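(* Let $\Omega\subset\mathbb{R}^2$ be an equilateral triangle with side length $a$. Then $$\kappa_1=\mu_2=\frac{16\pi^2}{9a^2}.$$ Moreover, the eigenspace of $\kappa_1$ with respect to the boundary mean zero Laplacian with constant Neumann data and the eigenspace of $\mu_2$ with respect to the Neumann Laplacian are the same.
   Context: $\mu_2$ is the second Neumann Laplacian eigenvalue of $\Omega$ (the first being $0$), and $$\kappa_1=\inf\Big\{\frac{\int_\Omega|\nabla u|^2\,dx}{\int_\Omega u^2\,dx}:\ u\in H^1(\Omega)\setminus\{0\},\ \int_{\partial\Omega}u\,d\sigma=0\Big\}.$$ The eigenspace of $\kappa_1$ (boundary mean zero Laplacian with constant Neumann data) consists of $0$ and the functions attaining this infimum, i.e. the weak solutions $w\in H^1(\Omega)$ of $-\Delta w=\kappa_1w$ in $\Omega$, $\partial_\nu w=-\frac{\kappa_1}{P(\Omega)}\int_\Omega w\,dx$ on $\partial\Omega$, $\int_{\partial\Omega}w\,d\sigma=0$, where $P(\Omega)$ is the perimeter, $\nu$ the outer unit normal and $d\sigma$ the boundary measure. *)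

(* Defs.v *)
From HB Require Import structures.
From mathcomp Require Import all_boot all_order all_algebra.
From mathcomp Require Import all_classical all_reals all_analysis.
Import Order.TTheory GRing.Theory Num.Theory.
Import numFieldNormedType.Exports.

Set Implicit Arguments.
Unset Strict Implicit.
Unset Printing Implicit Defensive.

Local Open Scope classical_set_scope.
Local Open Scope ring_scope.

Section Plane.
Context {R : realType}.
Implicit Types (D : set (R * R)) (f u v phi : R * R -> R).
Implicit Types (g h : R * R -> R * R).

Definition leb2 :
  {measure set (measurableTypeR R * measurableTypeR R) -> \bar R} :=
  (@lebesgue_measure R \x @lebesgue_measure R)%E.

(* The library norm on [R * R] is the max norm, hence the explicit Euclidean
   formulas below. *)
Definition dotp (x y : R * R) : R := x.1 * y.1 + x.2 * y.2.
Definition edist (x y : R * R) : R := Num.sqrt (dotp (x - y) (x - y)).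

(* C^oo on the whole plane: every iterated directional derivative is
   (Frechet) differentiable everywhere, hence in particular continuous. *)
Definition smooth f : Prop :=
  forall (s : seq (R * R)) (x : R * R),
    differentiable (foldr (fun e k => 'D_e k) f s : R * R -> R) x.

Definition d1 f : R * R -> R := 'D_((1, 0) : R * R) f.
Definition d2 f : R * R -> R := 'D_((0, 1) : R * R) f.
Definition gradient f : R * R -> R * R := fun x => (d1 f x, d2 f x).

(* C_c^oo(D) *)
Definition test_function D phi : Prop :=
  smooth phi /\
  exists K : set (R * R),
    [/\ compact K, K `<=` D & forall x, ~ K x -> phi x = 0].

(* Functions are total on the plane, but only their values on D matter. *)
Definition L2 D f : Prop :=
  measurable_fun D f /\ leb2.-integrable D (fun x => ((f x) ^+ 2)%:E).

(* u is in H^1(D) and g is (a representative of) its weak gradient. *)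
Definition H1 D u g : Prop :=
  [/\ L2 D u, L2 D (fun x => (g x).1), L2 D (fun x => (g x).2) &
      forall phi, test_function D phi ->
        \int[leb2]_(x in D) (u x * d1 phi x)
          = - (\int[leb2]_(x in D) ((g x).1 * phi x)) /\
        \int[leb2]_(x in D) (u x * d2 phi x)
          = - (\int[leb2]_(x in D) ((g x).2 * phi x))].

Definition ae_zero D u : Prop := {ae leb2, forall x, D x -> u x = 0}.

(* Eigenspace, for the parameter m, of the Neumann Laplacian on D, in the weak
   formulation; it is {u | u = 0 a.e. on D} when m is not an eigenvalue. *)
Definition neumann_eigenspace D (m : R) : set (R * R -> R) :=
  [set u | exists g, H1 D u g /\
    forall v h, H1 D v h ->
      \int[leb2]_(x in D) dotp (g x) (h x)
        = m * \int[leb2]_(x in D) (u x * v x)].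

Definition lin_indep D (k : nat) (u : 'I_k -> R * R -> R) : Prop :=
  forall c : 'I_k -> R,
    ae_zero D (fun x => \sum_(i < k) c i * u i x) -> forall i, c i = 0.

(* The k-th Neumann eigenvalue (k >= 1, so that neumann_mu D 1 = 0), counted
   with multiplicity in nondecreasing order: the least m such that there are
   k linearly independent eigenfunctions with eigenvalues at most m. *)
Definition neumann_mu D (k : nat) : R :=
  inf [set m : R | exists u : 'I_k -> R * R -> R,
    lin_indep D u /\
    forall i, exists2 l : R, l <= m & neumann_eigenspace D l (u i)].

End Plane.

Section Triangle.
Context {R : realType}.
Variable V : 'I_3 -> R * R.
Implicit Types (u v w tau s f : R * R -> R) (g h : R * R -> R * R).

Definition open_triangle : set (R * R) :=
  [set x | exists c : 'I_3 -> R,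
    [/\ forall i, 0 < c i, \sum_(i < 3) c i = 1 &
        x = \sum_(i < 3) c i *: V i]].

Definition equilateral (a : R) : Prop :=
  forall i j : 'I_3, i != j -> edist (V i) (V j) = a.

Definition side (i : 'I_3) (t : R) : R * R :=
  (1 - t) *: V i + t *: V (ordS i).

Definition side_length (i : 'I_3) : R := edist (V i) (V (ordS i)).

Definition perimeter : R := \sum_(i < 3) side_length i.

(* Integral over the boundary of the triangle with respect to arc length. *)
Definition boundary_int f : R :=
  \sum_(i < 3) side_length i *
    \int[@lebesgue_measure R]_(t in `[0, 1]) f (side i t).

Definition boundary_L2 f : Prop :=
  forall i : 'I_3,
    measurable_fun `[(0 : R), 1] (fun t => f (side i t)) /\
    (@lebesgue_measure R).-integrable `[0, 1]
      (fun t => ((f (side i t)) ^+ 2)%:E).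

(* tau is the trace of u (whose weak gradient is g): the trace operator is the
   continuous extension H^1 -> L^2(boundary) of the restriction map on
   C^oo(closure), i.e. its graph is the closure of that of the restriction
   map. Only the values of tau on the boundary matter. *)
Definition trace_of u g tau : Prop :=
  boundary_L2 tau /\
  exists phi : nat -> R * R -> R,
    [/\ forall n, smooth (phi n),
        (fun n => \int[leb2]_(x in open_triangle) ((phi n x - u x) ^+ 2))
          @ \oo --> (0 : R),
        (fun n => \int[leb2]_(x in open_triangle)
            dotp (gradient (phi n) x - g x) (gradient (phi n) x - g x))
          @ \oo --> (0 : R) &
        (fun n => boundary_int (fun x => (phi n x - tau x) ^+ 2))
          @ \oo --> (0 : R)].

(* [H1t u g tau]: u is in H^1, with weak gradient g and trace tau. *)
Definition H1t u g tau : Prop := H1 open_triangle u g /\ trace_of u g tau.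

Definition kappa1 : R :=
  inf [set q : R | exists u g tau,
    [/\ H1t u g tau, ~ ae_zero open_triangle u, boundary_int tau = 0 &
        q = (\int[leb2]_(x in open_triangle) dotp (g x) (g x))
            / (\int[leb2]_(x in open_triangle) ((u x) ^+ 2))]].

(* Weak solutions of  - Laplacian w = k w  in the triangle, with constant
   normal derivative  - (k / perimeter) * \int w  and zero boundary mean. *)
Definition bmz_eigenspace (k : R) : set (R * R -> R) :=
  [set w | exists g tau,
    [/\ H1t w g tau, boundary_int tau = 0 &
        forall v h s, H1t v h s ->
          \int[leb2]_(x in open_triangle) dotp (g x) (h x)
            = k * \int[leb2]_(x in open_triangle) (w x * v x)
              - k / perimeter * (\int[leb2]_(x in open_triangle) w x)
                * boundary_int s]].

End Triangle.

(* Main.v *)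
(* The value mu2 = 16 pi^2 / (9 a^2) comes from unfolding the triangle.  The
   trigonometric polynomials invariant under the reflection group form an
   algebra that separates the points of the triangle, hence they are dense in
   L^2; they satisfy the Neumann condition and diagonalize the Laplacian, with
   eigenvalues mu2 * N, N being the norm of an Eisenstein integer.  This gives
   the Poincare inequality with constant mu2 and the Neumann eigenspace of mu2.

   For kappa1, put Q(u, v) = \int grad u . grad v - mu2 \int u v.  In
   barycentric coordinates c_i, the function
     w = sum_i cos (2 z0 (c_i - 1/2)),  z0 = pi / sqrt 3,
   solves - Laplacian w = mu2 w with a constant nonzero normal derivative, so
   that Q(w, u) = - s \int_boundary u for some s > 0; moreover
   \int_boundary w > 0.  If u has zero boundary mean and t is chosen such that
   u - t w has zero mean, the Poincare inequality for u - t w reads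
     0 <= Q(u, u) + t^2 Q(w, w)  with  Q(w, w) < 0.
   Hence Q(u, u) >= 0, with equality only if \int u = 0, in which case the two
   eigenvalue problems coincide. *)
Require Import Defs.
From HB Require Import structures.
From mathcomp Require Import all_boot all_order all_algebra all_fingroup.
From mathcomp Require Import all_classical all_reals all_analysis.
From mathcomp Require Import measurable_realfun ring lra zify complex.
Import Order.TTheory GRing.Theory Num.Theory.
Import numFieldNormedType.Exports.

Set Implicit Arguments.
Unset Strict Implicit.
Unset Printing Implicit Defensive.

Local Open Scope classical_set_scope.
Local Open Scope ring_scope.

(** Three obstacles shape the proof. Membership in H^1 is tested only by compactly supported smooth
    functions; so the Neumann condition of a trigonometric polynomial is recorded as a bound
    [C * bary] on its normal derivative, whose factor cancels the growth [n] of the gradient of a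
    cutoff in a layer of width [1/n]. This yields Green's formula against every H^1 function.
    Density avoids uniform approximation: the sets whose indicators are L^2 limits of the algebra
    form a sigma-algebra, and separation of points makes it contain every measurable set. Separation
    holds because three unit complex numbers with product 1 are determined by their sum. The
    boundary term for [kappa1] is computed for smooth functions by slicing the triangle parallel to
    its sides, then passed to the limit that defines traces.

    The competitor works because each summand depends on one coordinate and is even about 1/2: along
    a side two of the three fluxes cancel and the third is constant. For the eigenspaces, the
    Neumann problem tests functions that are not given a trace; Cauchy-Schwarz for the semidefinite
    form Q reaches them. *)

(** * Square integrable functions and their inner product *)

Section SquareIntegrable.
Context {d} {S : measurableType d} {R : realType}.
Variables (m : {measure set S -> \bar R}) (D : set S).
Hypothesis mD : measurable D.
Implicit Types f g : S -> R.

(** With [leb2] this unfolds to [L2]. The measure is arbitrary because the sides of the triangle,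
    parametrized by [[0, 1]], use the same calculus: [boundary_L2] is [sqi] on each of them. *)
Definition sqi f :=
  measurable_fun D f /\ m.-integrable D (fun x => ((f x) ^+ 2)%:E).

Definition ip f g : R := \int[m]_(x in D) (f x * g x).

Lemma sqi_mul f g : sqi f -> sqi g ->
  m.-integrable D (fun x => (f x * g x)%:E).
Proof.
move=> [mf if2] [mg ig2].
apply: (@le_integrable _ _ _ m D mD _
   (fun x => ((f x) ^+ 2)%:E + ((g x) ^+ 2)%:E)%E).
- by apply/measurable_EFinP; exact: measurable_funM.
- move=> x _ /=; rewrite lee_fin [leRHS]ger0_norm; last by rewrite addr_ge0 ?sqr_ge0.
  have := sqr_ge0 (f x + g x); have := sqr_ge0 (f x - g x).
  by rewrite ler_norml => h1 h2; apply/andP; split; nra.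
- exact: integrableD.
Qed.

Lemma sqiD f g : sqi f -> sqi g -> sqi (fun x => f x + g x).
Proof.
move=> sf sg; have ifg := sqi_mul sf sg; have [mf if2] := sf; have [mg ig2] := sg.
split; first exact: measurable_funD.
apply: (@eq_integrable _ _ _ m D mD (fun x => ((f x) ^+ 2)%:E +
   (((g x) ^+ 2)%:E + ((f x * g x)%:E + (f x * g x)%:E)))%E).
  by move=> x _ /=; rewrite -!EFinD; congr (_%:E); ring.
by apply: integrableD => //; apply: integrableD => //; apply: integrableD.
Qed.

Lemma sqiZ k f : sqi f -> sqi (fun x => k * f x).
Proof.
move=> [mf if2]; split; first by apply: measurable_funM.
apply: (@eq_integrable _ _ _ m D mD (fun x => (k ^+ 2)%:E * ((f x) ^+ 2)%:E)%E).
  by move=> x _ /=; rewrite -EFinM; congr (_%:E); ring.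
exact: integrableZl.
Qed.

Lemma sqiB f g : sqi f -> sqi g -> sqi (fun x => f x - g x).
Proof.
move=> sf /(sqiZ (-1)) sg; have := sqiD sf sg.
by under eq_fun do rewrite mulN1r.
Qed.

Lemma sqi_cst0 : sqi (fun=> 0).
Proof.
split; first exact: measurable_cst.
rewrite expr0n /=; exact: integrable0.
Qed.

Lemma sqi_sum (I : Type) (r : seq I) (F : I -> S -> R) :
  (forall i, sqi (F i)) -> sqi (fun x => \sum_(i <- r) F i x).
Proof.
move=> sF; elim: r => [|i r IH].
  by under eq_fun do rewrite big_nil; exact: sqi_cst0.
by under eq_fun do rewrite big_cons; exact: sqiD.
Qed.

Lemma sqi_eq f g : (forall x, D x -> f x = g x) -> sqi f -> sqi g.
Proof.
move=> fg [mf if2]; split.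
  by apply: eq_measurable_fun mf => x /set_mem Dx; exact: fg.
by apply: eq_integrable if2 => // x /set_mem Dx /=; rewrite fg.
Qed.

Lemma sqi_bounded (M : R) f : (m D < +oo)%E -> measurable_fun D f ->
  (forall x, D x -> `|f x| <= M) -> sqi f.
Proof.
move=> mDoo mf fM; split=> //.
apply: (@le_integrable _ _ _ m D mD _ (cst (M ^+ 2)%:E)).
- by apply/measurable_EFinP; exact: measurable_funX.
- move=> x Dx /=; rewrite lee_fin !ger0_norm ?sqr_ge0// -(real_normK (num_real (f x))).
  by rewrite lerXn2r ?nnegrE ?normr_ge0 ?fM// (le_trans _ (fM x Dx)).
- apply/integrableP; split; first exact: measurable_cst.
  by rewrite integral_cst//= lte_mul_pinfty// ?lee_fin.
Qed.

Lemma ipC f g : ip f g = ip g f.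
Proof. by apply: eq_Rintegral => x _; rewrite mulrC. Qed.

Lemma eq_ip f g f' g' : (forall x, D x -> f x = f' x) ->
  (forall x, D x -> g x = g' x) -> ip f g = ip f' g'.
Proof.
by move=> ff gg; apply: eq_Rintegral => x /set_mem Dx; rewrite ff ?gg.
Qed.

Lemma ipDl f g h : sqi f -> sqi g -> sqi h ->
  ip (fun x => f x + g x) h = ip f h + ip g h.
Proof.
move=> sf sg sh; rewrite /ip; under eq_Rintegral do rewrite mulrDl.
by rewrite RintegralD//; exact: sqi_mul.
Qed.

Lemma ipZl k f h : sqi f -> sqi h -> ip (fun x => k * f x) h = k * ip f h.
Proof.
move=> sf sh; rewrite /ip; under eq_Rintegral do rewrite -mulrA.
by rewrite RintegralZl//; exact: sqi_mul.
Qed.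

Lemma ipBl f g h : sqi f -> sqi g -> sqi h ->
  ip (fun x => f x - g x) h = ip f h - ip g h.
Proof.
move=> sf sg sh; rewrite /ip; under eq_Rintegral do rewrite mulrBl.
by rewrite RintegralB//; exact: sqi_mul.
Qed.

Lemma ipDr f g h : sqi f -> sqi g -> sqi h ->
  ip h (fun x => f x + g x) = ip h f + ip h g.
Proof. by move=> sf sg sh; rewrite ipC ipDl// !(ipC h). Qed.

Lemma ipZr k f h : sqi f -> sqi h -> ip h (fun x => k * f x) = k * ip h f.
Proof. by move=> sf sh; rewrite ipC ipZl// ipC. Qed.

Lemma ipBr f g h : sqi f -> sqi g -> sqi h ->
  ip h (fun x => f x - g x) = ip h f - ip h g.
Proof. by move=> sf sg sh; rewrite ipC ipBl// !(ipC h). Qed.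

Lemma ip0l h : ip (fun=> 0) h = 0.
Proof.
rewrite /ip; under eq_Rintegral do rewrite mul0r.
by rewrite Rintegral_cst// mul0r.
Qed.

Lemma ip_suml (I : Type) (r : seq I) (F : I -> S -> R) h :
  (forall i, sqi (F i)) -> sqi h ->
  ip (fun x => \sum_(i <- r) F i x) h = \sum_(i <- r) ip (F i) h.
Proof.
move=> sF sh; elim: r => [|i r IH].
  by under [in LHS]eq_fun do rewrite big_nil; rewrite big_nil ip0l.
under [in LHS]eq_fun do rewrite big_cons.
by rewrite ipDl// ?IH ?big_cons//; exact: sqi_sum.
Qed.

Lemma ip_ge0 f : 0 <= ip f f.
Proof. by apply: Rintegral_ge0 => x _; rewrite -expr2 sqr_ge0. Qed.

Lemma ip_sqr f : ip f f = \int[m]_(x in D) (f x ^+ 2).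
Proof. by apply: eq_Rintegral => x _; rewrite expr2. Qed.

(** The case [z = 0] matters: the lemma gives Cauchy-Schwarz both for [ip] and for the form Q of the
    overview, which are only semidefinite. There a nonzero [y] would make the polynomial affine and
    equal to [- 1] somewhere. *)
Lemma quadratic_ge0_discr (x y z : R) :
  (forall t, 0 <= x + 2 * t * y + t ^+ 2 * z) -> 0 <= z -> y ^+ 2 <= x * z.
Proof.
move=> h; rewrite le_eqVlt => /predU1P[z0|z0].
  rewrite -z0 mulr0; have [->|y0] := eqVneq y 0; first by rewrite expr0n.
  have := h (- (x + 1) / (2 * y)); rewrite -z0 mulr0 addr0.
  have -> : x + 2 * (- (x + 1) / (2 * y)) * y = -1 by field.
  by rewrite lerNr oppr0 ler10.
have := h (- y / z).
have -> : x + 2 * (- y / z) * y + (- y / z) ^+ 2 * z = (x * z - y ^+ 2) / z.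
  by field; rewrite gt_eqF.
by rewrite pmulr_lge0 ?invr_gt0// subr_ge0.
Qed.

Lemma cauchy_schwarz f g : sqi f -> sqi g -> ip f g ^+ 2 <= ip f f * ip g g.
Proof.
move=> sf sg; apply: quadratic_ge0_discr (ip_ge0 g) => t.
have stg := sqiZ t sg.
have := ip_ge0 (fun x => f x + t * g x).
rewrite ipDl ?ipDr// ?ipZl ?ipZr//; try exact: sqiD.
by rewrite (ipC g f); congr (0 <= _); ring.
Qed.

Lemma ip_eq0_ae f : sqi f -> ip f f = 0 ->
  {ae m, forall x, D x -> f x = 0}.
Proof.
move=> [mf if2] f0.
have mf2 : measurable_fun D (EFin \o (fun x => f x ^+ 2)).
  by apply/measurable_EFinP; exact: measurable_funX.
have /(ae_eq_integral_abs m mD) H := mf2.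
have : (\int[m]_(x in D) `|(f x ^+ 2)%:E| = 0)%E.
  under eq_integral do rewrite abse_EFin ger0_norm ?sqr_ge0//.
  have := integrable_fin_num mD if2.
  move=> /fineK <-; congr (_%:E).
  by rewrite -[RHS]f0 ip_sqr.
move=> /H; apply: filterS => x /= h Dx; have := h Dx => -[] /eqP.
by rewrite sqrf_eq0 => /eqP.
Qed.

Lemma ae_eq0_ip f g : sqi f -> sqi g -> {ae m, forall x, D x -> f x = 0} ->
  ip f g = 0.
Proof.
move=> sf sg f0; rewrite /ip /Rintegral.
rewrite (@ae_eq_integral _ _ _ m D (cst 0%E) _ mD)//=.
- by rewrite integral0.
- by have /measurable_int := sqi_mul sf sg.
- by apply: filterS f0 => x h Dx; rewrite h// mul0r.
Qed.

Lemma cvg_ip0 (F : nat -> S -> R) g : (forall n, sqi (F n)) -> sqi g ->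
  (fun n => ip (F n) (F n)) @ \oo --> (0 : R) ->
  (fun n => ip (F n) g) @ \oo --> (0 : R).
Proof.
move=> sF sg F0.
have H : (fun n => ip (F n) g ^+ 2) @ \oo --> (0 : R).
  apply: (@squeeze_cvgr _ _ _ R (fun=> 0) (fun n => ip (F n) (F n) * ip g g)).
  - by apply: nearW => n; rewrite sqr_ge0 cauchy_schwarz.
  - exact: cvg_cst.
  - by rewrite -(mul0r (ip g g)); apply: cvgM => //; exact: cvg_cst.
apply/norm_cvg0P; have -> : (fun n => `|ip (F n) g|) = Num.sqrt \o (fun n => ip (F n) g ^+ 2).
  by apply/funext => n /=; rewrite sqrtr_sqr.
rewrite -[X in _ --> X](sqrtr0); apply: continuous_cvg => //.
exact: sqrt_continuous.
Qed.

End SquareIntegrable.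

(** * Measurability in the plane and dominated convergence *)

Section PlaneMeasurability.
Context {R : realType}.
Notation plane := (measurableTypeR R * measurableTypeR R)%type.

(** The sigma-algebra of the plane is the product one, so [U] is rebuilt as the countable union of
    the rational boxes that it contains. *)
Lemma open_measurable2 (U : set (R * R)) :
  open U -> measurable (U : set plane).
Proof.
move=> oU.
pose box (q : rat * rat * rat * rat) : set (R * R) :=
  `]ratr q.1.1.1, ratr q.1.1.2[ `*` `]ratr q.1.2, ratr q.2[.
have -> : U = \bigcup_(q in setT) (if `[< box q `<=` U >] then box q else set0).
  apply/seteqP; split => [x Ux|x [q _]]; last by case: asboolP => // qU /qU.
  have /nbhs_ballP[e /= e0 xe] : nbhs x U by rewrite nbhsE; exists U.
  have lte (y : R) : y - e < y by rewrite ltrBlDr ltrDl.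
  have gte (y : R) : y < y + e by rewrite ltrDl.
  have [a] := rat_in_itvoo (lte x.1); rewrite in_itv /= => /andP[a1 a2].
  have [b] := rat_in_itvoo (gte x.1); rewrite in_itv /= => /andP[b1 b2].
  have [c] := rat_in_itvoo (lte x.2); rewrite in_itv /= => /andP[c1 c2].
  have [d] := rat_in_itvoo (gte x.2); rewrite in_itv /= => /andP[d1 d2].
  exists (a, b, c, d) => //; case: asboolP.
    by split; rewrite /= in_itv /= ?a2 ?b1 ?c2 ?d1.
  case; rewrite /box /= => y [] /=; rewrite !in_itv /= => /andP[y1 y2] /andP[y3 y4].
  by apply: xe; split; rewrite /= /ball /= ltr_norml; lra.
apply: countable_bigcupT_measurable => // q.
by case: asboolP => // _; apply: measurableX; exact: measurable_itv.
Qed.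

Lemma closed_measurable2 (U : set (R * R)) :
  closed U -> measurable (U : set plane).
Proof.
by move=> /closed_openC/open_measurable2/measurableC; rewrite setCK.
Qed.

Lemma continuous_measurable2 (f : R * R -> R) :
  continuous f -> measurable_fun setT (f : plane -> R).
Proof.
move=> /continuousP cf; apply: (measurability (@RGenOpens.G R)).
  exact: RGenOpens.measurableE.
move=> _ [_ [a [b ->] <-]]; rewrite setTI; apply: open_measurable2.
by apply: cf; exact: interval_open.
Qed.

End PlaneMeasurability.

Section RDominated.
Context {d} {S : measurableType d} {R : realType}.
Variables (m : {measure set S -> \bar R}) (D : set S).
Hypothesis mD : measurable D.

Lemma Rdominated (F : nat -> S -> R) (f g : S -> R) :
  (forall n, measurable_fun D (F n)) -> measurable_fun D f ->
  (forall x, D x -> (fun n => F n x) @ \oo --> f x) ->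
  m.-integrable D (EFin \o g) ->
  (forall n x, D x -> `|F n x| <= g x) ->
  (fun n => \int[m]_(x in D) F n x) @ \oo --> \int[m]_(x in D) f x.
Proof.
move=> mF mf Ff ig Fg.
have [|||||if_ _ H] := @dominated_convergence _ _ _ m D mD
  (fun n x => (F n x)%:E) (fun x => (f x)%:E) (fun x => (g x)%:E).
- by move=> n; exact/measurable_EFinP.
- exact/measurable_EFinP.
- apply: aeW => x Dx; apply: cvg_EFin; first exact: nearW.
  exact: Ff.
- exact: ig.
- by apply: aeW => x n Dx; rewrite lee_fin; exact: Fg.
have fi := integrable_fin_num mD if_.
by move: H; rewrite -(fineK fi) => /fine_cvgP[].
Qed.

End RDominated.

(** * Ridge functions and the flat cutoff profile *)

Section Smooth.
Context {R : realType}.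
Implicit Types (f g : R * R -> R) (x e b : R * R).

Lemma dotpDr b x y : dotp b (x + y) = dotp b x + dotp b y.
Proof. by rewrite /dotp /=; ring. Qed.

Lemma dotpZr b k x : dotp b (k *: x) = k * dotp b x.
Proof. by rewrite /dotp /= /GRing.scale /=; ring. Qed.

Lemma dotp_is_linear b : linear (dotp b).
Proof. by move=> k x y; rewrite dotpDr dotpZr. Qed.

HB.instance Definition _ b :=
  GRing.isLinear.Build R (R * R)%type R _ (dotp b) (dotp_is_linear b).

Lemma dotp_continuous b : continuous (dotp b).
Proof.
move=> x; rewrite /dotp; apply: cvgD; apply: cvgMr.
- exact: cvg_fst.
- exact: cvg_snd.
Qed.

Lemma dotp_differentiable b x : differentiable (dotp b) x.
Proof. exact/linear_differentiable/dotp_continuous. Qed.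

Lemma affine_differentiable b c x :
  differentiable (fun y => dotp b y + c) x.
Proof.
by apply: differentiableD => //; exact: dotp_differentiable.
Qed.

Lemma affine_is_derive b c x e :
  is_derive x e (fun y => dotp b y + c) (dotp b e).
Proof.
apply: DeriveDef; first exact/diff_derivable/affine_differentiable.
rewrite deriveE; last exact: affine_differentiable.
rewrite diffD//; last exact: dotp_differentiable.
rewrite diff_cst; transitivity ('d (dotp b) x e); first exact: addr0.
by rewrite diff_lin//; exact: dotp_continuous.
Qed.

Lemma ridge_differentiable (g : R -> R) b c x :
  derivable g (dotp b x + c) 1 ->
  differentiable (fun y => g (dotp b y + c)) x.
Proof.
move=> /derivable1_diffP dg.
apply: (@differentiable_comp _ _ _ _ (fun y => dotp b y + c) g) => //.
exact: affine_differentiable.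
Qed.

Lemma ridge_derive (g : R -> R) b c x e :
  derivable g (dotp b x + c) 1 ->
  'D_e (fun y => g (dotp b y + c)) x = dotp b e * derive1 g (dotp b x + c).
Proof.
move=> dg; rewrite deriveE; last exact: ridge_differentiable.
have da := affine_differentiable b c x.
have := @diff_comp _ _ _ _ (fun y => dotp b y + c) g x da
  ((derivable1_diffP _ _).1 dg).
rewrite /comp => ->.
rewrite /= -(deriveE _ da) (@derive_val _ _ _ _ _ _ _ (affine_is_derive b c x e)).
by rewrite deriv1E.
Qed.

Lemma smooth_differentiable f : smooth f -> forall x, differentiable f x.
Proof. by move=> sf x; exact: (sf [::]). Qed.

Lemma smooth_derive f e : smooth f -> smooth ('D_e f).
Proof. by move=> sf s x; have := sf (rcons s e) x; rewrite foldr_rcons. Qed.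

Lemma smooth_continuous f : smooth f -> continuous f.
Proof.
by move=> sf x; exact/differentiable_continuous/smooth_differentiable.
Qed.

Lemma derive_coord f x e : differentiable f x ->
  'D_e f x = e.1 * d1 f x + e.2 * d2 f x.
Proof.
move=> df; rewrite /d1 /d2 !deriveE//.
have {1}-> : e = e.1 *: (1, 0) + e.2 *: (0, 1).
  by apply: injective_projections; rewrite /= /GRing.scale /=; ring.
by rewrite linearD !linearZ.
Qed.

(* [rho 0] is the cutoff profile; its derivatives are combinations of the other
   [rho k]. *)
Definition rho (k : nat) (t : R) : R :=
  if 0 < t then t ^- k * expR (- t^-1) else 0.

Lemma rho_ge0 k t : 0 <= rho k t.
Proof.
by rewrite /rho; case: ifP => // t0; rewrite mulr_ge0 ?expR_ge0// invr_ge0 exprn_ge0// ltW.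
Qed.

(** From [y <= 1 + y <= expR y] at [y = 1 / (n t)] follows [expR (- 1 / (n t)) <= n t]; the [n]-th
    power of this bounds [expR (- 1 / t)]. *)
Lemma rho_le k n t : 0 < t -> rho k t <= n%:R ^+ n * (t ^+ n / t ^+ k).
Proof.
move=> t0; rewrite /rho t0; case: n => [|n].
  rewrite !expr0 !mul1r ler_piMr ?invr_ge0 ?exprn_ge0 ?ltW//.
  by rewrite -expR0 ltr_expR oppr_lt0 invr_gt0.
have -> : n.+1%:R ^+ n.+1 * (t ^+ n.+1 / t ^+ k) = t ^- k * (n.+1%:R * t) ^+ n.+1.
  by rewrite exprMn; ring.
rewrite ler_wpM2l ?invr_ge0 ?exprn_ge0 ?(ltW t0)//.
have -> : expR (- t^-1) = expR (- (n.+1%:R * t)^-1) ^+ n.+1.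
  rewrite -expRM_natl; congr expR.
  by rewrite invfM mulrN mulrA divff ?mul1r// pnatr_eq0.
have p : 0 < n.+1%:R * t by rewrite mulr_gt0.
apply: lerXn2r; rewrite ?nnegrE ?expR_ge0 ?(ltW p)//.
rewrite expRN -[X in _ <= X]invrK lef_pV2 ?posrE ?expR_gt0 ?invr_gt0//.
by rewrite (le_trans _ (expR_ge1Dx _))// lerDr.
Qed.

Lemma rho_le_sqr k : exists2 C : R, 0 <= C & forall t, rho k t <= C * t ^+ 2.
Proof.
exists ((k + 2)%:R ^+ (k + 2)); first by rewrite exprn_ge0.
move=> t; case: (ltP 0 t) => t0; last first.
  by rewrite /rho ltNge t0 /= mulr_ge0 ?sqr_ge0 ?exprn_ge0.
rewrite (le_trans (rho_le k (k + 2) t0))// ler_wpM2l ?exprn_ge0//.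
by rewrite exprD mulrAC divff ?mul1r// expf_neq0// gt_eqF.
Qed.

End Smooth.

Section Smooth2.
Context {R : realType}.
Implicit Types (f g : R * R -> R) (x e b : R * R).

Lemma rho_is_derive (k : nat) (t : R) :
  is_derive t (1 : R) (rho k) (rho k.+2 t - k%:R * rho k.+1 t).
Proof.
have [t0|t0|t0] := ltgtP t 0.
- apply: (@near_eq_is_derive _ _ _ (cst 0)).
    near=> s; rewrite /rho /= ifF//; apply/negbTE; rewrite -leNgt.
    by apply: ltW; near: s; exact: (lt_nbhsl t0).
  by rewrite /rho (lt_gtF t0) mulr0 subr0; exact: is_derive_cst.
- apply: (@near_eq_is_derive _ _ _
    ((fun s : R => s^-1 : R) ^+ k * (fun s : R => expR (- s^-1)))).
    near=> s; rewrite !fctE /rho ifT ?exprVn//.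
    by near: s; exact: (lt_nbhsr t0).
  have tn0 : t != 0 by rewrite gt_eqF.
  have dV : is_derive t 1 (fun s : R => s^-1) (- t ^- 2 *: 1).
    by apply: is_deriveV.
  have dX := is_deriveX k dV.
  have dE : is_derive t 1 (fun s : R => expR (- s^-1))
     (expR (- t^-1) * (t ^- 2)).
    apply: (@is_derive1_comp _ expR (fun s => - s^-1)).
    apply: (is_derive_eq (is_deriveN dV)).
    by rewrite /GRing.scale /= mulr1 opprK.
  apply: (is_derive_eq (is_deriveM dX dE)).
  rewrite !fctE /rho t0 /GRing.scale /= mulr1 !exprVn; case: k {dX} => [|k].
    by field.
  rewrite -pred_Sn !(exprS t). field.
  by rewrite ?tn0 ?expf_neq0.
(* At 0 the slope function is [rho k z / z], at most [C * |z|] in absolute value by [rho_le_sqr];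
   its value at 0 is 0 by the convention [0^-1 = 0], which is the derivative sought. *)
- subst t; rewrite {2 3}/rho ltxx mulr0 subr0.
  have [C C0 hC] := @rho_le_sqr R k.
  apply/is_derive1_caratheodory; exists (fun z => rho k z / z); split.
  + move=> z; rewrite /rho ltxx subr0 [in RHS]subr0.
    have [->|z0] := eqVneq z 0; first by rewrite ltxx mulr0.
    by rewrite divfK.
  + rewrite /prop_for /continuous_at /= invr0 mulr0.
    apply/norm_cvg0P.
    apply: (@squeeze_cvgr _ _ _ R (fun=> 0) (fun z => C * `|z|)).
    * apply: nearW => z; rewrite normr_ge0 /=.
      have [->|z0] := eqVneq z 0; first by rewrite invr0 mulr0 normr0 mulr0.
      rewrite normrM normfV ler_pdivrMr ?normr_gt0// ger0_norm ?rho_ge0//.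
      by rewrite -mulrA -expr2 real_normK ?num_real.
    * exact: cvg_cst.
    * rewrite -[X in _ --> X](mulr0 C); apply: cvgM; first exact: cvg_cst.
      by have := @norm_continuous _ R^o (0 : R); rewrite /continuous_at normr0.
  + by rewrite invr0 mulr0.
Unshelve. all: by end_near.
Qed.

End Smooth2.

(** * A class of smooth functions stable under differentiation *)

Section Tame.
Context {R : realType}.
Implicit Types (f g : R * R -> R) (x e b : R * R).

(* Two classes closed under differentiation, so that membership gives
   smoothness by induction on the order of the derivative. *)
Inductive profile : (R -> R) -> Prop :=
| profile_cos d : profile (fun t => cos (t + d))
| profile_rho k : profile (rho k)
| profile_add (g h : R -> R) : profile g -> profile h -> profile (fun t => g t + h t)
| profile_scale a (g : R -> R) : profile g -> profile (fun t => a * g t).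

Inductive tame : (R * R -> R) -> Prop :=
| tame_ridge (g : R -> R) b c : profile g -> tame (fun x => g (dotp b x + c))
| tame_add f g : tame f -> tame g -> tame (fun x => f x + g x)
| tame_mul f g : tame f -> tame g -> tame (fun x => f x * g x)
| tame_scale a f : tame f -> tame (fun x => a * f x).

Lemma cos_shift_is_derive (t d : R) :
  is_derive t (1 : R) (fun t => cos (t + d)) (- sin (t + d)).
Proof.
apply: (@is_derive_eq _ _ _ _ _ _ _ (- sin (t + d) * 1)); last by rewrite mulr1.
by apply: (@is_derive1_comp _ cos (fun t => t + d)); exact: is_derive_shift.
Qed.

Lemma derive1_eq (g h : R -> R) :
  (forall t, is_derive t (1 : R) g (h t)) -> derive1 g = h.
Proof. by move=> gh; apply/funext => t; rewrite derive1E; exact: derive_val. Qed.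

Lemma profile_derive (g : R -> R) : profile g ->
  (forall t, derivable g t (1 : R)) /\ profile (derive1 g).
Proof.
elim=> {g} [d|k|g h _ [dg pg] _ [dh ph]|a g _ [dg pg]].
- split; first by move=> t; have [] := cos_shift_is_derive t d.
  rewrite (derive1_eq (cos_shift_is_derive ^~ d)).
  have -> : (fun t : R => - sin (t + d)) = (fun t => cos (t + (d + pi / 2))).
    by apply/funext => t; rewrite addrA cosDpihalf.
  exact: profile_cos.
- split; first by move=> t; have [] := rho_is_derive k t.
  rewrite (derive1_eq (rho_is_derive k)).
  have -> : (fun t : R => rho k.+2 t - k%:R * rho k.+1 t) =
            (fun t => rho k.+2 t + - k%:R * rho k.+1 t).
    by apply/funext => t; rewrite mulNr.
  apply: profile_add; first exact: profile_rho.
  by apply: profile_scale; exact: profile_rho.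
- split; first by move=> t; exact: derivableD.
  have -> : derive1 (fun t => g t + h t) = (fun t => derive1 g t + derive1 h t).
    by apply/funext => t; rewrite !derive1E; exact: deriveD.
  exact: profile_add.
- split; first by move=> t; exact: (@derivableZ R R^o R^o).
  have -> : derive1 (fun t => a * g t) = (fun t => a * derive1 g t).
    by apply/funext => t; rewrite !derive1E; exact: (@deriveZ R R^o R^o).
  exact: profile_scale.
Qed.

Lemma tame_derive f : tame f ->
  (forall x, differentiable f x) /\ forall e, tame ('D_e f).
Proof.
elim=> {f} [g b c /profile_derive[dg pg]|f g tf [df pf] tg [dg pg]
  |f g tf [df pf] tg [dg pg]|a f tf [df pf]].
- split=> [x|e]; first exact: ridge_differentiable.
  have -> : 'D_e (fun x => g (dotp b x + c)) =
            (fun x => dotp b e * derive1 g (dotp b x + c)).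
    by apply/funext => x; rewrite ridge_derive.
  exact/tame_scale/tame_ridge.
- split=> [x|e]; first exact: differentiableD.
  have -> : 'D_e (fun x => f x + g x) = (fun x => 'D_e f x + 'D_e g x).
    by apply/funext => x; apply: deriveD; exact: diff_derivable.
  exact: tame_add.
- split=> [x|e]; first exact: differentiableM.
  have -> : 'D_e (fun x => f x * g x) = (fun x => f x * 'D_e g x + g x * 'D_e f x).
    by apply/funext => x; apply: deriveM; exact: diff_derivable.
  by apply: tame_add; exact: tame_mul.
- split=> [x|e]; first exact: (@differentiableZ _ _ R^o).
  have -> : 'D_e (fun x => a * f x) = (fun x => a * 'D_e f x).
    by apply/funext => x; apply: (@deriveZ _ _ R^o); exact: diff_derivable.
  exact: tame_scale.
Qed.

Lemma tame_smooth f : tame f -> smooth f.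
Proof.
move=> tf s; suff /tame_derive[+ _] : tame (foldr (fun e k => 'D_e k) f s) by [].
by elim: s => //= e s /tame_derive[].
Qed.

Lemma tame_d1 f : tame f -> tame (d1 f).
Proof. by move=> /tame_derive[_]; exact. Qed.

Lemma tame_d2 f : tame f -> tame (d2 f).
Proof. by move=> /tame_derive[_]; exact. Qed.

Lemma tame_cst (k : R) : tame (fun=> k).
Proof.
have -> : (fun=> k) = (fun x => k * cos (dotp 0 x + 0 + 0)).
  by apply/funext => x; rewrite /dotp !mul0r !addr0 cos0 mulr1.
by apply: tame_scale; exact: (tame_ridge 0 0 (profile_cos 0)).
Qed.

Definition wave b d x : R := cos (dotp b x + d).

Lemma tame_wave b d : tame (wave b d).
Proof.
have -> : wave b d = (fun x => cos (dotp b x + d + 0)).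
  by apply/funext => x; rewrite addr0.
exact: (tame_ridge b d (profile_cos 0)).
Qed.

Lemma wave_derive b d e x :
  'D_e (wave b d) x = - dotp b e * sin (dotp b x + d).
Proof.
rewrite (@ridge_derive _ cos) //.
by rewrite derive1E derive_val mulrN mulNr.
Qed.

Lemma tame_cutoff (k : nat) b c : tame (fun x => rho k (dotp b x + c)).
Proof. exact: (tame_ridge b c (profile_rho k)). Qed.

Lemma cutoff_derive b c e x :
  'D_e (fun x => rho 0 (dotp b x + c)) x = dotp b e * rho 2 (dotp b x + c).
Proof.
have h := rho_is_derive 0 (dotp b x + c).
rewrite ridge_derive ?derive1E; last by case: h.
by rewrite derive_val mul0r subr0.
Qed.

(** At [t = n * c - 1], with [c] a barycentric coordinate, this is [c] times the size of the
    derivative of the [n]-th cutoff: the derivative blows up with [n], but its product with the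
    distance to the side does not. *)
Lemma rho2_bounded : exists C : R, forall t, 0 <= (t + 1) * rho 2 t <= C.
Proof.
have [C C0 hC] := @rho_le_sqr R 2.
exists (2 * C + 2) => t; case: (ltP 0 t) => t0; last first.
  by rewrite {1 2}/rho ltNge t0 /= mulr0 lexx /= addr_ge0// mulr_ge0.
have t1 : 0 <= t + 1 by lra.
rewrite mulr_ge0 ?rho_ge0//=; case: (leP t 1) => t2.
  have h : rho 2 t <= C.
    by rewrite (le_trans (hC t))// ler_piMr// expr_le1// ltW.
  have r0 := @rho_ge0 R 2 t; nra.
have h := rho_le 2 0 t0; rewrite expr0 mul1r expr0 mul1r in h.
have h2 : (t + 1) * rho 2 t <= (t + 1) * t ^- 2 by rewrite ler_wpM2l.
apply: (le_trans h2); rewrite ler_pdivrMr ?exprn_gt0//; nra.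
Qed.

Lemma cvg_invn : (fun n => n%:R^-1 : R) @ \oo --> (0 : R).
Proof. by rewrite -(cvg_shiftS (fun n => n%:R^-1 : R)); exact: cvg_harmonic. Qed.

Lemma rho2_scaled_cvg (s : R) : 0 < s ->
  (fun n => n%:R * s * rho 2 (n%:R * s - 1)) @ \oo --> (0 : R).
Proof.
move=> s0.
apply: (@squeeze_cvgr _ _ _ R (fun=> 0) (fun n => 4 / s * n%:R^-1)).
- near=> n.
  have h : 2 / s <= n%:R by near: n; exact: nbhs_infty_ger.
  have ns : 2 <= n%:R * s by move: h; rewrite ler_pdivrMr.
  have t0 : 0 < n%:R * s - 1 by lra.
  have ns0 : 0 <= n%:R * s by lra.
  rewrite mulr_ge0 ?rho_ge0 //=.
  have h1 := rho_le 2 0 t0; rewrite expr0 mul1r expr0 mul1r in h1.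
  set t := n%:R * s in ns t0 h1 *.
  have n0 : 0 < n%:R :> R by apply: lt_le_trans h; rewrite divr_gt0.
  have -> : 4 / s * n%:R^-1 = 4 / t by rewrite /t; field; rewrite !gt_eqF.
  have t2 : 0 < t by lra.
  (* For [t >= 2] one has [t <= 2 (t - 1)], hence [t / (t - 1)^2 <= 4 / t]. *)
  apply: (@le_trans _ _ (t * (t - 1) ^- 2)).
    by rewrite ler_wpM2l// ltW.
  rewrite ler_pdivrMr ?exprn_gt0// mulrAC ler_pdivlMr//; nra.
- exact: cvg_cst.
- rewrite -[X in _ --> X](mulr0 (4 / s)); apply: cvgM; first exact: cvg_cst.
  exact: cvg_invn.
Unshelve. all: by end_near.
Qed.

Lemma rho0_scaled_cvg (s : R) : 0 < s ->
  (fun n => rho 0 (n%:R * s - 1)) @ \oo --> (1 : R).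
Proof.
move=> s0.
apply: (@squeeze_cvgr _ _ _ R (fun n => 1 - 2 / s * n%:R^-1) (fun=> 1)).
- near=> n.
  have h : 2 / s <= n%:R by near: n; exact: nbhs_infty_ger.
  have ns : 2 <= n%:R * s by move: h; rewrite ler_pdivrMr.
  have t0 : 0 < n%:R * s - 1 by lra.
  have h1 := rho_le 0 0 t0; rewrite !expr0 invr1 !mul1r in h1.
  rewrite h1 andbT /rho t0 expr0 invr1 mul1r.
  set t := n%:R * s in ns t0 h1 *.
  have n0 : 0 < n%:R :> R by apply: lt_le_trans h; rewrite divr_gt0.
  have -> : 2 / s * n%:R^-1 = 2 / t by rewrite /t; field; rewrite !gt_eqF.
  apply: le_trans (expR_ge1Dx _); rewrite lerD2l lerN2.
  have t2 : 0 < t by lra.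
  rewrite -[(t - 1)^-1]mul1r ler_pdivrMr// mulrAC ler_pdivlMr//; lra.
- rewrite -[X in _ --> X]subr0; apply: cvgB; first exact: cvg_cst.
  rewrite -[X in _ --> X](mulr0 (2 / s)); apply: cvgM; first exact: cvg_cst.
  exact: cvg_invn.
- exact: cvg_cst.
Unshelve. all: by end_near.
Qed.

End Tame.

(** * Normals of an equilateral triangle *)

Section ThreePoints.
Context {R : realType}.
Implicit Types (P Q S x : R * R).

Lemma fst_scale (k : R) x : (k *: x).1 = k * x.1. Proof. by []. Qed.
Lemma snd_scale (k : R) x : (k *: x).2 = k * x.2. Proof. by []. Qed.
Lemma fst_add x y : (x + y).1 = x.1 + y.1. Proof. by []. Qed.
Lemma snd_add x y : (x + y).2 = x.2 + y.2. Proof. by []. Qed.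
Lemma fst_opp x : (- x).1 = - x.1. Proof. by []. Qed.
Lemma snd_opp x : (- x).2 = - x.2. Proof. by []. Qed.
Definition coordE :=
  (fst_scale, snd_scale, fst_add, snd_add, fst_opp, snd_opp).

Definition cross P Q S : R :=
  (Q.1 - P.1) * (S.2 - P.2) - (Q.2 - P.2) * (S.1 - P.1).

Lemma crossC P Q S : cross Q S P = cross P Q S.
Proof. by rewrite /cross; ring. Qed.

(** Gradient of the barycentric coordinate attached to [P]: orthogonal to [Q - S] and normalized by
    the signed double area, so that both orientations of the triangle are covered. *)
Definition side_normal P Q S : R * R :=
  ((cross P Q S)^-1 * (Q.2 - S.2), (cross P Q S)^-1 * (S.1 - Q.1)).

Variables (P Q S : R * R) (a : R).
Hypothesis a_gt0 : 0 < a.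
Hypotheses (PQ : dotp (P - Q) (P - Q) = a ^+ 2)
  (QS : dotp (Q - S) (Q - S) = a ^+ 2) (SP : dotp (S - P) (S - P) = a ^+ 2).

(** The metric hypotheses as three vanishing polynomials. The identities that follow hold modulo
    these; each proof supplies the explicit cofactors, after which [ring] or [field] can check the
    result. *)
Let H1 := (Q.1 - P.1) ^+ 2 + (Q.2 - P.2) ^+ 2 - a ^+ 2.
Let H2 := (S.1 - P.1) ^+ 2 + (S.2 - P.2) ^+ 2 - a ^+ 2.
Let H3 := (Q.1 - P.1) * (S.1 - P.1) + (Q.2 - P.2) * (S.2 - P.2) - a ^+ 2 / 2.
Let h1 : H1 = 0.
Proof. by rewrite /H1 -PQ /dotp /=; ring. Qed.
Let h2 : H2 = 0.
Proof. by rewrite /H2 -SP /dotp /=; ring. Qed.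
Let h3 : H3 = 0.
Proof.
have : (Q.1 - S.1) ^+ 2 + (Q.2 - S.2) ^+ 2 - a ^+ 2 = 0.
  by rewrite -QS /dotp /=; ring.
by move: h1 h2; rewrite /H1 /H2 /H3; lra.
Qed.

(** Lagrange's identity for [Q - P] and [S - P], whose squared lengths are [a^2] and whose inner
    product is [a^2 / 2]. *)
Lemma cross_sqr : cross P Q S ^+ 2 = 3 * a ^+ 4 / 4.
Proof.
have -> : cross P Q S ^+ 2 = (H1 + a ^+ 2) * (H2 + a ^+ 2) - (H3 + a ^+ 2 / 2) ^+ 2.
  by rewrite /cross /H1 /H2 /H3; ring.
by rewrite h1 h2 h3; field.
Qed.

Lemma cross_neq0 : cross P Q S != 0.
Proof.
rewrite -sqrf_eq0 cross_sqr gt_eqF// divr_gt0// mulr_gt0// exprn_gt0//.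
Qed.

Lemma side_normal_sqr :
  dotp (side_normal P Q S) (side_normal P Q S) = 4 / (3 * a ^+ 2).
Proof.
have -> : dotp (side_normal P Q S) (side_normal P Q S) =
   dotp (Q - S) (Q - S) / (cross P Q S) ^+ 2.
  by rewrite /dotp /side_normal /=; field; exact: cross_neq0.
by rewrite QS cross_sqr; field; rewrite gt_eqF.
Qed.

Lemma side_normal_dot :
  dotp (side_normal P Q S) (side_normal Q S P) = - 2 / (3 * a ^+ 2).
Proof.
have -> : dotp (side_normal P Q S) (side_normal Q S P) =
   (H3 - H2 - a ^+ 2 / 2) / (cross P Q S) ^+ 2.
  by rewrite /H3 /H2 /dotp /side_normal (crossC P Q S) /=; field; exact: cross_neq0.
by rewrite h2 h3 cross_sqr; field; rewrite gt_eqF.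
Qed.

(** In an equilateral triangle the altitude is also the median. Since [2 P - Q - S] is
    [(P - Q) + (P - S)], a derivative along the normal becomes a sum of derivatives along two sides,
    the form integrated by [div_triangle]. *)
Lemma side_normalE :
  side_normal P Q S = (2 / (3 * a ^+ 2)) *: (2 *: P - Q - S).
Proof.
have c0 := cross_neq0; have a0 : a != 0 by rewrite gt_eqF.
have e1 : cross P Q S * (2 * P.1 - Q.1 - S.1) = 3 * a ^+ 2 / 2 * (Q.2 - S.2).
  apply/eqP; rewrite -subr_eq0; apply/eqP.
  transitivity (- ((S.2 - P.2) * H1 - (Q.2 - P.2) * H2 + (S.2 - Q.2) * H3)).
    by rewrite /cross /H1 /H2 /H3; field.
  by rewrite h1 h2 h3; ring.
have e2 : cross P Q S * (2 * P.2 - Q.2 - S.2) = 3 * a ^+ 2 / 2 * (S.1 - Q.1).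
  apply/eqP; rewrite -subr_eq0; apply/eqP.
  transitivity (- (- (S.1 - P.1) * H1 + (Q.1 - P.1) * H2 + (Q.1 - S.1) * H3)).
    by rewrite /cross /H1 /H2 /H3; field.
  by rewrite h1 h2 h3; ring.
apply: injective_projections; rewrite !coordE /side_normal /=.
- have -> : Q.2 - S.2 = 2 / (3 * a ^+ 2) * (3 * a ^+ 2 / 2 * (Q.2 - S.2)).
    by field.
  by rewrite -e1; field; rewrite ?a0 ?c0.
- have -> : S.1 - Q.1 = 2 / (3 * a ^+ 2) * (3 * a ^+ 2 / 2 * (S.1 - Q.1)).
    by field.
  by rewrite -e2; field; rewrite ?a0 ?c0.
Qed.

End ThreePoints.

(** * Barycentric coordinates *)

Section Barycentric.
Context {R : realType}.
Variables (a : R) (V : 'I_3 -> R * R).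
Hypotheses (a_gt0 : 0 < a) (V_equilateral : equilateral V a).
Implicit Types (x e : R * R) (i j : 'I_3).

Definition i0 : 'I_3 := Ordinal (isT : (0 < 3)%N).
Definition i1 : 'I_3 := Ordinal (isT : (1 < 3)%N).
Definition i2 : 'I_3 := Ordinal (isT : (2 < 3)%N).

Lemma ordS0 : ordS i0 = i1. Proof. exact/val_inj. Qed.
Lemma ordS1 : ordS i1 = i2. Proof. exact/val_inj. Qed.
Lemma ordS2 : ordS i2 = i0. Proof. exact/val_inj. Qed.
Definition ordS012 := (ordS0, ordS1, ordS2).

Lemma I3P (P : 'I_3 -> Prop) : P i0 -> P i1 -> P i2 -> forall i, P i.
Proof.
by move=> p0 p1 p2 [[|[|[|//]]] h]; [move: p0|move: p1|move: p2];
  congr (P _); exact/val_inj.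
Qed.

Lemma big_I3 (F : 'I_3 -> R) : \sum_(i < 3) F i = F i0 + F i1 + F i2.
Proof.
rewrite !big_ord_recl big_ord0 addr0 addrA.
by congr (F _ + F _ + F _); exact/val_inj.
Qed.

Lemma big_I3v (F : 'I_3 -> R * R) : \sum_(i < 3) F i = F i0 + F i1 + F i2.
Proof.
rewrite !big_ord_recl big_ord0 addr0 addrA.
by congr (F _ + F _ + F _); exact/val_inj.
Qed.

Lemma dist_sqr i j : i != j -> dotp (V i - V j) (V i - V j) = a ^+ 2.
Proof.
move=> /V_equilateral <-; rewrite /edist sqr_sqrtr//.
by rewrite /dotp addr_ge0// -expr2 sqr_ge0.
Qed.

(** Gradient of [bary V i]: it points inward from the side opposite to [V i] and its length is the
    inverse of the height of the triangle. *)
Definition normal i : R * R := side_normal (V i) (V (ordS i)) (V (ordS (ordS i))).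

Definition offset i : R := - dotp (normal i) (V (ordS i)).

Definition bary i x : R := dotp (normal i) x + offset i.

Lemma cross_V0 i : cross (V i) (V (ordS i)) (V (ordS (ordS i))) != 0.
Proof.
by apply: (cross_neq0 a_gt0); apply: dist_sqr; move: i; apply: I3P.
Qed.

Lemma normal_sqr i : dotp (normal i) (normal i) = 4 / (3 * a ^+ 2).
Proof.
by apply: (side_normal_sqr a_gt0); apply: dist_sqr; move: i; apply: I3P.
Qed.

Lemma normal_dotS i : dotp (normal i) (normal (ordS i)) = - 2 / (3 * a ^+ 2).
Proof.
rewrite /normal; have -> : ordS (ordS (ordS i)) = i.
  by move: i; apply: I3P; exact/val_inj.
by apply: (side_normal_dot a_gt0); apply: dist_sqr; move: i; apply: I3P.
Qed.

Lemma dotpC (x y : R * R) : dotp x y = dotp y x.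
Proof. by rewrite /dotp; ring. Qed.

Lemma normal_dot i j :
  dotp (normal i) (normal j) = (if i == j then 4 else - 2) / (3 * a ^+ 2).
Proof.
have [->|] := eqVneq i j; first exact: normal_sqr.
by move: i j; do 2 apply: I3P => //; move=> _;
  rewrite ?(normal_dotS i0) ?(normal_dotS i1) ?(normal_dotS i2);
  have := (normal_dotS i0, normal_dotS i1, normal_dotS i2);
  rewrite !ordS012 => -[[]] // d0 d1 d2; rewrite ?d0 ?d1 ?d2//;
  rewrite dotpC ?d0 ?d1 ?d2.
Qed.

Lemma normalE i :
  normal i = (2 / (3 * a ^+ 2)) *: (2 *: V i - V (ordS i) - V (ordS (ordS i))).
Proof.
by apply: (side_normalE a_gt0); apply: dist_sqr; move: i; apply: I3P.
Qed.

Lemma bary_sum x : bary i0 x + bary i1 x + bary i2 x = 1.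
Proof.
have := cross_V0 i0; rewrite /bary /offset /normal /side_normal !ordS012.
rewrite (crossC (V i0)) -(crossC (V i2) (V i0)) /dotp /=.
rewrite /cross => h; field; exact: h.
Qed.

Lemma bary_comb x :
  x = bary i0 x *: V i0 + bary i1 x *: V i1 + bary i2 x *: V i2.
Proof.
have := cross_V0 i0; rewrite /bary /offset /normal /side_normal !ordS012.
rewrite (crossC (V i0)) -(crossC (V i2) (V i0)) /dotp /cross => h.
by apply: injective_projections; rewrite !coordE /=; field; exact: h.
Qed.

Lemma bary_of_comb (c : 'I_3 -> R) i : \sum_(j < 3) c j = 1 ->
  bary i (\sum_(j < 3) c j *: V j) = c i.
Proof.
rewrite big_I3 big_I3v => c1.
have {c1} c0 : c i0 = 1 - c i1 - c i2 by lra.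
have := cross_V0 i; rewrite /bary /offset /normal /side_normal.
by move: i; apply: I3P; rewrite !ordS012 /dotp !coordE /= /cross c0 => h;
  field; exact: h.
Qed.

Lemma open_triangleE : open_triangle V = [set x | forall i, 0 < bary i x].
Proof.
apply/seteqP; split => [x [c [c0 c1 ->]] i|x x0]; first by rewrite bary_of_comb.
exists (bary ^~ x); split => //; first by rewrite big_I3 bary_sum.
by rewrite big_I3v -bary_comb.
Qed.

End Barycentric.

(** * The triangle as a bounded measurable domain *)

Section TriangleDomain.
Context {R : realType}.
Variables (a : R) (V : 'I_3 -> R * R).
Hypotheses (a_gt0 : 0 < a) (V_equilateral : equilateral V a).
Implicit Types (x e : R * R) (i j : 'I_3) (f g p u v : R * R -> R).
Notation plane := (measurableTypeR R * measurableTypeR R)%type.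
Notation T := (open_triangle V).

Definition closed_triangle : set (R * R) := [set x | forall i, 0 <= bary V i x].

Lemma bary_continuous i : continuous (bary V i).
Proof.
move=> x; apply: cvgD; last exact: cvg_cst.
exact: dotp_continuous.
Qed.

Lemma sub_closed_triangle : T `<=` closed_triangle.
Proof. by rewrite (open_triangleE a_gt0 V_equilateral) => x Tx i; exact/ltW. Qed.

(** Serves both the closed triangle ([k = 1], [m = 0]) and the compact set carrying the cutoff
    [chi n] ([k = n], [m = - 1]). *)
Lemma bary_level_closed (k m : R) :
  closed [set x | forall i, 0 <= k * bary V i x + m].
Proof.
have -> : [set x | forall i, 0 <= k * bary V i x + m] =
   \bigcap_(i in [set: 'I_3]) ((fun x => k * bary V i x + m) @^-1` [set y | 0 <= y]).
  by apply/seteqP; split => [x h i _|x h i]; [exact: h|exact: (h i I)].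
apply: closed_bigI => i _; move: (@closed_ge R 0); move: [set y | 0 <= y].
apply/continuous_closedP => x; apply: cvgD; last exact: cvg_cst.
apply: cvgM; first exact: cvg_cst.
exact: bary_continuous.
Qed.

Lemma bary_le1 i x : closed_triangle x -> bary V i x <= 1.
Proof.
move=> Tx; have := bary_sum a_gt0 V_equilateral x.
by have := (Tx i0, Tx i1, Tx i2); case=> -[]; move: i; apply: I3P; lra.
Qed.

Let M : R := \sum_(i < 3) (`|(V i).1| + `|(V i).2|).

Lemma closed_triangle_box : closed_triangle `<=` `[- M, M] `*` `[- M, M].
Proof.
move=> x Tx; have B i : `|bary V i x| <= 1 by rewrite ger0_norm ?bary_le1 ?Tx.
have H (y : R) i : `|bary V i x * y| <= `|y|.
  by rewrite normrM ler_piMl.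
rewrite /M big_I3; split; rewrite /= in_itv /= -ler_norml;
  rewrite {1}(bary_comb a_gt0 V_equilateral x) !coordE.
- have := (H (V i0).1 i0, H (V i1).1 i1, H (V i2).1 i2) => -[[k0 k1] k2].
  apply: (le_trans (ler_normD _ _)).
  have := ler_normD (bary V i0 x * (V i0).1) (bary V i1 x * (V i1).1).
  have := (normr_ge0 (V i0).2, normr_ge0 (V i1).2, normr_ge0 (V i2).2) => -[[]]; lra.
- have := (H (V i0).2 i0, H (V i1).2 i1, H (V i2).2 i2) => -[[k0 k1] k2].
  apply: (le_trans (ler_normD _ _)).
  have := ler_normD (bary V i0 x * (V i0).2) (bary V i1 x * (V i1).2).
  have := (normr_ge0 (V i0).1, normr_ge0 (V i1).1, normr_ge0 (V i2).1) => -[[]]; lra.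
Qed.

Lemma closed_sub_compact (K : set (R * R)) :
  closed K -> K `<=` closed_triangle -> compact K.
Proof.
move=> cK KT; apply: (subclosed_compact cK) (subset_trans KT closed_triangle_box).
by apply: compact_setX; exact: segment_compact.
Qed.

Lemma closed_triangle_closed : closed closed_triangle.
Proof.
have -> : closed_triangle = [set x | forall i, 0 <= 1 * bary V i x + 0].
  by apply/seteqP; split => x h i; have := h i; rewrite mul1r addr0.
exact: bary_level_closed.
Qed.

Lemma triangle_measurable : measurable (T : set plane).
Proof.
rewrite (open_triangleE a_gt0 V_equilateral).
have -> : [set x | forall i, 0 < bary V i x] =
   \bigcap_(i in [set: 'I_3]) ((bary V i) @^-1` [set y | 0 < y]).
  by apply/seteqP; split => [x h i _|x h i]; [exact: h|exact: (h i I)].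
apply: fin_bigcap_measurable; first exact: finite_finset.
move=> i _; apply: open_measurable2; move: (@open_gt R 0).
by move: [set y | 0 < y]; apply/continuousP; exact: bary_continuous.
Qed.

Lemma triangle_finite : (@leb2 R T < +oo)%E.
Proof.
apply: (@le_lt_trans _ _ (@leb2 R (`[- M, M] `*` `[- M, M]))).
  apply: le_measure; rewrite ?inE; first exact: triangle_measurable.
    by apply: measurableX; exact: measurable_itv.
  exact: (subset_trans sub_closed_triangle closed_triangle_box).
rewrite /leb2 /= product_measure1E; [|exact: measurable_itv..].
by rewrite lte_mul_pinfty// ?measure_ge0 ?fin_num_measure//= ?lebesgue_measure_itv;
  case: ifP => _; rewrite -?EFinB ?ltry.
Qed.

Lemma continuous_bounded_triangle f : continuous f ->
  exists B : R, forall x, closed_triangle x -> `|f x| <= B.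
Proof.
move=> cf; have cT := closed_sub_compact closed_triangle_closed (@subset_refl _ _).
have : compact (f @` closed_triangle).
  by apply: continuous_compact => //; exact: continuous_subspaceT.
move=> /compact_bounded[B [_ hB]]; exists (B + 1) => x Tx.
by apply: (hB (B + 1)); [rewrite ltrDl|exists x].
Qed.

Lemma continuous_sqi f : continuous f -> sqi (@leb2 R) T f.
Proof.
move=> cf; have [B hB] := continuous_bounded_triangle cf.
apply: (sqi_bounded triangle_measurable (M := B)); first exact: triangle_finite.
  exact: measurable_funS (continuous_measurable2 cf).
by move=> x /sub_closed_triangle; exact: hB.
Qed.

End TriangleDomain.

(** * Green's formula for functions with vanishing normal derivative *)

Section WeakGreen.
Context {R : realType}.
Variables (a : R) (V : 'I_3 -> R * R).
Hypotheses (a_gt0 : 0 < a) (V_equilateral : equilateral V a).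
Implicit Types (x e : R * R) (i j : 'I_3) (f g p u v : R * R -> R).
Implicit Types (h : R * R -> R * R) (n : nat).
Notation T := (open_triangle V).

Local Opaque derive.

(** Equal to [rho 0 (n * bary V i x - 1)] by [cutE], but written as a ridge function, the form
    required by [tame]. It vanishes where [bary V i x <= 1 / n] and tends to 1 at every interior
    point. *)
Definition cut i n x : R :=
  rho 0 (dotp (n%:R *: normal V i) x + (n%:R * offset V i - 1)).

Definition cut' i n x : R := n%:R * rho 2 (n%:R * bary V i x - 1).

Definition chi n x : R := cut i0 n x * cut i1 n x * cut i2 n x.

Lemma cut_arg i n x :
  dotp (n%:R *: normal V i) x + (n%:R * offset V i - 1) = n%:R * bary V i x - 1.
Proof. by rewrite /bary dotpC dotpZr dotpC; ring. Qed.

Lemma cutE i n x : cut i n x = rho 0 (n%:R * bary V i x - 1).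
Proof. by rewrite /cut cut_arg. Qed.

Lemma cut_tame i n : tame (cut i n).
Proof. exact: tame_cutoff. Qed.

Lemma chi_tame n : tame (chi n).
Proof.
by apply: tame_mul; [apply: tame_mul|]; exact: cut_tame.
Qed.

Lemma cut_derive i n e x :
  'D_e (cut i n) x = dotp (normal V i) e * cut' i n x.
Proof.
by rewrite cutoff_derive cut_arg dotpC dotpZr dotpC /cut'; ring.
Qed.

Lemma tame_derivable f e x : tame f -> derivable f x e.
Proof. by move=> /tame_derive[df _]; exact: diff_derivable. Qed.

Lemma deriveMfun f g e x : tame f -> tame g ->
  'D_e (fun y => f y * g y) x = f x * 'D_e g x + g x * 'D_e f x.
Proof. by move=> tf tg; apply: deriveM; exact: tame_derivable. Qed.

Lemma d1M f g x : tame f -> tame g ->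
  d1 (fun y => f y * g y) x = f x * d1 g x + g x * d1 f x.
Proof. exact: deriveMfun. Qed.

Lemma d2M f g x : tame f -> tame g ->
  d2 (fun y => f y * g y) x = f x * d2 g x + g x * d2 f x.
Proof. exact: deriveMfun. Qed.

Lemma chi_derive n e x :
  'D_e (chi n) x =
    dotp (normal V i0) e * (cut' i0 n x * (cut i1 n x * cut i2 n x)) +
    dotp (normal V i1) e * (cut' i1 n x * (cut i0 n x * cut i2 n x)) +
    dotp (normal V i2) e * (cut' i2 n x * (cut i0 n x * cut i1 n x)).
Proof.
rewrite (deriveMfun _ _ (tame_mul (cut_tame i0 n) (cut_tame i1 n)) (cut_tame i2 n)).
rewrite (deriveMfun _ _ (cut_tame i0 n) (cut_tame i1 n)) !cut_derive; ring.
Qed.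

Lemma cut_ge0 i n x : 0 <= cut i n x. Proof. exact: rho_ge0. Qed.

Lemma rho0_le1 (t : R) : rho 0 t <= 1.
Proof.
case: (ltP 0 t) => t0; last by rewrite /rho ltNge t0.
by have := rho_le 0 0 t0; rewrite !expr0 invr1 !mul1r.
Qed.

Lemma cut_le1 i n x : cut i n x <= 1. Proof. exact: rho0_le1. Qed.

Lemma prod01 (s t : R) : 0 <= s -> s <= 1 -> 0 <= t -> t <= 1 -> 0 <= s * t <= 1.
Proof. by move=> s0 s1 t0 t1; rewrite mulr_ge0// mulr_ile1. Qed.

Lemma chi_test n q : tame q -> test_function T (fun x => chi n x * q x).
Proof.
move=> tq; split; first exact/tame_smooth/tame_mul/tq/chi_tame.
pose K := [set x | forall i, 0 <= n%:R * bary V i x + (- 1)].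
have bK x i : K x -> 0 < bary V i x.
  move=> /(_ i) h; rewrite ltNge; apply/negP => b0.
  by have := mulr_ge0_le0 (ler0n R n) b0; lra.
exists K; split.
- apply: (closed_sub_compact a_gt0 V_equilateral); first exact: bary_level_closed.
  by move=> x Kx i; exact/ltW/bK.
- by rewrite (open_triangleE a_gt0 V_equilateral) => x Kx i; exact: bK.
- move=> x nKx; have [i ci] : exists i, cut i n x = 0.
    move/existsNP : nKx => [i /negP]; rewrite -ltNge => h.
    by exists i; rewrite cutE /rho ltNge ltW.
  by move: i ci; rewrite /chi; apply: I3P => ->; rewrite !(mul0r, mulr0).
Qed.

Lemma chi_cvg x : T x -> (fun n => chi n x) @ \oo --> (1 : R).
Proof.
rewrite (open_triangleE a_gt0 V_equilateral) => Tx.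
suff : (fun n => chi n x) @ \oo --> (1 * 1 * 1 : R) by rewrite !mulr1.
by apply: cvgM; [apply: cvgM|]; under eq_fun do rewrite cutE;
  apply: rho0_scaled_cvg; exact: Tx.
Qed.

Lemma chi_bound n x : 0 <= chi n x <= 1.
Proof.
have /andP[h1 h2] := prod01 (cut_ge0 i0 n x) (cut_le1 i0 n x) (cut_ge0 i1 n x) (cut_le1 i1 n x).
exact: prod01 (cut_ge0 _ _ _) (cut_le1 _ _ _).
Qed.

Definition laplacian p x : R := d1 (d1 p) x + d2 (d2 p) x.

(* The normal derivative of [p] vanishes on the sides, quantitatively. *)
Definition neumann_bdry p : Prop := exists C : R, forall i x, T x ->
  `|dotp (normal V i) (gradient p x)| <= C * bary V i x.

Let chi_p n p x : R :=
  dotp (normal V i0) (gradient p x) * (cut' i0 n x * (cut i1 n x * cut i2 n x)) +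
  dotp (normal V i1) (gradient p x) * (cut' i1 n x * (cut i0 n x * cut i2 n x)) +
  dotp (normal V i2) (gradient p x) * (cut' i2 n x * (cut i0 n x * cut i1 n x)).

Let chi_pE n p x :
  chi_p n p x = d1 (chi n) x * d1 p x + d2 (chi n) x * d2 p x.
Proof.
rewrite [d1 (chi n) x]chi_derive [d2 (chi n) x]chi_derive /chi_p.
rewrite /gradient /dotp /=; move: (d1 p x) (d2 p x) => *; ring.
Qed.

(** The Neumann bound trades the normal derivative of [p] for a factor [bary V i x], which combines
    with the factor [n] of [cut']. The right-hand side is then bounded by [rho2_bounded] and tends
    to 0 by [rho2_scaled_cvg]. *)
Let layer p : neumann_bdry p -> exists2 C : R, 0 <= C &
  forall i x n (s : R), T x -> 0 <= s <= 1 ->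
  `|dotp (normal V i) (gradient p x) * (cut' i n x * s)| <=
   C * (n%:R * bary V i x * rho 2 (n%:R * bary V i x - 1)).
Proof.
move=> [C hC]; exists `|C| => // i x n s Tx /andP[s0 s1].
have c0 : 0 <= cut' i n x by rewrite mulr_ge0// rho_ge0.
rewrite normrM [X in _ * X]ger0_norm; last exact: mulr_ge0.
apply: (@le_trans _ _ (`|C| * bary V i x * (cut' i n x))); last first.
  by rewrite /cut' le_eqVlt; apply/orP; left; apply/eqP; ring.
have b0 : 0 < bary V i x by move: Tx i {c0}; rewrite (open_triangleE a_gt0 V_equilateral).
apply: ler_pM; [exact: normr_ge0|exact: mulr_ge0| |].
- by apply: (le_trans (hC i x Tx)); rewrite ler_pM2r// ler_norm.
- by rewrite ler_piMr.
Qed.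

Let chi_p_bound p : neumann_bdry p -> exists B : R,
  forall n x, T x -> `|chi_p n p x| <= B.
Proof.
move=> /layer[C C0 hC]; have [K hK] := @rho2_bounded R.
exists (C * K + C * K + C * K) => n x Tx.
have H i s : 0 <= s <= 1 ->
    `|dotp (normal V i) (gradient p x) * (cut' i n x * s)| <= C * K.
  move=> s01; apply: (le_trans (hC i x n s Tx s01)).
  rewrite ler_wpM2l//; have /andP[_] := hK (n%:R * bary V i x - 1).
  by rewrite subrK.
rewrite /chi_p; apply: (le_trans (ler_normD _ _)); apply: lerD.
  apply: (le_trans (ler_normD _ _)); apply: lerD.
all: by apply: H; apply: prod01; rewrite ?cut_ge0 ?cut_le1.
Qed.

Let chi_p_cvg p x : neumann_bdry p -> T x ->
  (fun n => chi_p n p x) @ \oo --> (0 : R).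
Proof.
move=> /layer[C C0 hC] Tx.
have H i (s : nat -> R) : (forall n, 0 <= s n <= 1) ->
   (fun n => dotp (normal V i) (gradient p x) * (cut' i n x * s n)) @ \oo --> (0 : R).
  move=> s01; apply/norm_cvg0P.
  apply: (@squeeze_cvgr _ _ _ R (fun=> 0)
    (fun n => C * (n%:R * bary V i x * rho 2 (n%:R * bary V i x - 1)))).
  - by apply: nearW => n; rewrite normr_ge0 hC.
  - exact: cvg_cst.
  - rewrite -[X in _ --> X](mulr0 C); apply: cvgM; first exact: cvg_cst.
    apply: rho2_scaled_cvg.
    by move: Tx; rewrite (open_triangleE a_gt0 V_equilateral).
suff : (fun n => chi_p n p x) @ \oo --> (0 + 0 + 0 : R) by rewrite !addr0.
by apply: cvgD; [apply: cvgD|]; apply: H => n; apply: prod01;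
   rewrite ?cut_ge0 ?cut_le1.
Qed.

Let mT := triangle_measurable a_gt0 V_equilateral.

Lemma tame_continuous f : tame f -> continuous f.
Proof. by move=> /tame_smooth; exact: smooth_continuous. Qed.

Lemma tame_sqi f : tame f -> sqi (@leb2 R) T f.
Proof.
by move=> tf; apply: (continuous_sqi a_gt0 V_equilateral); exact: tame_continuous.
Qed.

Lemma sqi_integrable f : sqi (@leb2 R) T f -> (@leb2 R).-integrable T (EFin \o f).
Proof.
move=> sf; have := sqi_mul mT sf (tame_sqi (tame_cst 1)).
by apply: eq_integrable => // x _; rewrite /= mulr1.
Qed.

(** The weak gradient of [v] is tested with the two components of [chi n * grad p]. Their divergence
    is [chi n * laplacian p] plus the boundary-layer term [chi_p n p], which is bounded uniformly in
    [n] and tends to 0 pointwise; dominated convergence concludes. *)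
Lemma weak_green p v h : tame p -> neumann_bdry p -> H1 T v h ->
  \int[leb2]_(x in T) dotp (gradient p x) (h x) =
  - \int[leb2]_(x in T) (laplacian p x * v x).
Proof.
move=> tp np [sv sh1 sh2 hv].
have sD1 := tame_d1 tp; have sD2 := tame_d2 tp.
have sl : tame (laplacian p).
  by apply: tame_add; [exact: tame_d1|exact: tame_d2].
have [B hB] := chi_p_bound np.
have E n : ip (@leb2 R) T v (fun x => chi n x * laplacian p x + chi_p n p x) =
   - \int[leb2]_(x in T) (chi n x * dotp (gradient p x) (h x)).
  have [t1 _] := hv _ (chi_test n sD1); have [_ t2] := hv _ (chi_test n sD2).
  have tc1 := tame_mul (chi_tame n) sD1; have tc2 := tame_mul (chi_tame n) sD2.
  transitivity (ip (@leb2 R) T v (fun x => d1 (fun x => chi n x * d1 p x) x +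
                                 d2 (fun x => chi n x * d2 p x) x)).
    apply: eq_Rintegral => x _; congr (_ * _); rewrite chi_pE /laplacian.
    rewrite (d1M x (chi_tame n) sD1) (d2M x (chi_tame n) sD2).
    move: (chi n x) (d1 (chi n) x) (d2 (chi n) x) (d1 p x) (d2 p x).
    by move: (d1 (d1 p) x) (d2 (d2 p) x) => *; ring.
  transitivity (ip (@leb2 R) T v (d1 (fun x => chi n x * d1 p x)) +
                ip (@leb2 R) T v (d2 (fun x => chi n x * d2 p x))).
    by apply: ipDr => //; apply: tame_sqi; [exact: tame_d1|exact: tame_d2].
  transitivity (- ip (@leb2 R) T (fun x => (h x).1) (fun x => chi n x * d1 p x) +
     - ip (@leb2 R) T (fun x => (h x).2) (fun x => chi n x * d2 p x)).
    exact: (f_equal2 _ t1 t2).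
  rewrite -opprD; congr (- _); rewrite /ip.
  rewrite -RintegralD//; [|by apply: sqi_mul => //; exact: tame_sqi..].
  apply: eq_Rintegral => x _; rewrite /gradient /dotp /=.
  by move: (chi n x) (d1 p x) (d2 p x) => *; ring.
have iv := sqi_integrable sv.
have iD : (@leb2 R).-integrable T (EFin \o (fun x => dotp (gradient p x) (h x))).
  apply: (eq_integrable mT (fun x => (d1 p x * (h x).1)%:E + (d2 p x * (h x).2)%:E)%E).
    by move=> x _; rewrite -EFinD.
  by apply: integrableD => //; apply: sqi_mul => //; exact: tame_sqi.
have L1 : (fun n => ip (@leb2 R) T v (fun x => chi n x * laplacian p x + chi_p n p x))
    @ \oo --> ip (@leb2 R) T v (laplacian p).
  have [K hK] := continuous_bounded_triangle a_gt0 V_equilateral (tame_continuous sl).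
  apply: (Rdominated mT (g := fun x => `|v x| * (K + B))).
  - move=> n; apply: measurable_funM; first by case: sv.
    apply: measurable_funD.
      by case: (tame_sqi (tame_mul (chi_tame n) sl)).
    have tt : tame (fun x => d1 (chi n) x * d1 p x + d2 (chi n) x * d2 p x).
      apply: tame_add; apply: tame_mul => //; [apply: tame_d1|apply: tame_d2];
      exact: chi_tame.
    have [mt _] := tame_sqi tt; apply: eq_measurable_fun mt => x _.
    by rewrite chi_pE.
  - by apply: measurable_funM; [case: sv|case: (tame_sqi sl)].
  - move=> x Tx; apply: cvgM; first exact: cvg_cst.
    rewrite -[X in _ --> X]addr0; apply: cvgD; last exact: chi_p_cvg.
    rewrite -[X in _ --> X]mul1r; apply: cvgM; last exact: cvg_cst.
    exact: chi_cvg.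
  - apply: (eq_integrable mT (fun x => (K + B)%:E * `|(EFin \o v) x|)%E).
      by move=> x _; rewrite /= -EFinM mulrC.
    by apply: integrableZl => //; exact: integrable_abse.
  - move=> n x Tx; rewrite normrM ler_wpM2l//.
    apply: (le_trans (ler_normD _ _)); apply: lerD; last exact: hB.
    have /andP[c0 c1] := chi_bound n x.
    rewrite normrM ger0_norm//; apply: le_trans (hK x (sub_closed_triangle a_gt0 V_equilateral Tx)).
    by rewrite ler_piMl.
have L2 : (fun n => - \int[leb2]_(x in T) (chi n x * dotp (gradient p x) (h x)))
    @ \oo --> - \int[leb2]_(x in T) dotp (gradient p x) (h x).
  apply: cvgN; apply: (Rdominated mT (g := fun x => `|dotp (gradient p x) (h x)|)).
  - move=> n; apply: measurable_funM; first by case: (tame_sqi (chi_tame n)).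
    by apply/measurable_EFinP; case/integrableP: iD.
  - by apply/measurable_EFinP; case/integrableP: iD.
  - move=> x Tx; rewrite -[X in _ --> X]mul1r; apply: cvgM; last exact: cvg_cst.
    exact: chi_cvg.
  - by apply: eq_integrable (integrable_abse iD).
  - move=> n x Tx; have /andP[c0 c1] := chi_bound n x.
    by rewrite normrM ger0_norm// ler_piMl.
have EE : (fun n => ip (@leb2 R) T v (fun x => chi n x * laplacian p x + chi_p n p x)) =
  (fun n => - \int[leb2]_(x in T) (chi n x * dotp (gradient p x) (h x))).
  exact/funext.
rewrite EE in L1; have := cvg_unique _ L1 L2.
by move=> /(_ (@Rhausdorff R)) e; rewrite -[LHS]opprK -e ipC.
Qed.

End WeakGreen.

(** * Integrals of derivatives of compactly supported functions *)

Section LineDerivative.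
Context {R : realType}.
Implicit Types (x e P : R * R) (f : R * R -> R).
Notation plane := (measurableTypeR R * measurableTypeR R)%type.
Notation leb := (@lebesgue_measure R).

Lemma line_is_derive f P e (t : R) : differentiable f (P + t *: e) ->
  is_derive t (1 : R) (fun s => f (P + s *: e)) ('D_e f (P + t *: e)).
Proof.
move=> df; have dfe := @diff_derivable _ _ _ _ _ e df.
have E : (fun h : R => h^-1 *: ((fun s => f (P + s *: e)) (h *: (1 : R) + t) - f (P + t *: e)))
   = (fun h : R => h^-1 *: (f (h *: e + (P + t *: e)) - f (P + t *: e))).
  apply/funext => h; congr (_ *: (f _ - _)).
  by rewrite scalerDl [h *: 1]mulr1 addrCA.
by apply: DeriveDef; rewrite /derivable /derive /= E.
Qed.

Lemma FTC_C1 (g g' : R -> R) (s t : R) : s < t ->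
  (forall r, is_derive r (1 : R) g (g' r)) -> continuous g' ->
  \int[leb]_(r in `[s, t]) g' r = g t - g s.
Proof.
move=> st dg cg'; have cg : continuous g.
  by move=> r; apply: differentiable_continuous; apply/derivable1_diffP; case: (dg r).
rewrite /Rintegral (@continuous_FTC2 _ g' g s t st)//.
- exact: continuous_subspaceT.
- split => [r _| |]; first by case: (dg r).
    exact/cvg_at_right_filter/cg.
  exact/cvg_at_left_filter/cg.
- by move=> r _; rewrite derive1E; case: (dg r).
Qed.

Lemma line_continuous P e : continuous (fun s : R => P + s *: e).
Proof.
by move=> s; apply: cvgD; [exact: cvg_cst|exact: scalel_continuous].
Qed.

Lemma FTC_line f P e (s t : R) : s < t -> (forall x, differentiable f x) ->
  continuous ('D_e f) ->
  \int[leb]_(r in `[s, t]) 'D_e f (P + r *: e) = f (P + t *: e) - f (P + s *: e).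
Proof.
move=> st df cf; apply: (@FTC_C1 (fun s => f (P + s *: e)) (fun s => 'D_e f (P + s *: e))) => //.
  by move=> r; exact: line_is_derive.
move=> r; apply: (@cvg_comp _ _ _ (fun s => P + s *: e) ('D_e f)); first exact: line_continuous.
exact: cf.
Qed.

Lemma derive_off_support f (K : set (R * R)) e x : closed K ->
  (forall y, ~ K y -> f y = 0) -> ~ K x -> 'D_e f x = 0.
Proof.
move=> cK fK nKx; rewrite (@near_eq_derive _ _ _ _ (cst 0)) ?derive_cst//.
have : nbhs x (~` K) by apply: open_nbhs_nbhs; split => //; exact: closed_openC.
by apply: filterS => y; exact: fK.
Qed.

(** Fubini, then the fundamental theorem of calculus on each line parallel to [e]. The direction is
    one of the axes so that these lines are the fibres of the product measure. *)
Lemma integral_derive_compact f (K : set (R * R)) e :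
  (e = (1, 0) \/ e = (0, 1)) -> (forall x, differentiable f x) ->
  continuous ('D_e f) -> compact K -> (forall x, ~ K x -> f x = 0) ->
  \int[@leb2 R]_x 'D_e f x = 0.
Proof.
move=> ee df cf cK fK.
have clK : closed K by apply: compact_closed cK; exact: norm_hausdorff.
have dK x : ~ K x -> 'D_e f x = 0 by exact: derive_off_support.
(* The bounds are strict so that [f] already vanishes at the endpoints [- M] and [M] of each
   line. *)
have [M M0 KM] : exists2 M : R, 0 < M & forall x, K x -> `|x.1| < M /\ `|x.2| < M.
  have [M0 [_ hM]] := compact_bounded cK.
  exists (`|M0| + 2) => [|x Kx]; first by rewrite ltr_wpDl.
  have h : `|x| <= `|M0| + 1 by apply: hM => //; rewrite (le_lt_trans (ler_norm _))// ltrDl.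
  have h2 : `|x| < `|M0| + 2 by apply: (le_lt_trans h); rewrite ltrD2l ltr1n.
  by move: h2; rewrite prod_normE /= gt_max => /andP[].
pose B := `[- M, M] `*` `[- M, M] : set plane.
have mB : measurable B by apply: measurableX; exact: measurable_itv.
have KB : K `<=` B.
  by move=> x /KM[h1 h2]; split; rewrite /= in_itv /= -ler_norml ltW.
have cB : compact (B : set (R * R)) by apply: compact_setX; exact: segment_compact.
have [C hC] : exists C : R, forall x, K x -> `|'D_e f x| <= C.
  have : compact ('D_e f @` K).
    by apply: continuous_compact => //; exact: continuous_subspaceT.
  move=> /compact_bounded[C [_ hC]]; exists (C + 1) => x Kx.
  by apply: (hC (C + 1)); [rewrite ltrDl|exists x].
have mf : measurable_fun setT ('D_e f : plane -> R) by exact: continuous_measurable2.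
have fB : (@leb2 R B < +oo)%E.
  rewrite /leb2 /= product_measure1E; [|exact: measurable_itv..].
  by rewrite lte_mul_pinfty// ?measure_ge0 ?fin_num_measure//= ?lebesgue_measure_itv;
    case: ifP => _; rewrite -?EFinB ?ltry.
have iB : (@leb2 R).-integrable setT (EFin \o 'D_e f).
  apply: (@le_integrable _ _ _ leb2 _ measurableT _ (EFin \o (fun x => C * \1_B x))).
  - exact/measurable_EFinP.
  - move=> x _ /=; rewrite lee_fin indicE.
    have [Kx|nKx] := pselect (K x).
      rewrite mem_set ?mulr1; last exact: KB.
      by rewrite (le_trans (hC x Kx))// ler_norm.
    by rewrite dK// normr0 normr_ge0.
  - apply: (@eq_integrable _ _ _ leb2 setT measurableT (fun x => C%:E * (\1_B x)%:E)%E).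
      by move=> x _; rewrite /= EFinM.
    apply: integrableZl => //; apply/integrableP; split.
      by apply/measurable_EFinP; exact: measurable_indic.
    under eq_integral do rewrite gee0_abs ?lee_fin//.
    by rewrite integral_indic// setIT.
have line (g : R -> R * R) : (exists P, forall r, g r = P + r *: e) ->
    (forall r, M <= `|r| -> ~ K (g r)) ->
    (\int[leb]_r ('D_e f (g r))%:E = 0)%E.
  move=> [P gP] gK.
  have H : \int[leb]_(r in `[- M, M]) 'D_e f (g r) = 0.
    under eq_Rintegral do rewrite gP.
    rewrite FTC_line//; last lra.
    have z s : M <= `|s| -> f (P + s *: e) = 0 by move=> /gK; rewrite gP; exact: fK.
    by rewrite !z ?subr0// ?normrN ger0_norm// ltW.
  have cg : continuous g.
    have -> : g = (fun r => P + r *: e) by apply/funext => r; rewrite gP.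
    exact: line_continuous.
  have cD : continuous (fun r => 'D_e f (g r)).
    by move=> r; apply: (@cvg_comp _ _ _ g ('D_e f)); [exact: cg|exact: cf].
  have -> : (\int[leb]_r ('D_e f (g r))%:E = \int[leb]_(r in `[(- M)%R, M]) ('D_e f (g r))%:E)%E.
    rewrite [RHS]integral_mkcond; apply: eq_integral => r _; rewrite patchE.
    case: ifPn => // /negP; rewrite inE /= in_itv /= -ler_norml => /negP.
    by rewrite -ltNge => h; rewrite dK//; apply: gK; exact: ltW.
  have /integrable_fin_num : leb.-integrable `[- M, M] (EFin \o (fun r => 'D_e f (g r))).
    apply: continuous_compact_integrable; first exact: segment_compact.
    exact: continuous_subspaceT.
  by move=> /(_ (measurable_itv _))/fineK <-; congr (_%:E).
rewrite /Rintegral; case: ee => ee; subst e.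
- rewrite -integral21_prod_meas1// /fubini_G.
  under eq_integral => y _.
    rewrite (line (fun r => (r, y))).
    over.
  - exists (0, y) => r; apply: injective_projections; rewrite !coordE /=; ring.
  - by move=> r Mr /KM[/=]; rewrite ltNge Mr.
  by rewrite integral0.
- rewrite -integral12_prod_meas1// /fubini_F.
  under eq_integral => y _.
    rewrite (line (fun r => (y, r))).
    over.
  - exists (y, 0) => r; apply: injective_projections; rewrite !coordE /=; ring.
  - by move=> r Mr /KM[_ /=]; rewrite ltNge Mr.
  by rewrite integral0.
Qed.

End LineDerivative.

(** * Smooth functions in H^1 and the Dirichlet form *)

Section TameH1.
Context {R : realType}.
Variables (a : R) (V : 'I_3 -> R * R).
Hypotheses (a_gt0 : 0 < a) (V_equilateral : equilateral V a).
Implicit Types (x e : R * R) (i j : 'I_3) (f p u v phi : R * R -> R).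
Implicit Types (g h : R * R -> R * R) (n : nat).
Notation T := (open_triangle V).
Notation ipT := (ip (@leb2 R) T).
Notation sqiT := (sqi (@leb2 R) T).

Local Opaque derive.

Let mT := triangle_measurable a_gt0 V_equilateral.

Lemma smooth_sqi f : smooth f -> sqiT f.
Proof.
by move=> sf; apply: (continuous_sqi a_gt0 V_equilateral); exact: smooth_continuous.
Qed.

Lemma integration_by_parts_test p phi e : (e = (1, 0) \/ e = (0, 1)) ->
  smooth p -> test_function T phi -> ipT p ('D_e phi) = - ipT ('D_e p) phi.
Proof.
move=> ee tp [sphi [K [cK KT phi0]]].
have dp := smooth_differentiable tp; have dphi := smooth_differentiable sphi.
have Df : 'D_e (fun x => p x * phi x) = (fun x => p x * 'D_e phi x + phi x * 'D_e p x).
  by apply/funext => x; apply: deriveM; exact: diff_derivable.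
have cDp := smooth_continuous (smooth_derive e tp).
have cDphi := smooth_continuous (smooth_derive e sphi).
have cf : continuous ('D_e (fun x => p x * phi x)).
  rewrite Df => x; apply: cvgD; apply: cvgM.
  - exact: smooth_continuous.
  - exact: cDphi.
  - exact: smooth_continuous.
  - exact: cDp.
have df x : differentiable (fun x => p x * phi x) x by exact: differentiableM.
have f0 x : ~ K x -> p x * phi x = 0 by move=> /phi0 ->; rewrite mulr0.
have := integral_derive_compact ee df cf cK f0.
(* The product is supported in [K], inside the triangle, so its derivative can be integrated over
   the plane or over the triangle alike. *)
have -> : 'D_e (fun x => p x * phi x) = ('D_e (fun x => p x * phi x)) \_ T.
  apply/funext => x; rewrite patchE; case: ifPn => // /negP nT.
  apply: derive_off_support f0 _; first by apply: compact_closed cK; exact: norm_hausdorff.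
  by move=> /KT Tx; apply: nT; rewrite inE.
rewrite -Rintegral_mkcond Df => E.
have s1 := smooth_sqi tp; have s2 := smooth_sqi sphi.
have s3 := smooth_sqi (smooth_derive e tp); have s4 := smooth_sqi (smooth_derive e sphi).
move: E; rewrite RintegralD//; [|exact: sqi_mul..].
move=> /eqP; rewrite addr_eq0 => /eqP E; rewrite [in RHS]ipC; exact: E.
Qed.

Lemma smooth_H1 p : smooth p -> H1 T p (gradient p).
Proof.
move=> tp; have s1 := smooth_sqi tp.
have s3 := smooth_sqi (smooth_derive (1, 0) tp).
have s4 := smooth_sqi (smooth_derive (0, 1) tp).
split; [exact: s1|exact: s3|exact: s4|]; move=> phi tphi; split.
- exact: (integration_by_parts_test (or_introl erefl) tp tphi).
- exact: (integration_by_parts_test (or_intror erefl) tp tphi).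
Qed.

Lemma H1_lin (k : R) u v g h : H1 T u g -> H1 T v h ->
  H1 T (fun x => u x + k * v x) (fun x => g x + k *: h x).
Proof.
move=> [su sg1 sg2 hu] [sv sh1 sh2 hv].
have L f f' : L2 T f -> L2 T f' -> L2 T (fun x => f x + k * f' x).
  by move=> sf sf'; apply: (sqiD mT sf); exact: (sqiZ mT).
split; [exact: L|exact: L|exact: L|].
move=> phi tphi; have [a1 a2] := hu _ tphi; have [b1 b2] := hv _ tphi.
have sphi := smooth_sqi (proj1 tphi).
have s1 := smooth_sqi (smooth_derive (1, 0) (proj1 tphi)).
have s2 := smooth_sqi (smooth_derive (0, 1) (proj1 tphi)).
have lin f f' q : sqiT f -> sqiT f' -> sqiT q ->
    ipT (fun x => f x + k * f' x) q = ipT f q + k * ipT f' q.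
  by move=> sf sf' sq; rewrite ipDl ?ipZl//; exact: sqiZ.
split.
- transitivity (ipT u (d1 phi) + k * ipT v (d1 phi)); first exact: lin.
  rewrite /ip a1 b1 mulrN -opprD; congr (- _); apply/esym.
  exact: (lin (fun x => (g x).1) (fun x => (h x).1)).
- transitivity (ipT u (d2 phi) + k * ipT v (d2 phi)); first exact: lin.
  rewrite /ip a2 b2 mulrN -opprD; congr (- _); apply/esym.
  exact: (lin (fun x => (g x).2) (fun x => (h x).2)).
Qed.

(** Equality almost everywhere is stated through inner products, the only way in which the weak
    gradient sees a function. *)
Lemma H1_ae_eq u v g : sqiT v -> (forall f, sqiT f -> ipT u f = ipT v f) ->
  H1 T u g -> H1 T v g.
Proof.
move=> sv uv [su sg1 sg2 hu]; split => // phi tphi; have [h1 h2] := hu _ tphi.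
have s1 := smooth_sqi (smooth_derive (1, 0) (proj1 tphi)).
have s2 := smooth_sqi (smooth_derive (0, 1) (proj1 tphi)).
split; [rewrite -h1|rewrite -h2]; apply/esym; exact: uv.
Qed.

(** Split into components so that the bilinear calculus of [ip] applies; [dirE] identifies it with
    the Dirichlet integral. *)
Definition dir g h : R :=
  ipT (fun x => (g x).1) (fun x => (h x).1) + ipT (fun x => (g x).2) (fun x => (h x).2).

Lemma dirE u v g h : H1 T u g -> H1 T v h ->
  \int[leb2]_(x in T) dotp (g x) (h x) = dir g h.
Proof.
move=> [su sg1 sg2 _] [sv sh1 sh2 _]; rewrite /dir /ip -RintegralD//.
all: exact: sqi_mul.
Qed.

Lemma dirC g h : dir g h = dir h g.
Proof. by congr (_ + _); exact: ipC. Qed.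

End TameH1.

(** * Trigonometric polynomials invariant under the reflections of the triangle *)

Section TrigFacts.
Context {R : realType}.
Implicit Types x y d : R.

Lemma sinD2pin x (n : nat) : sin (x + 2 * pi * n%:R) = sin x.
Proof.
elim: n => [|n IH]; first by rewrite mulr0 addr0.
have -> : x + 2 * pi * n.+1%:R = x + 2 * pi * n%:R + pi + pi.
  by rewrite -[n.+1]addn1 natrD; ring.
by rewrite !sinDpi opprK.
Qed.

Lemma sinD2piz x (m : int) : sin (x + 2 * pi * m%:~R) = sin x.
Proof.
case: m => n; first exact: sinD2pin.
rewrite NegzE rmorphN /= -[LHS](@sinD2pin _ n.+1); congr sin.
by rewrite pmulrn; ring.
Qed.

Lemma sin_lipschitz x y : `|sin x - sin y| <= `|x - y|.
Proof.
wlog xy : x y / x < y => [H|].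
  have [/H//|/H|->] := ltgtP x y; last by rewrite !subrr.
  by rewrite distrC (distrC x).
rewrite distrC (distrC x).
have [c _ ->] := @MVT _ sin cos x y xy (fun r _ => is_derive_sin r)
  (continuous_subspaceT (@continuous_sin R)).
rewrite normrM ler_piMl// ler_norml cos_geN1 cos_le1//.
Qed.

Lemma cosM x y : cos x * cos y = 2^-1 * (cos (x + y) + cos (x - y)).
Proof. by rewrite cosB cosD; field. Qed.

End TrigFacts.

Section TrigPolynomials.
Context {R : realType}.
Variables (a : R) (V : 'I_3 -> R * R).
Hypotheses (a_gt0 : 0 < a) (V_equilateral : equilateral V a).
Implicit Types (x e : R * R) (i j : 'I_3) (f p q : R * R -> R).
Implicit Types (k : 'I_3 -> int) (d : R) (s : 'S_3).

Local Opaque derive.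

Definition mu2 : R := 16 * pi ^+ 2 / (9 * a ^+ 2).

(** In units of a third of a turn. With these shifts [ang i1 - ang i0], [ang i2 - ang i1] and
    [ang i0 - ang i2] are [2 pi] times [c_1], [c_2 - 1] and [c_0], while the three angles still sum
    to 0. *)
Definition ang_shift i : R := if i == i0 then 0 else if i == i1 then 1 else - 1.

(* On the triangle, exp(i t_0), exp(i t_1), exp(i t_2) are three points of the
   circle with product 1, cutting it into arcs of lengths 2 pi c_j, where c_j
   are the barycentric coordinates.  The unfolding group of the triangle acts on
   them by permutations and by shifts of the t_j by multiples of 2 pi. *)
Definition ang i x : R :=
  2 * pi / 3 * (bary V i x - bary V (ordS i) x + ang_shift i).

Definition ang_vec i : R * R := (2 * pi / 3) *: (normal V i - normal V (ordS i)).

Definition ang_off i : R :=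
  2 * pi / 3 * (offset V i - offset V (ordS i) + ang_shift i).

Lemma angE i x : ang i x = dotp (ang_vec i) x + ang_off i.
Proof.
by rewrite /ang /ang_vec /ang_off /bary /dotp !coordE; ring.
Qed.

Lemma ang_sum x : ang i0 x + ang i1 x + ang i2 x = 0.
Proof. by rewrite /ang !ordS012 /ang_shift /=; ring. Qed.

Definition freq k : R * R := \sum_(i < 3) (k i)%:~R *: ang_vec i.

Definition phase k x : R := \sum_(i < 3) (k i)%:~R * ang i x.

Definition phase_off k : R := \sum_(i < 3) (k i)%:~R * ang_off i.

Lemma phaseE k x : phase k x = dotp (freq k) x + phase_off k.
Proof.
rewrite /phase /freq /phase_off !big_I3 big_I3v !angE /dotp !coordE; ring.
Qed.

(** Norm of the Eisenstein integer [k_0 + k_1 w + k_2 w^2], [w] a primitive cube root of unity. It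
    is unchanged when a constant is added to [k], and so is [phase], the angles having sum 0. *)
Definition qform k : int :=
  k i0 ^+ 2 + k i1 ^+ 2 + k i2 ^+ 2 - k i0 * k i1 - k i1 * k i2 - k i2 * k i0.

(** This is where the value of [mu2] arises: by the Gram matrix of the normals, each [ang_vec] has
    squared length [mu2] and two distinct ones have inner product [- mu2 / 2]. *)
Lemma freq_sqr k : dotp (freq k) (freq k) = mu2 * (qform k)%:~R.
Proof.
have a0 : a != 0 by rewrite gt_eqF.
pose G i j : dotp (normal V i) (normal V j) = _ := normal_dot a_gt0 V_equilateral i j.
have D (u v w : R * R) (r0 r1 r2 : R) :
   dotp (r0 *: u + r1 *: v + r2 *: w) (r0 *: u + r1 *: v + r2 *: w) =
   r0 ^+ 2 * dotp u u + r1 ^+ 2 * dotp v v + r2 ^+ 2 * dotp w w +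
   2 * (r0 * r1 * dotp u v + r1 * r2 * dotp v w + r2 * r0 * dotp w u).
  by rewrite /dotp !coordE; ring.
have E (u v w z : R * R) (r : R) : dotp (r *: (u - v)) (r *: (w - z)) =
   r ^+ 2 * (dotp u w - dotp u z - dotp v w + dotp v z).
  by rewrite /dotp !coordE; ring.
rewrite /freq big_I3v D /ang_vec !ordS012 !E !G /= /mu2 /qform.
rewrite !(rmorphD, rmorphB, rmorphM, rmorphXn, rmorphN) /=.
by field.
Qed.

Definition kperm k s : 'I_3 -> int := fun i => k (s i).

Lemma sum_int3 (F : 'I_3 -> int) : \sum_(i < 3) F i = F i0 + F i1 + F i2.
Proof.
rewrite !big_ord_recl big_ord0 addr0 addrA.
by congr (F _ + F _ + F _); exact/val_inj.
Qed.

Lemma qform_perm k s : qform (kperm k s) = qform k.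
Proof.
have H k' : 2 * qform k' = 3 * (\sum_(i < 3) k' i ^+ 2) - (\sum_(i < 3) k' i) ^+ 2.
  by rewrite !sum_int3 /qform; ring.
apply: (@mulfI _ (2 : int)) => //; rewrite !H; congr (3 * _ - _ ^+ 2).
- by rewrite [RHS](reindex_inj (@perm_inj _ s)).
- by rewrite [RHS](reindex_inj (@perm_inj _ s)).
Qed.

Lemma qform_ge0 k : 0 <= qform k.
Proof.
rewrite -(pmulr_rge0 _ (isT : 0 < (2 : int))).
have -> : 2 * qform k = (k i0 - k i1) ^+ 2 + (k i1 - k i2) ^+ 2 + (k i2 - k i0) ^+ 2.
  by rewrite /qform; ring.
by rewrite !addr_ge0 ?sqr_ge0.
Qed.

Definition qnat k : nat := absz (qform k).

Lemma qnatE k : (qnat k)%:R = (qform k)%:~R :> R.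
Proof. by rewrite /qnat natr_absz ger0_norm// qform_ge0. Qed.

(** Symmetrization of one plane wave. The parameter [d] treats real and imaginary parts together:
    [d = 0] gives cosines and [d = pi / 2] gives minus the sines. *)
Definition orb k d x : R := \sum_(s : 'S_3) cos (phase (kperm k s) x + d).

Lemma orb_wave k d :
  orb k d = fun x => \sum_(s : 'S_3) wave (freq (kperm k s)) (phase_off (kperm k s) + d) x.
Proof.
by apply/funext => x; apply: eq_bigr => s _; rewrite phaseE /wave addrA.
Qed.

Lemma orb_perm k s d : orb (kperm k s) d = orb k d.
Proof.
apply/funext => x; rewrite /orb [RHS](reindex_inj (mulIg s)).
apply: eq_bigr => r _; congr (cos (_ + _)); congr (phase _ x).
by apply/funext => i; rewrite /kperm permM.
Qed.

Definition kadd k k' : 'I_3 -> int := fun i => k i + k' i.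
Definition kopp k : 'I_3 -> int := fun i => - k i.

Lemma phaseD k k' x : phase (kadd k k') x = phase k x + phase k' x.
Proof. by rewrite /phase -big_split /=; apply: eq_bigr => i _; rewrite rmorphD mulrDl. Qed.

Lemma phaseN k x : phase (kopp k) x = - phase k x.
Proof. by rewrite /phase -sumrN; apply: eq_bigr => i _; rewrite rmorphN mulNr. Qed.

(** In the double sum over [S_3] the second permutation is written [s * r]; for fixed [r] the terms
    then run over a whole orbit in [s]. Hence the span of the orbits is an algebra. *)
Lemma orbM k k' d d' x : orb k d x * orb k' d' x =
  \sum_(r : 'S_3) 2^-1 * (orb (kadd k (kperm k' r)) (d + d') x +
                          orb (kadd k (kopp (kperm k' r))) (d - d') x).
Proof.
transitivity (\sum_(s : 'S_3) \sum_(r : 'S_3) cos (phase (kperm k s) x + d) *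
    cos (phase (kperm (kperm k' r) s) x + d')).
  rewrite /orb mulr_suml; apply: eq_bigr => s _.
  rewrite mulr_sumr (reindex_inj (mulgI s)); apply: eq_bigr => r _.
  congr (_ * cos (phase _ x + _)).
  by apply/funext => i; rewrite /kperm permM.
rewrite exchange_big /=; apply: eq_bigr => r _.
rewrite /orb -big_split mulr_sumr /=; apply: eq_bigr => s _.
rewrite cosM; congr (_ * (cos _ + cos _)).
  have -> : kperm (kadd k (kperm k' r)) s = kadd (kperm k s) (kperm (kperm k' r) s) by [].
  by rewrite phaseD; ring.
have -> : kperm (kadd k (kopp (kperm k' r))) s =
   kadd (kperm k s) (kopp (kperm (kperm k' r) s)) by [].
by rewrite phaseD phaseN; ring.
Qed.

End TrigPolynomials.

(** * Laplacian and normal derivative of an orbit *)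

Section Levels.
Context {R : realType}.
Variables (a : R) (V : 'I_3 -> R * R).
Hypotheses (a_gt0 : 0 < a) (V_equilateral : equilateral V a).
Implicit Types (x e : R * R) (i j : 'I_3) (f g p q : R * R -> R).
Implicit Types (k : 'I_3 -> int) (d : R) (s : 'S_3).
Notation orb := (orb V).
Notation mu2 := (mu2 a).

Local Opaque derive.

Lemma tame_sum (I : Type) (r : seq I) (F : I -> R * R -> R) :
  (forall l, tame (F l)) -> tame (fun x => \sum_(l <- r) F l x).
Proof.
move=> tF; elim: r => [|l r IH].
  by under eq_fun do rewrite big_nil; exact: tame_cst.
by under eq_fun do rewrite big_cons; exact: tame_add.
Qed.

Lemma derive_addfun f g e x : tame f -> tame g ->
  'D_e (fun y => f y + g y) x = 'D_e f x + 'D_e g x.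
Proof. by move=> tf tg; apply: deriveD; exact: tame_derivable. Qed.

Lemma derive_scalefun (r : R) f e x : tame f ->
  'D_e (fun y => r * f y) x = r * 'D_e f x.
Proof. by move=> tf; apply: (@deriveZ _ _ R^o); exact: tame_derivable. Qed.

Lemma derive_sumfun (I : Type) (r : seq I) (F : I -> R * R -> R) e x :
  (forall l, tame (F l)) ->
  'D_e (fun y => \sum_(l <- r) F l y) x = \sum_(l <- r) 'D_e (F l) x.
Proof.
move=> tF; elim: r => [|l r IH].
  under [in LHS]eq_fun do rewrite big_nil.
  by rewrite big_nil; exact: derive_cst.
under [in LHS]eq_fun do rewrite big_cons.
by rewrite derive_addfun ?IH ?big_cons//; exact: tame_sum.
Qed.

Lemma orb_tame k d : tame (orb k d).
Proof. by rewrite orb_wave; apply: tame_sum => s; exact: tame_wave. Qed.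

Lemma orb_derive k d e x : 'D_e (orb k d) x =
  - \sum_(s : 'S_3) dotp (freq V (kperm k s)) e * sin (phase V (kperm k s) x + d).
Proof.
rewrite orb_wave derive_sumfun => [|s]; last exact: tame_wave.
rewrite -sumrN; apply: eq_bigr => s _.
by rewrite wave_derive phaseE addrA mulNr.
Qed.

Lemma laplacian_orb k d x : laplacian (orb k d) x = - (mu2 * (qnat k)%:R) * orb k d x.
Proof.
have W (b : R * R) (c : R) (y : R * R) : laplacian (wave b c) y = - dotp b b * wave b c y.
  have D (e : R * R) : 'D_e (wave b c) = fun z => (- dotp b e) * wave b (c - pi / 2) z.
    by apply/funext => z; rewrite wave_derive /wave addrA cosBpihalf.
  rewrite /laplacian /d1 /d2 !D !derive_scalefun; [|exact: tame_wave..].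
  rewrite !wave_derive /wave addrA sinBpihalf /dotp /=; ring.
have tw s := tame_wave (freq V (kperm k s)) (phase_off V (kperm k s) + d).
rewrite orb_wave /laplacian.
have -> : d1 (fun x => \sum_(s : 'S_3) wave (freq V (kperm k s)) (phase_off V (kperm k s) + d) x)
   = (fun x => \sum_(s : 'S_3) d1 (wave (freq V (kperm k s)) (phase_off V (kperm k s) + d)) x).
  by apply/funext => y; exact: derive_sumfun.
have -> : d2 (fun x => \sum_(s : 'S_3) wave (freq V (kperm k s)) (phase_off V (kperm k s) + d) x)
   = (fun x => \sum_(s : 'S_3) d2 (wave (freq V (kperm k s)) (phase_off V (kperm k s) + d)) x).
  by apply/funext => y; exact: derive_sumfun.
pose w (s : 'S_3) := wave (freq V (kperm k s)) (phase_off V (kperm k s) + d).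
transitivity (\sum_s d1 (d1 (w s)) x + \sum_s d2 (d2 (w s)) x).
  congr (_ + _).
    by apply: (@derive_sumfun _ _ (fun s => d1 (w s)) (1, 0)) => s; exact/tame_d1/tame_wave.
  by apply: (@derive_sumfun _ _ (fun s => d2 (w s)) (0, 1)) => s; exact/tame_d2/tame_wave.
rewrite -big_split mulr_sumr /=; apply: eq_bigr => s _.
have := W (freq V (kperm k s)) (phase_off V (kperm k s) + d) x.
rewrite (freq_sqr a_gt0 V_equilateral) qform_perm -qnatE; exact.
Qed.

Let jm j : 'I_3 := ordS (ordS j).

Lemma normal_freq j k :
  dotp (normal V j) (freq V k) = 4 * pi / (3 * a ^+ 2) * (k j - k (jm j))%:~R.
Proof.
have a0 : a != 0 by rewrite gt_eqF.
pose G i i' : dotp (normal V i) (normal V i') = _ := normal_dot a_gt0 V_equilateral i i'.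
have E (w u v z t : R * R) (r0 r1 r2 r : R) :
   dotp w (r0 *: (r *: (u - v)) + r1 *: (r *: (v - z)) + r2 *: (r *: (z - t))) =
   r * (r0 * (dotp w u - dotp w v) + r1 * (dotp w v - dotp w z) + r2 * (dotp w z - dotp w t)).
  by rewrite /dotp !coordE; ring.
rewrite /freq big_I3v /ang_vec !ordS012 E !G /jm rmorphB /=.
by move: j; apply: I3P; rewrite !ordS012 /=; field.
Qed.

(** Exchanging two entries of [k] corresponds to the reflection in the side [bary V j = 0]. The
    phase changes by [- (k j - k (jm j))] times [ang j - ang (jm j)], which is [2 pi * bary V j x],
    less [2 pi] when [j = i2]; that exception gives [m]. *)
Lemma phase_tperm j k x : exists m : int,
  phase V (kperm k (tperm j (jm j))) x =
  phase V k x - 2 * pi * (k j - k (jm j))%:~R * bary V j x + 2 * pi * m%:~R.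
Proof.
have b1 : bary V i0 x + bary V i1 x + bary V i2 x = 1 by exact: bary_sum a_gt0 V_equilateral x.
have b2 : bary V i2 x = 1 - bary V i0 x - bary V i1 x by rewrite -b1; ring.
exists (if j == i2 then k j - k (jm j) else 0).
rewrite /phase !big_I3 /kperm /ang !ordS012 b2 /jm rmorphB /=.
move: j; apply: I3P; rewrite !ordS012 ?tpermL ?tpermR ?tpermD//= /ang_shift /= ?b2 ?rmorphB
  ?mulr0z /=; by field.
Qed.

(** By [normal_freq], a permutation and its composite with the transposition of [j] and [jm j] have
    opposite coefficients in the normal derivative. By [phase_tperm] their sines are taken at angles
    that differ, modulo [2 pi], by a multiple of [bary V j x], so the Lipschitz bound of [sin] gives
    the decay. *)
Lemma orb_neumann k d : neumann_bdry V (orb k d).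
Proof.
pose Dl j s : int := k (s j) - k (s (jm j)).
pose C j : R := `|4 * pi / (3 * a ^+ 2)| *
   \sum_(s : 'S_3) 2 * pi * ((Dl j s)%:~R ^+ 2).
have C0 j : 0 <= C j.
  rewrite mulr_ge0// sumr_ge0// => s _.
  by apply: mulr_ge0; [apply: mulr_ge0 => //; exact: pi_ge0|exact: sqr_ge0].
exists (C i0 + C i1 + C i2) => j x Tx.
have b0 : 0 < bary V j x by move: Tx; rewrite (open_triangleE a_gt0 V_equilateral).
have CC : C j <= C i0 + C i1 + C i2.
  by move: j {Tx b0}; apply: I3P; have := C0 i0; have := C0 i1; have := C0 i2; lra.
apply: (@le_trans _ _ (C j * bary V j x)); last by rewrite ler_pM2r.
pose S s : R := (Dl j s)%:~R * sin (phase V (kperm k s) x + d).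
have -> : dotp (normal V j) (gradient (orb k d) x) =
    - (4 * pi / (3 * a ^+ 2) * \sum_(s : 'S_3) S s).
  rewrite /gradient /dotp /= /d1 /d2 !orb_derive !mulrN -opprD; congr (- _).
  rewrite !mulr_sumr -big_split; apply: eq_bigr => s _ /=.
  have := normal_freq j (kperm k s); rewrite /S /Dl /kperm => E.
  rewrite [RHS]mulrA -E /dotp /=; ring.
rewrite normrN normrM /C -[X in _ <= X]mulrA; apply: ler_wpM2l => //.
(* Each term is paired with its mirror image, which counts everything twice. *)
have E2 : 2 * \sum_(s : 'S_3) S s = \sum_(s : 'S_3) (S s + S (tperm j (jm j) * s)%g).
  rewrite big_split /= mulrDl mul1r; congr (_ + _).
  exact: (reindex_inj (mulgI (tperm j (jm j)))).
rewrite -(ler_pM2l (ltr0n R 2)) -[2 in leLHS]ger0_norm// -normrM E2.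
apply: (le_trans (ler_norm_sum _ _ _)).
rewrite mulr_suml mulr_sumr; apply: ler_sum => s _.
have -> : S (tperm j (jm j) * s)%g =
   - (Dl j s)%:~R * sin (phase V (kperm k s) x + d - 2 * pi * (Dl j s)%:~R * bary V j x).
  rewrite /S; congr (_ * _).
    by rewrite /Dl !permM tpermL tpermR -rmorphN opprB.
  have [m Em] := phase_tperm j (kperm k s) x.
  have -> : kperm k (tperm j (jm j) * s)%g = kperm (kperm k s) (tperm j (jm j)).
    by apply/funext => i; rewrite /kperm permM.
  by rewrite Em -[RHS](sinD2piz _ m); congr sin; rewrite /kperm /Dl; ring.
rewrite mulNr -mulrBr normrM.
have := sin_lipschitz (phase V (kperm k s) x + d)
  (phase V (kperm k s) x + d - 2 * pi * (Dl j s)%:~R * bary V j x).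
rewrite opprB [X in _ <= `|X|]addrC subrK => H.
apply: (@le_trans _ _ (`|(Dl j s)%:~R| * `|2 * pi * (Dl j s)%:~R * bary V j x|)).
  by rewrite ler_wpM2l.
rewrite !normrM (ger0_norm (pi_ge0 R)) (gtr0_norm b0) (@ger0_norm _ 2)//.
have -> : `|(Dl j s)%:~R| * (2 * pi * `|(Dl j s)%:~R| * bary V j x) =
  2 * pi * `|(Dl j s)%:~R : R| ^+ 2 * bary V j x by ring.
rewrite real_normK ?num_real//.
have : 0 <= 2 * pi * ((Dl j s)%:~R : R) ^+ 2 * bary V j x.
  by apply: mulr_ge0; [apply: mulr_ge0; [apply: mulr_ge0 => //; exact: pi_ge0|
    exact: sqr_ge0]|exact: ltW].
lra.
Qed.

End Levels.

(** Four times the norm is [(2 v - u)^2 + 3 u^2], so norm 1 forces [u], and by symmetry [v], into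
    [- 1], [0], [1]. These are the six units of the Eisenstein integers. *)
Lemma eisenstein_units (u v : int) : u ^+ 2 + v ^+ 2 - u * v = 1 ->
  [\/ u = 1 /\ v = 0, u = -1 /\ v = 0, u = 0 /\ v = 1 |
     [\/ u = 0 /\ v = -1, u = 1 /\ v = 1 | u = -1 /\ v = -1]].
Proof.
have bound (y z : int) : y ^+ 2 + z ^+ 2 - y * z = 1 -> [\/ y = -1, y = 0 | y = 1].
  move=> h; have := sqr_ge0 (2 * z - y).
  have -> : (2 * z - y) ^+ 2 = 4 * (y ^+ 2 + z ^+ 2 - y * z) - 3 * (y * y) by ring.
  rewrite h => {h} h; have {h} : -1 <= y <= 1 by nia.
  move=> h; have [//|[//|//]] : y = -1 \/ y = 0 \/ y = 1 by lia.
  - by constructor 1.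
  - by constructor 2.
  - by constructor 3.
move=> h; have bu := bound _ _ h.
have bv : [\/ v = -1, v = 0 | v = 1] by apply: (bound v u); rewrite -h; ring.
case: bu bv h => -> [] -> //= _.
- by apply/Or44/Or33.
- by apply: Or42.
- by apply/Or44/Or31.
- by apply: Or43.
- by apply: Or41.
- by apply/Or44/Or32.
Qed.

(** * The algebra of trigonometric polynomials and its levels *)

Section TrigAlgebra.
Context {R : realType}.
Variables (a : R) (V : 'I_3 -> R * R).
Hypotheses (a_gt0 : 0 < a) (V_equilateral : equilateral V a).
Implicit Types (x e : R * R) (i j : 'I_3) (f g p q : R * R -> R).
Implicit Types (k : 'I_3 -> int) (d : R) (s : 'S_3) (N : nat).
Notation orb := (orb V).
Notation mu2 := (mu2 a).

Local Opaque derive.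

Inductive trig : (R * R -> R) -> Prop :=
| trig_orb k d : trig (orb k d)
| trig_add p q : trig p -> trig q -> trig (fun x => p x + q x)
| trig_scale (r : R) p : trig p -> trig (fun x => r * p x).

Inductive level N : (R * R -> R) -> Prop :=
| level_orb k d : qnat k = N -> level N (orb k d)
| level_add p q : level N p -> level N q -> level N (fun x => p x + q x)
| level_scale (r : R) p : level N p -> level N (fun x => r * p x).

Lemma level_tame N p : level N p -> tame p.
Proof.
elim=> {p} [k d _|p q _ tp _ tq|r p _ tp]; first exact: orb_tame.
- exact: tame_add.
- exact: tame_scale.
Qed.

Lemma laplacian_add p q x : tame p -> tame q ->
  laplacian (fun x => p x + q x) x = laplacian p x + laplacian q x.
Proof.
move=> tp tq; rewrite /laplacian.
have -> : d1 (fun x => p x + q x) = fun x => d1 p x + d1 q x.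
  by apply/funext => y; exact: derive_addfun.
have -> : d2 (fun x => p x + q x) = fun x => d2 p x + d2 q x.
  by apply/funext => y; exact: derive_addfun.
have -> : d1 (fun x => d1 p x + d1 q x) x = d1 (d1 p) x + d1 (d1 q) x.
  by apply: derive_addfun; exact: tame_d1.
have -> : d2 (fun x => d2 p x + d2 q x) x = d2 (d2 p) x + d2 (d2 q) x.
  by apply: derive_addfun; exact: tame_d2.
exact: addrACA.
Qed.

Lemma laplacian_scale (r : R) p x : tame p ->
  laplacian (fun x => r * p x) x = r * laplacian p x.
Proof.
move=> tp; rewrite /laplacian.
have -> : d1 (fun x => r * p x) = fun x => r * d1 p x.
  by apply/funext => y; exact: derive_scalefun.
have -> : d2 (fun x => r * p x) = fun x => r * d2 p x.
  by apply/funext => y; exact: derive_scalefun.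
have -> : d1 (fun x => r * d1 p x) x = r * d1 (d1 p) x.
  by apply: derive_scalefun; exact: tame_d1.
have -> : d2 (fun x => r * d2 p x) x = r * d2 (d2 p) x.
  by apply: derive_scalefun; exact: tame_d2.
by rewrite mulrDr.
Qed.

Lemma gradient_add p q x : tame p -> tame q ->
  gradient (fun x => p x + q x) x = gradient p x + gradient q x.
Proof.
move=> tp tq; apply: injective_projections; rewrite !coordE /=; exact: derive_addfun.
Qed.

Lemma gradient_scale (r : R) p x : tame p ->
  gradient (fun x => r * p x) x = r *: gradient p x.
Proof.
move=> tp; apply: injective_projections; rewrite !coordE /=; exact: derive_scalefun.
Qed.

Lemma neumann_add p q : tame p -> tame q -> neumann_bdry V p -> neumann_bdry V q ->
  neumann_bdry V (fun x => p x + q x).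
Proof.
move=> tp tq [C hC] [D hD]; exists (C + D) => i x Tx.
rewrite gradient_add// dotpDr mulrDl (le_trans (ler_normD _ _))//.
by apply: lerD; [exact: hC|exact: hD].
Qed.

Lemma neumann_scale (r : R) p : tame p -> neumann_bdry V p ->
  neumann_bdry V (fun x => r * p x).
Proof.
move=> tp [C hC]; exists (`|r| * C) => i x Tx.
by rewrite gradient_scale// dotpZr normrM -mulrA ler_wpM2l// hC.
Qed.

Lemma level_neumann N p : level N p -> neumann_bdry V p.
Proof.
elim=> {p} [k d _|p q lp np lq nq|r p lp np].
- exact: (orb_neumann a_gt0 V_equilateral).
- by apply: neumann_add => //; exact: (level_tame (N := N)).
- by apply: neumann_scale => //; exact: (level_tame (N := N)).
Qed.

Lemma level_laplacian N p x : level N p -> laplacian p x = - (mu2 * N%:R) * p x.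
Proof.
elim=> {p} [k d <-|p q lp IHp lq IHq|r p lp IHp].
- exact: (laplacian_orb a_gt0 V_equilateral).
- by rewrite laplacian_add ?IHp ?IHq ?mulrDr//; exact: (level_tame (N := N)).
- by rewrite laplacian_scale ?IHp; [exact: mulrCA|exact: (level_tame (N := N))].
Qed.

Lemma cst_orb (r : R) : (fun=> r) = (fun x => r / 6 * orb (fun=> 0) 0 x).
Proof.
apply/funext => x; rewrite /orb.
rewrite (eq_bigr (fun=> 1)) => [|s _]; last first.
  by rewrite /phase /kperm big1 ?addr0 ?cos0// => i _; rewrite mul0r.
by rewrite sumr_const (_ : #|_| = 6%N) ?card_Sn// divfK.
Qed.

Lemma trig_cst (r : R) : trig (fun=> r).
Proof. by rewrite cst_orb; exact/trig_scale/trig_orb. Qed.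

Lemma level_cst (r : R) : level 0 (fun=> r).
Proof. by rewrite cst_orb; apply/level_scale/level_orb. Qed.

Lemma trig_sum (I : finType) (F : I -> R * R -> R) :
  (forall l, trig (F l)) -> trig (fun x => \sum_l F l x).
Proof.
move=> tF; elim: (index_enum I) => [|l r IH].
  by under eq_fun do rewrite big_nil; exact: trig_cst.
by under eq_fun do rewrite big_cons; exact: trig_add.
Qed.

Lemma trig_mul p q : trig p -> trig q -> trig (fun x => p x * q x).
Proof.
move=> tp tq; elim: tp => {p} [k d|p p' _ IHp _ IHp'|r p _ IHp]; last 2 first.
- by under eq_fun do rewrite mulrDl; exact: trig_add.
- by under eq_fun do rewrite -mulrA; exact: trig_scale.
elim: tq => {q} [k' d'|q q' _ IHq _ IHq'|r q _ IHq]; last 2 first.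
- by under eq_fun do rewrite mulrDr; exact: trig_add.
- by under eq_fun do rewrite mulrCA; exact: trig_scale.
under eq_fun do rewrite orbM.
apply: trig_sum => r; apply: trig_scale.
by apply: trig_add; exact: trig_orb.
Qed.

Lemma trig_tame p : trig p -> tame p.
Proof.
elim=> {p} [k d|p q _ tp _ tq|r p _ tp]; first exact: orb_tame.
- exact: tame_add.
- exact: tame_scale.
Qed.

(* Components equal to 0 are allowed at every level, including the levels that
   contain no frequency. *)
Definition level0 N p := p = (fun=> 0) \/ level N p.

Lemma level0_add N p q : level0 N p -> level0 N q -> level0 N (fun x => p x + q x).
Proof.
move=> [->|lp] [->|lq].
- by left; apply/funext => x; rewrite addr0.
- by right; under eq_fun do rewrite add0r.
- by right; under eq_fun do rewrite addr0.
- by right; exact: level_add.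
Qed.

Lemma level0_scale N (r : R) p : level0 N p -> level0 N (fun x => r * p x).
Proof.
move=> [->|lp]; first by left; apply/funext => x; rewrite mulr0.
by right; exact: level_scale.
Qed.

(** The components form a sequence over all levels, zero from [M] on, so that decompositions of
    different lengths can be added. *)
Lemma trig_decomp p : trig p -> exists (M : nat) (P : nat -> R * R -> R),
  (forall N, level0 N (P N)) /\ (forall x, p x = \sum_(N < M) P N x) /\
  (forall N, (M <= N)%N -> P N = (fun=> 0)).
Proof.
elim=> {p} [k d|p q _ [M [P [lP [eP zP]]]] _ [M' [P' [lP' [eP' zP']]]]|r p _ [M [P [lP [eP zP]]]]].
- exists (qnat k).+1, (fun N x => if N == qnat k then orb k d x else 0).
  split; [|split].
  + move=> N; case: (eqVneq N (qnat k)) => [->|_]; last by left.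
    by right; exact: level_orb.
  + move=> x; rewrite big_ord_recr /= eqxx big1 ?add0r// => i _.
    by rewrite ltn_eqF.
  + by move=> N kN; rewrite gtn_eqF.
- have wide (m n : nat) (Q : nat -> R * R -> R) x : (m <= n)%N ->
      (forall N, (m <= N)%N -> Q N = (fun=> 0)) ->
      \sum_(N < m) Q N x = \sum_(N < n) Q N x.
    move=> mn zQ; rewrite -!(big_mkord predT (Q ^~ x)) (@big_cat_nat _ _ _ m 0 n)//=.
    rewrite [X in _ + X]big_nat_cond [X in _ + X]big1 ?addr0// => i /andP[/andP[mi _] _].
    by rewrite zQ.
  exists (maxn M M'), (fun N x => P N x + P' N x); split; [|split].
  + by move=> N; exact: level0_add.
  + move=> x; rewrite big_split /= eP eP'.
    by rewrite (wide M (maxn M M') P)// ?(wide M' (maxn M M') P')// ?leq_maxl ?leq_maxr.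
  + move=> N; rewrite geq_max => /andP[h h']; apply/funext => x.
    by rewrite zP ?zP' ?addr0.
- exists M, (fun N x => r * P N x); split; [|split].
  + by move=> N; exact: level0_scale.
  + by move=> x; rewrite eP mulr_sumr.
  + by move=> N h; apply/funext => x; rewrite zP ?mulr0.
Qed.

Lemma orb_shift k (m : int) d : orb (kadd k (fun=> m)) d = orb k d.
Proof.
apply/funext => x; apply: eq_bigr => s _; congr (cos (_ + _)).
have -> : kperm (kadd k (fun=> m)) s = kadd (kperm k s) (fun=> m) by [].
rewrite phaseD; suff -> : phase V (fun=> m) x = 0 by rewrite addr0.
by rewrite /phase -mulr_sumr big_I3 ang_sum mulr0.
Qed.

Lemma orb_opp k d : orb (kopp k) d = orb k (- d).
Proof.
apply/funext => x; apply: eq_bigr => s _.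
have -> : kperm (kopp k) s = kopp (kperm k s) by [].
by rewrite phaseN -cosN opprD opprK.
Qed.

Definition kunit i : 'I_3 -> int := fun j => if j == i then 1 else 0.

(** [eigX] and [eigY] are the real part and minus the imaginary part of twice
    [e^(i t_0) + e^(i t_1) + e^(i t_2)]. They span level 1 and, taken together, separate the points
    of the triangle. *)
Definition eigX : R * R -> R := orb (kunit i0) 0.
Definition eigY : R * R -> R := orb (kunit i0) (pi / 2).

Lemma orb_unit i d : orb (kunit i) d = orb (kunit i0) d.
Proof.
rewrite -(orb_perm V (kunit i0) (tperm i i0)); congr (orb _ d).
apply/funext => j; rewrite /kperm /kunit; congr (if _ then _ else _).
by rewrite -{2}(tpermL i i0) (inj_eq perm_inj).
Qed.

Lemma orb_rotate k d x : orb k d x = cos d * orb k 0 x + sin d * orb k (pi / 2) x.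
Proof.
rewrite /orb !mulr_sumr -big_split; apply: eq_bigr => s _ /=.
by rewrite cosD addr0 cosDpihalf; ring.
Qed.

Lemma level_zero p : level 0 p -> exists r : R, forall x, p x = r.
Proof.
elim=> {p} [k d k0|p q _ [r hr] _ [r' hr']|t p _ [r hr]]; last 2 first.
- by exists (r + r') => x; rewrite hr hr'.
- by exists (t * r) => x; rewrite hr.
have /eqP := k0; rewrite /qnat absz_eq0 => /eqP q0.
have /eqP : (k i0 - k i1) ^+ 2 + (k i1 - k i2) ^+ 2 + (k i2 - k i0) ^+ 2 = 0.
  by transitivity (2 * qform k); [rewrite /qform; ring|rewrite q0].
rewrite !paddr_eq0 ?addr_ge0 ?sqr_ge0// !sqrf_eq0 !subr_eq0.
move=> /andP[/andP[/eqP h1 /eqP h2] _].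
exists (orb (fun=> 0) d 0) => x.
have -> : k = kadd (fun=> 0) (fun=> k i1).
  by apply/funext; apply: I3P; rewrite /kadd add0r.
rewrite orb_shift; apply: eq_bigr => s _; congr (cos (_ + _)).
by rewrite /phase /kperm !big1// => i _; rewrite mul0r.
Qed.

(** Modulo constants, the frequencies of norm 1 are the six units, that is [kunit i] and their
    opposites. All [kunit i] have the same orbit, and passing to the opposite only changes the sign
    of [d]. *)
Lemma level_one p : level 1 p ->
  exists r t : R, forall x, p x = r * eigX x + t * eigY x.
Proof.
elim=> {p} [k d k1|p q _ [r [t h]] _ [r' [t' h']]|c p _ [r [t h]]]; last 2 first.
- by exists (r + r'), (t + t') => x; rewrite h h'; ring.
- by exists (c * r), (c * t) => x; rewrite h; ring.
have q1 : qform k = 1 by rewrite -[LHS]ger0_norm ?qform_ge0// -abszE -/(qnat k) k1.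
have E d' : exists r t : R, forall x, orb (kunit i0) d' x = r * eigX x + t * eigY x.
  by exists (cos d'), (sin d') => x; exact: orb_rotate.
have [i [m [ek|ek]]] : exists i (m : int),
    k = kadd (kunit i) (fun=> m) \/ k = kadd (kopp (kunit i)) (fun=> m).
  have W i (m c : int) : (forall j, k j = c * kunit i j + m) -> c = 1 \/ c = -1 ->
     exists i (m : int), k = kadd (kunit i) (fun=> m) \/ k = kadd (kopp (kunit i)) (fun=> m).
    move=> h [E1|E1]; exists i, m; [left|right]; apply/funext => j.
      by rewrite h E1 mul1r.
    by rewrite h E1 mulN1r.
  have D i (m c : int) : k i0 = c * kunit i i0 + m -> k i1 = c * kunit i i1 + m ->
      k i2 = c * kunit i i2 + m -> forall j, k j = c * kunit i j + m.
    by move=> h0 h1 h2; apply: I3P.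
  move: q1; rewrite /qform => q1.
  pose u := k i0 - k i2; pose v := k i1 - k i2.
  have quv : u ^+ 2 + v ^+ 2 - u * v = 1 by rewrite -q1 /u /v; ring.
  have C := eisenstein_units quv.
  rewrite /u /v in C.
  case: C => [[h1 h2]|[h1 h2]|[h1 h2]|[[h1 h2]|[h1 h2]|[h1 h2]]].
  + apply: (W i0 (k i2) 1); last by left. by apply: D; rewrite /kunit /=; lia.
  + apply: (W i0 (k i2) (-1)); last by right. by apply: D; rewrite /kunit /=; lia.
  + apply: (W i1 (k i2) 1); last by left. by apply: D; rewrite /kunit /=; lia.
  + apply: (W i1 (k i2) (-1)); last by right. by apply: D; rewrite /kunit /=; lia.
  + apply: (W i2 (k i0) (-1)); last by right. by apply: D; rewrite /kunit /=; lia.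
  + apply: (W i2 (k i0) 1); last by left. by apply: D; rewrite /kunit /=; lia.
- by rewrite ek orb_shift orb_unit; exact: E.
- by rewrite ek orb_shift orb_opp orb_unit; exact: E.
Qed.

Lemma eigX_level : level 1 eigX.
Proof. exact: level_orb. Qed.

Lemma eigY_level : level 1 eigY.
Proof. exact: level_orb. Qed.

End TrigAlgebra.

(** * Separation of points: three points on the circle *)

Section ThreeRoots.
Variable F : fieldType.
Implicit Types u v w : F.

Lemma two_roots u1 u2 v1 v2 : u1 + u2 = v1 + v2 -> u1 * u2 = v1 * v2 ->
  (u1 = v1 /\ u2 = v2) \/ (u1 = v2 /\ u2 = v1).
Proof.
move=> s p; have : (u1 - v1) * (u1 - v2) = 0.
  transitivity (u1 ^+ 2 - (v1 + v2) * u1 + v1 * v2); first ring.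
  by rewrite -s -p; ring.
move=> /eqP; rewrite mulf_eq0 !subr_eq0 => /orP[] /eqP e; [left|right]; split=> //.
  by apply: (addrI v1); rewrite -s e.
by apply: (addrI v2); rewrite addrC [RHS]addrC -s -e addrC.
Qed.

(** [u0] is a root of the cubic whose roots are the [v], hence one of them. Cancelling [u0 != 0] in
    the triple product yields the product of the remaining two, and their sum is known. *)
Lemma three_roots u0 u1 u2 v0 v1 v2 :
  u0 + u1 + u2 = v0 + v1 + v2 ->
  u0 * u1 + u1 * u2 + u2 * u0 = v0 * v1 + v1 * v2 + v2 * v0 ->
  u0 * u1 * u2 = v0 * v1 * v2 -> u0 != 0 ->
  [\/ u0 = v0 /\ (u1 = v1 /\ u2 = v2 \/ u1 = v2 /\ u2 = v1),
      u0 = v1 /\ (u1 = v0 /\ u2 = v2 \/ u1 = v2 /\ u2 = v0) |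
      u0 = v2 /\ (u1 = v0 /\ u2 = v1 \/ u1 = v1 /\ u2 = v0)].
Proof.
move=> e1 e2 e3 u00; have : (u0 - v0) * ((u0 - v1) * (u0 - v2)) = 0.
  transitivity (u0 ^+ 3 - (v0 + v1 + v2) * u0 ^+ 2
     + (v0 * v1 + v1 * v2 + v2 * v0) * u0 - v0 * v1 * v2); first ring.
  by rewrite -e1 -e2 -e3; ring.
have H v w w' : u0 = v -> v + w + w' = v0 + v1 + v2 -> v * w * w' = v0 * v1 * v2 ->
    u1 = w /\ u2 = w' \/ u1 = w' /\ u2 = w.
  move=> uv s p; apply: two_roots.
    by apply: (addrI u0); rewrite addrA e1 -s uv addrA.
  by apply: (mulfI u00); rewrite mulrA e3 -p uv mulrA.
move=> /eqP; rewrite !mulf_eq0 !subr_eq0 => /orP[/eqP e|/orP[]/eqP e].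
- by apply: Or31; split=> //; apply: (H v0).
- by apply: Or32; split=> //; apply: (H v1) => //; ring.
- by apply: Or33; split=> //; apply: (H v2) => //; ring.
Qed.

End ThreeRoots.

Section Angles.
Context {R : realType}.
Implicit Types s t : R.

Definition expi t : R[i] := (cos t +i* sin t)%C.

Lemma expiD s t : expi (s + t) = expi s * expi t.
Proof.
by apply/eqP; rewrite eq_complex /= cosD sinD [sin s * _ + _]addrC !eqxx.
Qed.

Lemma expi0 : expi 0 = 1.
Proof. by apply/eqP; rewrite eq_complex /= cos0 sin0 !eqxx. Qed.

Lemma expi_neq0 t : expi t != 0.
Proof.
have : expi t * expi (- t) = 1 by rewrite -expiD subrr expi0.
by apply: contra_eq_neq => ->; rewrite mul0r eq_sym oner_eq0.
Qed.

Lemma sin_eq0_small t : sin t = 0 -> `|t| < 2 * pi -> [\/ t = 0, t = pi | t = - pi].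
Proof.
have H (r : R) : 0 < r -> r < 2 * pi -> sin r = 0 -> r = pi.
  move=> r0 r2 s0; case: (ltgtP r pi) => // h.
    by have := @sin_gt0_pi R r; rewrite r0 h s0 ltxx => /(_ isT).
  have := @sin_gt0_pi R (r - pi); have := sinDpi (r - pi).
  rewrite subrK s0 => /eqP; rewrite eq_sym oppr_eq0 => /eqP -> /(_ _).
  by rewrite ltxx => h2; exfalso; have : false by apply: h2; lra.
move=> s0; rewrite ltr_norml => /andP[h1 h2]; have [t0|t0|->] := ltgtP t 0.
- apply: Or33; rewrite -[LHS]opprK; congr (- _); apply: H; [lra|lra|].
  by rewrite sinN s0 oppr0.
- by apply: Or32; exact: H.
- exact: Or31.
Qed.

(** On the closed triangle every [ang] is at most [4 pi / 3] in absolute value, so two of them are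
    less than [4 pi] apart and can differ by one turn at most. *)
Lemma expi_inj_small s t : expi s = expi t -> `|s - t| < 4 * pi ->
  [\/ s = t, s = t + 2 * pi | s = t - 2 * pi].
Proof.
move=> /eqP; rewrite eq_complex /= => /andP[/eqP ec /eqP es] st.
have : cos (s - t) = 1 by rewrite cosB ec es -!expr2 cos2Dsin2.
have -> : s - t = ((s - t) / 2) *+ 2 by rewrite -mulr_natl; field.
rewrite cos_mulr2n => h.
have : sin ((s - t) / 2) = 0.
  apply/eqP; rewrite -sqrf_eq0 sin2cos2; apply/eqP.
  have -> : cos ((s - t) / 2) ^+ 2 = 1 by move: h; rewrite mulr2n; lra.
  by rewrite subrr.
move=> /sin_eq0_small H; have : `|(s - t) / 2| < 2 * pi.
  by rewrite normrM [`|2^-1|]ger0_norm// ltr_pdivrMr//; lra.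
move=> /H[] h2; [apply: Or31|apply: Or32|apply: Or33]; lra.
Qed.

End Angles.

Section Arcs.
Context {R : realFieldType}.

Definition eq_mod3 (r r' : R) := [\/ r = r', r = r' + 3 | r = r' - 3].

Lemma arcs_unique (x0 x1 x2 y0 y1 y2 : R) :
  0 <= x0 -> 0 <= x1 -> 0 <= x2 -> 0 <= y0 -> 0 <= y1 -> 0 <= y2 ->
  x0 + x1 + x2 = 1 -> y0 + y1 + y2 = 1 ->
  let X0 := x0 - x1 + 0 in let X1 := x1 - x2 + 1 in let X2 := x2 - x0 - 1 in
  let Y0 := y0 - y1 + 0 in let Y1 := y1 - y2 + 1 in let Y2 := y2 - y0 - 1 in
  [\/ eq_mod3 X0 Y0 /\ (eq_mod3 X1 Y1 /\ eq_mod3 X2 Y2 \/ eq_mod3 X1 Y2 /\ eq_mod3 X2 Y1),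
      eq_mod3 X0 Y1 /\ (eq_mod3 X1 Y0 /\ eq_mod3 X2 Y2 \/ eq_mod3 X1 Y2 /\ eq_mod3 X2 Y0) |
      eq_mod3 X0 Y2 /\ (eq_mod3 X1 Y0 /\ eq_mod3 X2 Y1 \/ eq_mod3 X1 Y1 /\ eq_mod3 X2 Y0)] ->
  x0 = y0 /\ x1 = y1.
Proof.
move=> x00 x10 x20 y00 y10 y20 sx sy /=.
have ex : x2 = 1 - x0 - x1 by rewrite -sx; ring.
have ey : y2 = 1 - y0 - y1 by rewrite -sy; ring.
subst x2 y2; clear sx sy.
by case=> -[h0 [[h1 h2]|[h1 h2]]]; case: h0 => h0; case: h1 => h1; case: h2 => h2;
  (exfalso; lra) || (split; lra).
Qed.

End Arcs.

Section Injectivity.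
Context {R : realType}.
Variables (a : R) (V : 'I_3 -> R * R).
Hypotheses (a_gt0 : 0 < a) (V_equilateral : equilateral V a).
Implicit Types (x y : R * R) (i j : 'I_3) (s : 'S_3).

Lemma sum_perm_image (G : 'I_3 -> R) (j : 'I_3) :
  \sum_(s : 'S_3) G (s j) = 2 * \sum_(i < 3) G i.
Proof.
have E i : \sum_(s : 'S_3) G (s i) = \sum_(s : 'S_3) G (s j).
  rewrite [RHS](reindex_inj (mulgI (tperm i j))).
  by apply: eq_bigr => s _; rewrite permM tpermR.
have : \sum_(i < 3) \sum_(s : 'S_3) G (s i) = \sum_(s : 'S_3) \sum_(i < 3) G i.
  rewrite exchange_big; apply: eq_bigr => s _ /=.
  by rewrite [RHS](reindex_inj (@perm_inj _ s)).
rewrite (eq_bigr _ (fun i _ => E i)) !sumr_const card_ord (_ : #|_| = 6%N) ?card_Sn//.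
by lra.
Qed.

Lemma orb_unitE d x : orb V (kunit i0) d x = 2 * \sum_(i < 3) cos (ang V i x + d).
Proof.
rewrite /orb (reindex_inj invg_inj) -(sum_perm_image (fun i => cos (ang V i x + d)) i0).
apply: eq_bigr => s _; congr (cos (_ + _)).
rewrite /phase (bigD1 (s i0)) //= big1 ?addr0.
  by rewrite /kperm /kunit permK eqxx mul1r.
move=> i ne; rewrite /kperm /kunit ifF ?mul0r//; apply/negbTE.
by apply: contra ne => /eqP <-; rewrite permKV.
Qed.

Lemma eig_expi x y : eigX V x = eigX V y -> eigY V x = eigY V y ->
  \sum_(i < 3) expi (ang V i x) = \sum_(i < 3) expi (ang V i y) /\
  \sum_(i < 3) expi (- ang V i x) = \sum_(i < 3) expi (- ang V i y).
Proof.
rewrite /eigX /eigY !orb_unitE => /(mulfI (negbT (pnatr_eq0 R 2))) ec.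
move=> /(mulfI (negbT (pnatr_eq0 R 2))) es.
have {}ec : \sum_(i < 3) cos (ang V i x) = \sum_(i < 3) cos (ang V i y).
  by move: ec; under eq_bigr do rewrite addr0; under [in RHS]eq_bigr do rewrite addr0.
have {}es : \sum_(i < 3) sin (ang V i x) = \sum_(i < 3) sin (ang V i y).
  apply: oppr_inj; rewrite -!sumrN; move: es.
  by under eq_bigr do rewrite cosDpihalf; under [in RHS]eq_bigr do rewrite cosDpihalf.
rewrite !big_ord_recl !big_ord0 !addr0 in ec es *.
rewrite /expi; split; apply/eqP; rewrite eq_complex /=.
  by rewrite ec es !eqxx.
by rewrite !cosN !sinN -!opprD ec es !eqxx.
Qed.

(** For unit complex numbers of product 1 the second symmetric function is the conjugate of the sum.
    The sum, known from [eigX] and [eigY], thus fixes all coefficients of the cubic and hence the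
    three points up to order; [arcs_unique] recovers the coordinates. *)
Lemma eig_injective x y : closed_triangle V x -> closed_triangle V y ->
  eigX V x = eigX V y -> eigY V x = eigY V y -> x = y.
Proof.
move=> Tx Ty eX eY; have [E1 E2] := eig_expi eX eY.
have bx := bary_sum a_gt0 V_equilateral x; have by_ := bary_sum a_gt0 V_equilateral y.
suff [e0 e1] : bary V i0 x = bary V i0 y /\ bary V i1 x = bary V i1 y.
  rewrite (bary_comb a_gt0 V_equilateral x) (bary_comb a_gt0 V_equilateral y) e0 e1.
  by congr (_ + _ *: _); move: bx by_; rewrite e0 e1 => <- /addrI.
have I3s (G : 'I_3 -> R[i]) : \sum_(i < 3) G i = G i0 + G i1 + G i2.
  rewrite !big_ord_recl big_ord0 addr0 addrA.
  by congr (G _ + G _ + G _); exact/val_inj.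
have P z : expi (ang V i0 z) * expi (ang V i1 z) * expi (ang V i2 z) = 1.
  by rewrite -!expiD ang_sum expi0.
have Q z : expi (ang V i0 z) * expi (ang V i1 z) + expi (ang V i1 z) * expi (ang V i2 z)
    + expi (ang V i2 z) * expi (ang V i0 z) = \sum_(i < 3) expi (- ang V i z).
  have s0 := ang_sum V z; rewrite I3s -!expiD [RHS]addrC [_ + expi (- ang V i1 z)]addrC.
  rewrite !addrA [RHS]addrAC; congr (expi _ + expi _ + expi _); lra.
have pi0 := pi_gt0 R.
have B i j : expi (ang V i x) = expi (ang V j y) ->
  [\/ ang V i x = ang V j y, ang V i x = ang V j y + 2 * pi | ang V i x = ang V j y - 2 * pi].
  move=> e; apply: expi_inj_small => //.
  have H z l : closed_triangle V z -> `|ang V l z| <= 4 * pi / 3.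
    move=> Tz; have := (Tz i0, Tz i1, Tz i2) => -[[z0 z1] z2].
    have := bary_sum a_gt0 V_equilateral z.
    rewrite /ang normrM (@ger0_norm _ (2 * pi / 3)); last by lra.
    move=> bz; have : `|bary V l z - bary V (ordS l) z + ang_shift l| <= 2 :> R.
      by rewrite ler_norml; move: l; apply: I3P; rewrite !ordS012 /ang_shift /=; lra.
    by nra.
  have := ler_normB (ang V i x) (ang V j y); have := H _ i Tx; have := H _ j Ty; lra.
have S z i : ang V i z = 2 * pi * ((bary V i z - bary V (ordS i) z + ang_shift i) / 3).
  by rewrite /ang; field.
have D i j : expi (ang V i x) = expi (ang V j y) ->
   let r := bary V i x - bary V (ordS i) x + ang_shift i in
   let r' := bary V j y - bary V (ordS j) y + ang_shift j in
   [\/ r = r', r = r' + 3 | r = r' - 3].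
  have p2 : 2 * pi != 0 :> R by rewrite mulf_neq0// gt_eqF.
  move=> /B[]; rewrite !S => h; [apply: Or31|apply: Or32|apply: Or33].
  - have := mulfI p2 h; lra.
  - have : 2 * pi * ((bary V i x - bary V (ordS i) x + ang_shift i) / 3) =
      2 * pi * ((bary V j y - bary V (ordS j) y + ang_shift j) / 3 + 1) :> R.
      by rewrite h; ring.
    by move=> /(mulfI p2); lra.
  - have : 2 * pi * ((bary V i x - bary V (ordS i) x + ang_shift i) / 3) =
      2 * pi * ((bary V j y - bary V (ordS j) y + ang_shift j) / 3 - 1) :> R.
      by rewrite h; ring.
    by move=> /(mulfI p2); lra.
have := @three_roots _ (expi (ang V i0 x)) (expi (ang V i1 x)) (expi (ang V i2 x))
  (expi (ang V i0 y)) (expi (ang V i1 y)) (expi (ang V i2 y)).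
rewrite !I3s in E1.
rewrite !P !Q E2 => /(_ E1 erefl erefl (expi_neq0 _)).
have := arcs_unique (Tx i0) (Tx i1) (Tx i2) (Ty i0) (Ty i1) (Ty i2) bx by_.
move=> U [] [/D h0 [[/D h1 /D h2]|[/D h1 /D h2]]]; apply: U; move: h0 h1 h2;
  rewrite !ordS012 /ang_shift /= => h0 h1 h2.
- by apply: Or31; split=> //; left.
- by apply: Or31; split=> //; right.
- by apply: Or32; split=> //; left.
- by apply: Or32; split=> //; right.
- by apply: Or33; split=> //; left.
- by apply: Or33; split=> //; right.
Qed.

End Injectivity.

(** * Polynomials converging to a step function *)

Section StepPolynomials.
Context {R : realType}.
Implicit Types s x : R.

Lemma bernoulli_le x (n : nat) : 0 <= x -> x <= 1 -> 1 - n%:R * x <= (1 - x) ^+ n.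
Proof.
move=> x0 x1; elim: n => [|n IH]; first by rewrite mul0r subr0 expr0.
rewrite exprS -[n.+1]addn1 natrD.
have h : 0 <= (1 - x) * ((1 - x) ^+ n - (1 - n%:R * x)).
  by rewrite mulr_ge0 ?subr_ge0.
have n0 : 0 <= n%:R * x ^+ 2 by rewrite mulr_ge0 ?sqr_ge0.
nra.
Qed.

(* [(1 - s^n)^(2^n)] tends to 1 below 1/2 and to 0 above; the second factor
   takes care of the point 1/2 itself. *)
Definition step (n : nat) s : R :=
  (1 - s ^+ n) ^+ (2 ^ n) * (1 - (1 - (s - 2^-1) ^+ 2) ^+ n).

Lemma step_bound n s : 0 <= s -> s <= 1 -> `|step n s| <= 1.
Proof.
move=> s0 s1; have a1 : 0 <= 1 - s ^+ n <= 1.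
  by rewrite subr_ge0 exprn_ile1//= gerBl exprn_ge0.
have b1 : 0 <= 1 - (s - 2^-1) ^+ 2 <= 1.
  rewrite gerBl sqr_ge0 andbT subr_ge0 expr2; nra.
move: a1 b1 => /andP[a0 a1] /andP[b0 b1].
rewrite /step normrM mulr_ile1 ?normr_ge0//.
  by rewrite ger0_norm ?exprn_ge0 ?exprn_ile1.
by rewrite ger0_norm ?subr_ge0 ?exprn_ile1// gerBl exprn_ge0.
Qed.

Lemma step_cvg s : 0 <= s -> s <= 1 ->
  (fun n => step n s) @ \oo --> ((s < 2^-1)%R%:R : R).
Proof.
move=> s0 s1; case: (eqVneq s 2^-1) => [->|sh].
  rewrite ltxx /=; apply: cvg_near_cst; apply: nearW => n.
  by rewrite /step subrr expr0n subr0 expr1n subrr mulr0.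
have q0 : 0 < (s - 2^-1) ^+ 2 by rewrite exprn_even_gt0//= subr_eq0.
have q1 : (s - 2^-1) ^+ 2 <= 1 by rewrite expr2; nra.
have fac2 : (fun n => 1 - (1 - (s - 2^-1) ^+ 2) ^+ n) @ \oo --> (1 : R).
  rewrite -[X in _ --> X]subr0; apply: cvgB; first exact: cvg_cst.
  by apply: cvg_expr; rewrite ger0_norm ?subr_ge0// ltrBlDr ltrDl.
rewrite -[X in _ --> X]mulr1; apply: cvgM => //.
have [sl|sl] := ltP s 2^-1.
- apply: (@squeeze_cvgr _ _ _ R (fun n => 1 - (2 * s) ^+ n) (fun=> 1)).
  + apply: nearW => n; apply/andP; split.
      apply: le_trans (@bernoulli_le _ _ _ _); rewrite ?exprn_ge0 ?exprn_ile1//.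
      by rewrite exprMn natrX.
    by rewrite exprn_ile1// ?subr_ge0 ?exprn_ile1// gerBl exprn_ge0.
  + rewrite -[X in _ --> X]subr0; apply: cvgB; first exact: cvg_cst.
    by apply: cvg_expr; rewrite ger0_norm ?mulr_ge0//; lra.
  + exact: cvg_cst.
- have sg : 2^-1 < s by rewrite lt_neqAle eq_sym sh.
  apply: (@squeeze_cvgr _ _ _ R (fun=> 0) (fun n => (2 * s)^-1 ^+ n)).
  + apply: nearW => n; rewrite exprn_ge0 ?subr_ge0 ?exprn_ile1//=.
    rewrite exprVn -[X in _ <= X]mul1r ler_pdivlMr; last by rewrite exprn_gt0//; lra.
    have sn0 : 0 <= s ^+ n by rewrite exprn_ge0.
    have sn1 : s ^+ n <= 1 by rewrite exprn_ile1.
    (* Since [(1 - s^n) (1 + s^n) <= 1], the first power is at most the inverse of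
       [(1 + s^n)^(2^n)], and Bernoulli's inequality bounds the latter below by [(2 s)^n]. *)
    apply: (@le_trans _ _ ((1 - s ^+ n) ^+ (2 ^ n) * (1 + s ^+ n) ^+ (2 ^ n))).
      rewrite ler_wpM2l ?exprn_ge0 ?subr_ge0//.
      have : 1 + (2 ^ n)%:R * s ^+ n <= (1 + s ^+ n) ^+ (2 ^ n).
        elim: (2 ^ n)%N => [|m IH]; first by rewrite mul0r addr0 expr0.
        rewrite exprS -[m.+1]addn1 natrD.
        have m0 : 0 <= m%:R * (s ^+ n) ^+ 2 by rewrite mulr_ge0 ?sqr_ge0.
        have : 0 <= (1 + s ^+ n) * ((1 + s ^+ n) ^+ m - (1 + m%:R * s ^+ n)).
          by rewrite mulr_ge0 ?subr_ge0// addr_ge0.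
        nra.
      by apply: le_trans; rewrite exprMn natrX lerDr.
    rewrite -exprMn exprn_ile1//; last by nra.
    by rewrite mulr_ge0 ?subr_ge0// addr_ge0.
  + exact: cvg_cst.
  + apply: cvg_expr; rewrite ger0_norm ?invr_ge0 ?mulr_ge0// invf_lt1; lra.
Qed.

End StepPolynomials.

(** * L^2 closure of an algebra of bounded functions *)

Section L2Closure.
Import HBNNSimple.
Context {d} {S : measurableType d} {R : realType}.
Variables (m : {measure set S -> \bar R}) (D : set S).
Hypotheses (mD : measurable D) (fD : (m D < +oo)%E).
Implicit Types (f g p q : S -> R) (B : set S).

Variable A : (S -> R) -> Prop.
Hypotheses (A_cst : forall r : R, A (fun=> r))
  (A_add : forall p q, A p -> A q -> A (fun x => p x + q x))
  (A_mul : forall p q, A p -> A q -> A (fun x => p x * q x))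
  (A_measurable : forall p, A p -> measurable_fun D p)
  (A_bounded : forall p, A p -> exists M : R, forall x, D x -> `|p x| <= M).

Local Notation ip := (ip m D).
Local Notation sqi := (sqi m D).

Lemma A_sqi p : A p -> sqi p.
Proof.
move=> Ap; have [M hM] := A_bounded Ap.
by apply: (sqi_bounded mD fD) hM; exact: A_measurable.
Qed.

Definition approximable f : Prop := sqi f /\
  forall e : R, 0 < e -> exists2 p, A p & ip (fun x => f x - p x) (fun x => f x - p x) < e.

Lemma ip_le f g (K : R) : sqi f -> sqi g ->
  (forall x, D x -> `|f x| <= K * `|g x|) -> ip f f <= K ^+ 2 * ip g g.
Proof.
move=> sf sg h; have sK := sqiZ mD K sg.
have -> : K ^+ 2 * ip g g = ip (fun x => K * g x) (fun x => K * g x).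
  by rewrite ipZl// ipZr//; ring.
apply: le_Rintegral => //; [exact: sqi_mul|exact: sqi_mul|].
move=> x /h hx; rewrite -!expr2 -(real_normK (num_real (f x))) -[leRHS]real_normK ?num_real//.
apply: lerXn2r; rewrite ?nnegrE//; apply: (le_trans hx).
by rewrite normrM ler_wpM2r// ler_norm.
Qed.

Lemma ip_add_le f g : sqi f -> sqi g ->
  ip (fun x => f x + g x) (fun x => f x + g x) <= 2 * ip f f + 2 * ip g g.
Proof.
move=> sf sg; have := ip_ge0 m D (fun x => f x - g x).
have sD := sqiD mD sf sg; have sB := sqiB mD sf sg.
have -> : ip (fun x => f x - g x) (fun x => f x - g x) = ip f f - 2 * ip f g + ip g g.
  by rewrite ipBl// !ipBr// (ipC _ _ g f); ring.
have -> : ip (fun x => f x + g x) (fun x => f x + g x) = ip f f + 2 * ip f g + ip g g.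
  by rewrite ipDl// !ipDr// (ipC _ _ g f); ring.
lra.
Qed.

Lemma approximable_A p : A p -> approximable p.
Proof.
move=> Ap; split; first exact: A_sqi.
move=> e e0; exists p => //; rewrite (_ : ip _ _ = 0)//.
rewrite -[RHS](ip0l m mD (fun=> 0)).
by apply: eq_ip => x _; rewrite subrr.
Qed.

Lemma approximable_eq f g : (forall x, D x -> f x = g x) -> approximable f -> approximable g.
Proof.
move=> fg [sf hf]; split; first exact: (sqi_eq mD fg).
move=> e /hf[p Ap h]; exists p => //.
by rewrite -(@eq_ip _ _ _ m D (fun x => f x - p x) (fun x => f x - p x))// => x Dx; rewrite fg.
Qed.

Lemma approximable_limit f : sqi f ->
  (forall e : R, 0 < e -> exists2 g, approximable g &
     ip (fun x => f x - g x) (fun x => f x - g x) < e) -> approximable f.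
Proof.
move=> sf hf; split=> // e e0; have e4 : 0 < e / 4 by lra.
have [g [sg hg] fg] := hf _ e4; have [p Ap gp] := hg _ e4.
exists p => //; have sp := A_sqi Ap.
have := ip_add_le (sqiB mD sf sg) (sqiB mD sg sp).
rewrite (@eq_ip _ _ _ m D _ _ (fun x => f x - p x) (fun x => f x - p x)); [lra| |];
  by move=> x _; ring.
Qed.

Lemma approximable_add f g : approximable f -> approximable g ->
  approximable (fun x => f x + g x).
Proof.
move=> [sf hf] [sg hg]; split; first exact: sqiD.
move=> e e0; have e4 : 0 < e / 4 by lra.
have [p Ap fp] := hf _ e4; have [q Aq gq] := hg _ e4.
exists (fun x => p x + q x); first exact: A_add.
have := ip_add_le (sqiB mD sf (A_sqi Ap)) (sqiB mD sg (A_sqi Aq)).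
rewrite (@eq_ip _ _ _ m D _ _ (fun x => f x + g x - (p x + q x))
  (fun x => f x + g x - (p x + q x))); [lra| |]; by move=> x _; ring.
Qed.

Lemma sqr_norm_le (y K : R) : `|y| <= K -> y ^+ 2 <= K ^+ 2.
Proof.
move=> h; rewrite -(real_normK (num_real y)).
by apply: lerXn2r; rewrite ?nnegrE// (le_trans _ h).
Qed.

Lemma sqi_bounded_mul f g (K : R) : measurable_fun D f ->
  (forall x, D x -> `|f x| <= K) -> sqi g -> sqi (fun x => f x * g x).
Proof.
move=> mf fK [mg ig]; split; first exact: measurable_funM.
apply: (@le_integrable _ _ _ m D mD _ (fun x => (K ^+ 2)%:E * ((g x) ^+ 2)%:E)%E).
- by apply/measurable_EFinP; apply: measurable_funX; exact: measurable_funM.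
- move=> x Dx; rewrite -EFinM !abse_EFin lee_fin [leLHS]ger0_norm ?sqr_ge0//.
  rewrite (le_trans _ (ler_norm _))// exprMn ler_wpM2r ?sqr_ge0//.
  exact/sqr_norm_le/fK.
- exact: integrableZl.
Qed.

Lemma approximable_mulA f p : approximable f -> A p -> approximable (fun x => p x * f x).
Proof.
move=> [sf hf] Ap; have [M hM] := A_bounded Ap.
have spf g : sqi g -> sqi (fun x => p x * g x).
  by apply: sqi_bounded_mul hM; exact: A_measurable.
split; first exact: spf.
move=> e e0; pose K := `|M| + 1; have K0 : 0 < K by rewrite ltr_wpDl.
have [q Aq fq] := hf (e / K ^+ 2) (divr_gt0 e0 (exprn_gt0 2 K0)).
exists (fun x => p x * q x); first exact: A_mul.
have sfq := sqiB mD sf (A_sqi Aq).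
rewrite (@eq_ip _ _ _ m D _ _ (fun x => p x * (f x - q x)) (fun x => p x * (f x - q x)));
  [|by move=> x _; ring..].
apply: (@le_lt_trans _ _ (K ^+ 2 * ip (fun x => f x - q x) (fun x => f x - q x))).
  apply: ip_le => //; first exact: spf.
  move=> x Dx; rewrite normrM ler_wpM2r// (le_trans (hM x Dx))//.
  by rewrite (le_trans (ler_norm _))// lerDl.
by rewrite mulrC -ltr_pdivlMr// exprn_gt0.
Qed.

Lemma approximable_scale (r : R) f : approximable f -> approximable (fun x => r * f x).
Proof. by move=> hf; exact: (approximable_mulA hf (A_cst r)). Qed.

(** Approximation in two stages: [f] is replaced by some [p] in [A] at a cost controlled by the
    bound on [g], and [p * g] is approximable because [p] is bounded. *)
Lemma approximable_mul f g (M : R) : approximable f -> approximable g ->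
  (forall x, D x -> `|g x| <= M) -> approximable (fun x => f x * g x).
Proof.
move=> [sf hf] ag gM; have [sg _] := ag; pose K := `|M| + 1.
have K0 : 0 < K by rewrite ltr_wpDl.
have gK x : D x -> `|g x| <= K.
  by move=> Dx; rewrite (le_trans (gM x Dx))// (le_trans (ler_norm _))// lerDl.
have sfg h : sqi h -> sqi (fun x => h x * g x).
  move=> sh; under eq_fun do rewrite mulrC.
  by apply: sqi_bounded_mul gK sh; case: sg.
apply: approximable_limit; first exact: sfg.
move=> e e0; have [p Ap fp] := hf (e / K ^+ 2) (divr_gt0 e0 (exprn_gt0 2 K0)).
exists (fun x => p x * g x); first exact: approximable_mulA.
have sfp := sqiB mD sf (A_sqi Ap).
rewrite (@eq_ip _ _ _ m D _ _ (fun x => (f x - p x) * g x) (fun x => (f x - p x) * g x));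
  [|by move=> x _; ring..].
apply: (@le_lt_trans _ _ (K ^+ 2 * ip (fun x => f x - p x) (fun x => f x - p x))).
  apply: ip_le => //; first exact: sfg.
  by move=> x Dx; rewrite normrM mulrC ler_wpM2r// gK.
by rewrite mulrC -ltr_pdivlMr// exprn_gt0.
Qed.

Lemma approximable_dominated (F : nat -> S -> R) f g : (forall n, approximable (F n)) ->
  (forall x, D x -> (fun n => F n x) @ \oo --> f x) ->
  sqi g -> (forall n x, D x -> `|F n x| <= g x) -> approximable f.
Proof.
move=> aF Ff sg Fg.
have mf : measurable_fun D f.
  by apply: measurable_fun_cvg Ff => n; case: (aF n) => -[].
have fg x : D x -> `|f x| <= g x.
  move=> Dx; have cF : (fun n => `|F n x|) @ \oo --> `|f x|.
    exact: cvg_norm (Ff x Dx).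
  rewrite -(cvg_lim (@Rhausdorff R) cF).
  apply: limr_le; first by apply/cvg_ex; exists `|f x|.
  by apply: nearW => n; exact: Fg.
have sf : sqi f.
  split=> //; apply: (@le_integrable _ _ _ m D mD _ (fun x => ((g x) ^+ 2)%:E)).
  - by apply/measurable_EFinP; exact: measurable_funX.
  - move=> x Dx; rewrite !abse_EFin lee_fin !ger0_norm ?sqr_ge0//.
    exact/sqr_norm_le/fg.
  - by case: sg.
apply: approximable_limit => // e e0.
have L : (fun n => \int[m]_(x in D) ((f x - F n x) ^+ 2)) @ \oo --> \int[m]_(x in D) (0 : R).
  apply: (Rdominated mD (g := fun x => 4 * g x ^+ 2)).
  - move=> n; apply: measurable_funX; apply: measurable_funB => //.
    by case: (aF n) => -[].
  - exact: measurable_cst.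
  - move=> x Dx; rewrite -[X in _ --> X](expr0n R 2).
    have -> : (fun n => (f x - F n x) ^+ 2) = (fun n => (f x - F n x) * (f x - F n x)).
      by apply/funext => n; rewrite expr2.
    rewrite [X in _ --> X](_ : _ = (f x - f x) * (f x - f x)); last by rewrite subrr mulr0 expr0n.
    by apply: cvgM; apply: cvgB; (exact: cvg_cst || exact: Ff).
  - apply: (@eq_integrable _ _ _ m D mD (fun x => 4%:E * ((g x) ^+ 2)%:E)%E).
      by move=> x _; rewrite -EFinM.
    by apply: integrableZl => //; case: sg.
  - move=> n x Dx; rewrite ger0_norm ?sqr_ge0//.
    have -> : 4 * g x ^+ 2 = (2 * g x) ^+ 2 by ring.
    apply: sqr_norm_le; rewrite (le_trans (ler_normB _ _))//.
    by have := fg x Dx; have := Fg n x Dx; lra.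
rewrite Rintegral_cst// mul0r in L.
have /cvgrPdist_lt /(_ e e0) [n _ hn] := L.
exists (F n) => //; rewrite ip_sqr; have := hn n (leqnn n).
by rewrite sub0r normrN ger0_norm// Rintegral_ge0// => x _; rewrite sqr_ge0.
Qed.

Lemma approximable_sum (I : Type) (r : seq I) (F : I -> S -> R) :
  (forall l, approximable (F l)) -> approximable (fun x => \sum_(l <- r) F l x).
Proof.
move=> aF; elim: r => [|l r IH].
  by under eq_fun do rewrite big_nil; exact/approximable_A/A_cst.
by under eq_fun do rewrite big_cons; exact: approximable_add.
Qed.

Definition approximable_set B : Prop := approximable (\1_B : S -> R).

Lemma indic_bound B x : `|\1_B x : R| <= 1.
Proof. by rewrite indicE ger0_norm// lern1 leq_b1. Qed.

Lemma approximable_setI B B' : approximable_set B -> approximable_set B' ->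
  approximable_set (B `&` B').
Proof.
rewrite /approximable_set indicI => aB aB'.
by apply: (approximable_mul (M := 1)) => // x _; exact: indic_bound.
Qed.

Lemma approximable_setC B : approximable_set B -> approximable_set (~` B).
Proof.
move=> aB; apply: (@approximable_eq (fun x => 1 + (- 1) * \1_B x)).
  move=> x _; rewrite !indicE in_setC; case: (_ \in _) => /=; ring.
by apply: approximable_add; [exact/approximable_A/A_cst|exact: approximable_scale].
Qed.

(** Intersections come from products, complements from subtraction from 1, and countable unions from
    dominated convergence of the finite unions. *)
Lemma approximable_sigma_algebra : sigma_algebra setT approximable_set.
Proof.
have a0 : approximable_set set0.
  by rewrite /approximable_set indic0; apply: approximable_A; exact: (A_cst 0).
have aU B B' : approximable_set B -> approximable_set B' -> approximable_set (B `|` B').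
  move=> /approximable_setC h /approximable_setC h'.
  by rewrite -[B `|` B']setCK setCU; apply/approximable_setC/approximable_setI.
split=> //; first by move=> B; rewrite setTD; exact: approximable_setC.
move=> F aF; have aFn n : approximable_set (\big[setU/set0]_(i < n) F i).
  by elim/big_ind : _ => // i _; exact: aF.
have lim x : (fun n => (\1_(\big[setU/set0]_(i < n) F i) x : R)) @ \oo -->
     (\1_(\bigcup_i F i) x : R).
  have [[n _ Fx]|nFx] := pselect ((\bigcup_i F i) x).
    apply: cvg_near_cst; exists n.+1 => // k /= nk; rewrite !indicE !mem_set//.
      by exists n.
    by rewrite -bigcup_mkord; exists n.
  apply: cvg_near_cst; apply: nearW => k; rewrite !indicE !memNset//.
  by rewrite -bigcup_mkord => -[i _ Fi]; apply: nFx; exists i.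
apply: (@approximable_dominated (fun n => \1_(\big[setU/set0]_(i < n) F i)) _ (fun=> 1)) => //.
- exact/A_sqi/A_cst.
- by move=> n x _; exact: indic_bound.
Qed.

Lemma A_exp p (n : nat) : A p -> A (fun x => p x ^+ n).
Proof.
move=> Ap; elim: n => [|n IH].
  by under eq_fun do rewrite expr0; exact: A_cst.
by under eq_fun do rewrite exprS; exact: A_mul.
Qed.

Lemma approximable_lt p (r : R) : A p -> approximable_set [set x | p x < r].
Proof.
move=> Ap; have [M hM] := A_bounded Ap.
pose K := `|M| + `|r| + 1; have K0 : 0 < K by rewrite ltr_wpDl// addr_ge0.
(* Affine rescaling of [p] into [[0, 1]] that sends the threshold [r] to [1/2], where [step]
   jumps. *)
pose s x := 2^-1 + (2 * K)^-1 * (p x + - r).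
have As : A s.
  apply: A_add; first exact: A_cst.
  by apply: A_mul; [exact: A_cst|apply: A_add => //; exact: A_cst].
have s01 x : D x -> 0 <= s x <= 1.
  move=> /hM; rewrite ler_norml => /andP[h1 h2].
  have := ler_norm M; have := ler_norm r; have := ler_norm (- r); rewrite normrN => n1 n2 n3.
  have K2 : 0 < 2 * K by rewrite mulr_gt0.
  have e1 : s x * (2 * K) = K + (p x - r) by rewrite /s; field; rewrite gt_eqF.
  have k1 : p x - r <= K by rewrite /K; lra.
  have k2 : - K <= p x - r by rewrite /K; lra.
  by apply/andP; split; rewrite -(ler_pM2r K2) e1; lra.
have sr x : (s x < 2^-1) = (p x < r).
  by rewrite /s gtrDl pmulr_rlt0 ?invr_gt0 ?mulr_gt0// subr_lt0.
have An n : A (fun x => step n (s x)).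
  have A1N q : A q -> A (fun x => 1 - q x).
    move=> Aq; have := A_add (A_cst 1) (A_mul (A_cst (- 1)) Aq).
    by under eq_fun do rewrite mulN1r.
  apply: A_mul; first by apply/A_exp/A1N/A_exp.
  apply/A1N/A_exp/A1N/(@A_exp (fun x => s x - 2^-1)).
  exact: (A_add As (A_cst _)).
apply: (@approximable_dominated (fun n x => step n (s x)) _ (fun=> 1)).
- by move=> n; exact: approximable_A.
- move=> x Dx; have /andP[s0 s1] := s01 x Dx.
  have := step_cvg s0 s1; rewrite sr indicE.
  by have -> : (x \in [set y | p y < r]) = (p x < r) by apply/idP/idP; rewrite inE.
- exact/A_sqi/A_cst.
- by move=> n x Dx; have /andP[s0 s1] := s01 x Dx; exact: step_bound.
Qed.

Lemma approximable_all f :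
  (forall B, measurable B -> approximable_set B) -> sqi f -> approximable f.
Proof.
move=> aM; have pos g : (forall x, 0 <= g x) -> sqi g -> approximable g.
  move=> g0 sg; have mg : measurable_fun D (EFin \o g).
    by apply/measurable_EFinP; case: sg.
  have g0E x : D x -> (0 <= (EFin \o g) x)%E by move=> _; rewrite lee_fin.
  have cg x : D x -> (fun n => nnsfun_approx mD mg n x) @ \oo --> g x.
    by move=> Dx; have := cvg_nnsfun_approx mD mg g0E Dx => /fine_cvgP[].
  apply: (@approximable_dominated (fun n => nnsfun_approx mD mg n) _ g) => //.
  - move=> n; apply: (@approximable_eq (fun x =>
        \sum_(y <- finmap.enum_fset (fset_set (range (nnsfun_approx mD mg n))))
          y * \1_(nnsfun_approx mD mg n @^-1` [set y]) x)).
      by move=> x _; rewrite [RHS]fimfunE fsbig_finite.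
    by apply: approximable_sum => y; apply: approximable_scale; exact: aM.
  - move=> n x Dx; rewrite ger0_norm//.
    rewrite -(cvg_lim (@Rhausdorff R) (cg x Dx)).
    apply: (@nondecreasing_cvgn_le _ (fun n => nnsfun_approx mD mg n x)).
      by move=> i j ij; have /lefP := nd_nnsfun_approx mD mg ij; exact.
    by apply/cvg_ex; exists (g x); exact: cg.
move=> [mf if2]; have split_part g : measurable_fun D g -> (forall x, `|g x| <= `|f x|) -> sqi g.
  move=> mg gf; split=> //.
  apply: (@le_integrable _ _ _ m D mD _ (fun x => ((f x) ^+ 2)%:E)) => //.
    by apply/measurable_EFinP; exact: measurable_funX.
  move=> x Dx; rewrite !abse_EFin lee_fin !ger0_norm ?sqr_ge0//.
  by rewrite -(real_normK (num_real (f x))); exact: sqr_norm_le.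
apply: (@approximable_eq (fun x => Num.max (f x) 0 + (- 1) * Num.max (- f x) 0)).
  by move=> x _; case: (leP (f x) 0) => h; rewrite /Num.max /=; case: ltP => h2; lra.
apply: approximable_add; last apply: approximable_scale.
all: apply: pos => [x|]; first by rewrite le_max lexx orbT.
- apply: split_part; first exact: measurable_maxr.
  by move=> x; case: (leP (f x) 0) => h; rewrite ?normr0 ?normr_ge0.
- apply: split_part; first by apply: measurable_maxr => //; exact: measurableT_comp.
  move=> x; rewrite -[in leRHS]normrN.
  by case: (leP (- f x) 0) => h; rewrite ?normr0 ?normr_ge0.
Qed.

End L2Closure.

(** * Half-planes generate the measurable sets of the plane *)

Section PlaneSigmaAlgebra.
Context {R : realType}.
Notation plane := (measurableTypeR R * measurableTypeR R)%type.

Lemma sigma_algebra_setI (S : Type) (G : set (set S)) (B B' : set S) :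
  sigma_algebra setT G -> G B -> G B' -> G (B `&` B').
Proof.
move=> [G0 GC GU] GB GB'; have GC' A : G A -> G (~` A) by move=> /GC; rewrite setTD.
rewrite -[B `&` B']setCK setCI; apply: (GC'); rewrite -bigcup2E; apply: GU => n.
by rewrite /bigcup2; case: ifP => _; [exact: GC'|case: ifP => _; [exact: GC'|]].
Qed.

Lemma sigma_algebra_preim (S S' : Type) (phi : S -> S') (G : set (set S)) :
  sigma_algebra setT G -> sigma_algebra setT [set B | G (phi @^-1` B)].
Proof.
move=> [G0 GC GU]; split => /=.
- by rewrite preimage_set0.
- by move=> B /GC; rewrite !setTD preimage_setC.
- by move=> F GF; rewrite preimage_bigcup; exact: GU.
Qed.

Lemma measurable_line_ind (G : set (set R)) (A : set (measurableTypeR R)) :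
  sigma_algebra setT G -> (forall r, G [set y | r <= y]) -> measurable A -> G A.
Proof.
move=> sG Gr mA; have : (RGenCInfty.G (R := R)).-sigma.-measurable A.
  by rewrite -RGenCInfty.measurableE.
apply: smallest_sub => // _ [r ->]; have := Gr r; congr G.
by apply/seteqP; split => y /=; rewrite in_itv /= andbT.
Qed.

Lemma measurable_plane_ind (G : set (set (R * R))) (B : set plane) :
  sigma_algebra setT G -> (forall r, G [set x | r <= x.1]) ->
  (forall r, G [set x | r <= x.2]) -> measurable B -> G B.
Proof.
move=> sG G1 G2; rewrite measurable_prod_measurableType.
apply: smallest_sub => // _ [A1 mA1] [A2 mA2] <-.
have -> : A1 `*` A2 = (fst @^-1` A1) `&` (snd @^-1` A2) by [].
apply: (sigma_algebra_setI sG).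
- exact: (measurable_line_ind (sigma_algebra_preim fst sG)).
- exact: (measurable_line_ind (sigma_algebra_preim snd sG)).
Qed.

End PlaneSigmaAlgebra.

(** * Density of the trigonometric polynomials *)

Section Density.
Context {R : realType}.
Variables (a : R) (V : 'I_3 -> R * R).
Hypotheses (a_gt0 : 0 < a) (V_equilateral : equilateral V a).
Implicit Types (x y : R * R) (f p : R * R -> R).
Notation plane := (measurableTypeR R * measurableTypeR R)%type.
Notation T := (open_triangle V).

Let mT := triangle_measurable a_gt0 V_equilateral.
Let fT := triangle_finite a_gt0 V_equilateral.

Let trig_measurable p : trig V p -> measurable_fun (T : set plane) (p : plane -> R).
Proof. by move=> /trig_tame /(tame_sqi a_gt0 V_equilateral)[]. Qed.

Let trig_bounded p : trig V p -> exists M : R, forall x, T x -> `|p x| <= M.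
Proof.
move=> /trig_tame /tame_continuous cp.
have [M hM] := continuous_bounded_triangle a_gt0 V_equilateral cp.
by exists M => x /(sub_closed_triangle a_gt0 V_equilateral); exact: hM.
Qed.

Let aS : set (set plane) := approximable_set (@leb2 R) T (trig V).

Let sS : sigma_algebra setT aS := approximable_sigma_algebra mT fT (@trig_cst R V)
   (@trig_add R V) (@trig_mul R V) trig_measurable trig_bounded.

Let eig x : R * R := (eigX V x, eigY V x).

Lemma eig_continuous : continuous eig.
Proof.
move=> x; apply: (@cvg_pair _ _ _ (nbhs x) (nbhs (eigX V x)) (nbhs (eigY V x))
  _ _ _ (eigX V) (eigY V)); exact: (tame_continuous (orb_tame _ _ _)).
Qed.

Let aS_eig (B : set plane) : measurable B -> aS (eig @^-1` B).
Proof.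
apply: (measurable_plane_ind (sigma_algebra_preim eig sS)) => r /=.
- have -> : eig @^-1` [set x | r <= x.1] = setT `\` [set x | eigX V x < r].
    rewrite setTD; apply/seteqP; split => x /=; first by move=> h /=; apply/negP; rewrite -leNgt.
    by move/negP; rewrite -leNgt.
  case: sS => _ SC _; apply: SC.
  exact: (approximable_lt mT fT (@trig_cst R V) (@trig_add R V) (@trig_mul R V)
    trig_measurable trig_bounded _ (trig_orb _ _ _)).
- have -> : eig @^-1` [set x | r <= x.2] = setT `\` [set x | eigY V x < r].
    rewrite setTD; apply/seteqP; split => x /=; first by move=> h /=; apply/negP; rewrite -leNgt.
    by move/negP; rewrite -leNgt.
  case: sS => _ SC _; apply: SC.
  exact: (approximable_lt mT fT (@trig_cst R V) (@trig_add R V) (@trig_mul R V)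
    trig_measurable trig_bounded _ (trig_orb _ _ _)).
Qed.

Let aS_eq (B B' : set plane) : (forall x, T x -> B x <-> B' x) -> aS B -> aS B'.
Proof.
move=> BB; apply: (approximable_eq mT) => x Tx; rewrite !indicE; congr (_ %:R).
congr (nat_of_bool _); apply/idP/idP; rewrite !inE; exact: (BB x Tx).1 || exact: (BB x Tx).2.
Qed.

(** By injectivity, [K] agrees on the triangle with the preimage under [eig] of its own image, and
    this image is compact, hence measurable. *)
Let aS_compact (K : set (R * R)) : closed K -> K `<=` closed_triangle V -> aS K.
Proof.
move=> cK KT; have kK := closed_sub_compact a_gt0 V_equilateral cK KT.
have kE : compact (eig @` K).
  by apply: continuous_compact => //; apply: continuous_subspaceT; exact: eig_continuous.
have mE : measurable (eig @` K : set plane).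
  by apply: closed_measurable2; apply: compact_closed kE; exact: norm_hausdorff.
apply: aS_eq (aS_eig mE) => x Tx; split=> [[y Ky exy]|Kx]; last by exists x.
have [e1 e2] : eigX V y = eigX V x /\ eigY V y = eigY V x by case: exy.
have Tx' := sub_closed_triangle a_gt0 V_equilateral Tx.
by rewrite -(eig_injective a_gt0 V_equilateral (KT _ Ky) Tx' e1 e2).
Qed.

(** Closed half-planes may be cut down to the closed triangle, where [aS_compact] applies, and they
    generate all measurable sets. *)
Let aS_all (B : set plane) : measurable B -> aS B.
Proof.
have cT := @closed_triangle_closed R V.
have H (q : R * R -> R) r : continuous q -> aS [set x | r <= q x].
  move=> /continuous_closedP cq.
  apply: (aS_eq (B := closed_triangle V `&` (q @^-1` [set y | r <= y]))).
    move=> x Tx; split=> [[]//|h]; split=> //.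
    exact: (sub_closed_triangle a_gt0 V_equilateral Tx).
  apply: aS_compact; last by move=> x [].
  by apply: closedI => //; apply: cq; exact: closed_ge.
apply: (measurable_plane_ind sS) => r; apply: H => x; [exact: cvg_fst|exact: cvg_snd].
Qed.

Lemma trig_dense f (e : R) : sqi (@leb2 R) T f -> 0 < e ->
  exists2 p, trig V p &
    ip (@leb2 R) T (fun x => f x - p x) (fun x => f x - p x) < e.
Proof.
move=> sf e0; have [_] := approximable_all mT fT (@trig_cst R V) (@trig_add R V)
  (@trig_mul R V) trig_measurable trig_bounded aS_all sf.
exact.
Qed.

End Density.

(** * Poincare inequality and Neumann eigenfunctions *)

Section Poincare.
Context {R : realType}.
Variables (a : R) (V : 'I_3 -> R * R).
Hypotheses (a_gt0 : 0 < a) (V_equilateral : equilateral V a).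
Implicit Types (x y : R * R) (f p q u v l : R * R -> R) (g h : R * R -> R * R).
Notation T := (open_triangle V).
Notation ipT := (ip (@leb2 R) T).
Notation sqiT := (sqi (@leb2 R) T).
Notation dirT := (dir V).
Notation mu2 := (mu2 a).

Local Opaque derive.

Let mT := triangle_measurable a_gt0 V_equilateral.
Let tsqi := tame_sqi a_gt0 V_equilateral.

Lemma mu2_gt0 : 0 < mu2.
Proof. by rewrite /mu2 divr_gt0// ?mulr_gt0 ?exprn_gt0 ?pi_gt0. Qed.

Lemma H1_sqi u g : H1 T u g -> sqiT u.
Proof. by case. Qed.

Lemma dir_linl k u v w g h h' : H1 T u g -> H1 T v h -> H1 T w h' ->
  dirT (fun x => g x + k *: h x) h' = dirT g h' + k * dirT h h'.
Proof.
move=> [_ sg1 sg2 _] [_ sh1 sh2 _] [_ sh1' sh2' _]; rewrite /dir.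
have lin f f' q : sqiT f -> sqiT f' -> sqiT q ->
    ipT (fun x => f x + k * f' x) q = ipT f q + k * ipT f' q.
  by move=> sf sf' sq; rewrite ipDl ?ipZl//; exact: sqiZ.
rewrite mulrDr addrACA; congr (_ + _).
- exact: (lin (fun x => (g x).1) (fun x => (h x).1) (fun x => (h' x).1)).
- exact: (lin (fun x => (g x).2) (fun x => (h x).2) (fun x => (h' x).2)).
Qed.

Lemma ip_linl k f f' q : sqiT f -> sqiT f' -> sqiT q ->
  ipT (fun x => f x + k * f' x) q = ipT f q + k * ipT f' q.
Proof. by move=> sf sf' sq; rewrite ipDl ?ipZl//; exact: sqiZ. Qed.

Lemma dir_ge0 g : 0 <= dirT g g.
Proof. by rewrite addr_ge0// ip_ge0. Qed.

(* [p] satisfies [- Laplacian p = l] with zero normal derivative, weakly. *)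
Definition weak_neumann p l : Prop :=
  [/\ tame p, sqiT l & forall v h, H1 T v h -> dirT (gradient p) h = ipT l v].

Lemma tame_H1 p : tame p -> H1 T p (gradient p).
Proof. by move=> tp; apply: (smooth_H1 a_gt0 V_equilateral); exact: tame_smooth. Qed.

Lemma weak_neumann_level N p : level V N p ->
  weak_neumann p (fun x => mu2 * N%:R * p x).
Proof.
move=> lp; have tp := level_tame lp; split=> //; first by apply: sqiZ => //; exact: tsqi.
move=> v h H; rewrite -(dirE a_gt0 V_equilateral (tame_H1 tp) H).
rewrite (weak_green a_gt0 V_equilateral tp (level_neumann a_gt0 V_equilateral lp) H).
have E x : laplacian p x = (- (mu2 * N%:R)) * p x.
  exact: (level_laplacian a_gt0 V_equilateral).
transitivity (- ipT (fun x => (- (mu2 * N%:R)) * p x) v).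
  by congr (- _); apply: eq_ip => x _.
by rewrite !(ipZl mT) ?mulNr ?opprK//; [exact: tsqi|exact: H1_sqi H|exact: tsqi|exact: H1_sqi H].
Qed.

Lemma weak_neumann0 : weak_neumann (fun=> 0) (fun=> 0).
Proof.
split; [exact: tame_cst|exact: sqi_cst0|move=> v h H].
have E e x : 'D_e (fun=> 0 : R) x = 0 :> R by exact: derive_cst.
have Z k : ipT (fun=> 0) k = 0 by exact: ip0l.
rewrite Z -[RHS](addr0 0); congr (_ + _).
  by rewrite -[RHS](Z (fun x => (h x).1)); apply: eq_ip => x _ //; exact: E.
by rewrite -[RHS](Z (fun x => (h x).2)); apply: eq_ip => x _ //; exact: E.
Qed.

Lemma weak_neumann_level0 N p : level0 V N p ->
  weak_neumann p (fun x => mu2 * N%:R * p x).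
Proof.
case=> [->|]; last exact: weak_neumann_level.
by under [X in weak_neumann _ X]eq_fun do rewrite mulr0; exact: weak_neumann0.
Qed.

Lemma weak_neumann_lin k p q l l' : weak_neumann p l -> weak_neumann q l' ->
  weak_neumann (fun x => p x + k * q x) (fun x => l x + k * l' x).
Proof.
move=> [tp sl hp] [tq sl' hq]; split.
- by apply: tame_add => //; exact: tame_scale.
- by apply: sqiD => //; exact: sqiZ.
- move=> v h H; rewrite ip_linl//; last exact: H1_sqi H.
  rewrite -(hp _ _ H) -(hq _ _ H) -(dir_linl k (tame_H1 tp) (tame_H1 tq) H).
  have E x : gradient (fun x => p x + k * q x) x = gradient p x + k *: gradient q x.
    rewrite gradient_add ?gradient_scale//; exact: tame_scale.
  by congr (dir V _ _); exact/funext.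
Qed.

Lemma weak_neumann_sum (M : nat) (t : nat -> R) (P L : nat -> R * R -> R) :
  (forall N, weak_neumann (P N) (L N)) ->
  weak_neumann (fun x => \sum_(N < M) t N * P N x) (fun x => \sum_(N < M) t N * L N x).
Proof.
move=> hP; elim: M => [|M IH].
  under eq_fun do rewrite big_ord0; under [X in weak_neumann _ X]eq_fun do rewrite big_ord0.
  exact: weak_neumann0.
under eq_fun do rewrite big_ord_recr /=.
under [X in weak_neumann _ X]eq_fun do rewrite big_ord_recr /=.
exact: weak_neumann_lin.
Qed.

Lemma level0_tame N p : level0 V N p -> tame p.
Proof. by case=> [->|/level_tame//]; exact: tame_cst. Qed.

Lemma level_orth N N' p q : level0 V N p -> level0 V N' q -> N != N' -> ipT p q = 0.
Proof.
move=> lp lq NN; have [tp _ hp] := weak_neumann_level0 lp.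
have [tq _ hq] := weak_neumann_level0 lq.
have := hp _ _ (tame_H1 tq); rewrite dirC (hq _ _ (tame_H1 tp)).
rewrite !(ipZl mT); [|exact: tsqi..].
rewrite (ipC leb2 T q p) => /eqP; rewrite -subr_eq0 -mulrBl -mulrBr 2!mulf_eq0.
rewrite (gt_eqF mu2_gt0) subr_eq0 eqr_nat eq_sym (negbTE NN) /=.
by move/eqP.
Qed.

Lemma level0_const p : level0 V 0 p -> exists r : R, forall x, p x = r.
Proof. by case=> [->|/level_zero//]; exists 0. Qed.

Lemma ip_sum_orth (M : nat) (t : nat -> R) (P : nat -> R * R -> R) N :
  (forall N, level0 V N (P N)) -> (N < M)%N ->
  ipT (fun x => \sum_(K < M) t K * P K x) (P N) = t N * ipT (P N) (P N).
Proof.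
move=> lP NM; have sP K : sqiT (P K) by apply: tsqi; exact: level0_tame (lP K).
rewrite (@ip_suml _ _ _ _ _ mT _ _ (fun (K : 'I_M) x => t K * P K x)); last first.
- exact: sP.
- by move=> K; exact: sqiZ.
rewrite (bigD1 (Ordinal NM)) //= big1 ?addr0 ?ipZl// => K KN.
rewrite ipZl// (level_orth (lP K) (lP N)) ?mulr0//.
Qed.

(** In an approximation of [v] by a sum of level components, the coefficients 1 are replaced by the
    projection coefficients [t N]. The projection nearly exhausts the norm of [v] ([A1]), and its
    energy is at most that of [v] ([A2]); level 0 drops out by the zero mean, and the other levels
    have eigenvalue at least [mu2]. *)
Theorem poincare v h : H1 T v h -> ipT v (fun=> 1) = 0 ->
  mu2 * ipT v v <= dirT h h.
Proof.
move=> H v0; have sv := H1_sqi H; have mu0 := mu2_gt0.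
apply/ler_addgt0Pr => e e0.
have [p tp vp] := trig_dense a_gt0 V_equilateral sv (divr_gt0 e0 mu0).
have [M [P [lP [pP _]]]] := trig_decomp tp.
have sP K : sqiT (P K) by apply: tsqi; exact: level0_tame (lP K).
pose b N := ipT v (P N); pose s N := ipT (P N) (P N); pose t N := b N / s N.
have s0 N : 0 <= s N by exact: ip_ge0.
(* If a component has zero norm, division by 0 gives [t N = 0], and [b N = 0] as well by
   Cauchy-Schwarz. *)
have bs N : t N * s N = b N.
  rewrite /t; have [sN|sN] := eqVneq (s N) 0; last by rewrite divfK.
  rewrite sN mulr0; have := cauchy_schwarz mT sv (sP N).
  rewrite -/(b N) -/(s N) sN mulr0 => bN; apply/esym/eqP.
  by rewrite -sqrf_eq0 eq_le bN sqr_ge0.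
have sp : sqiT p by apply: tsqi; exact: trig_tame tp.
have pE : p = fun x => \sum_(N < M) 1 * P N x.
  by apply/funext => x; rewrite pP; apply: eq_bigr => N _; rewrite mul1r.
have sS (c : nat -> R) : sqiT (fun x => \sum_(N < M) c N * P N x).
  by apply: (@sqi_sum _ _ _ _ _ mT _ _ (fun (N : 'I_M) x => c N * P N x)) => N; exact: sqiZ.
have ipS (c : nat -> R) f : sqiT f ->
    ipT (fun x => \sum_(N < M) c N * P N x) f = \sum_(N < M) c N * ipT (P N) f.
  move=> sf; rewrite (@ip_suml _ _ _ _ _ mT _ _ (fun (N : 'I_M) x => c N * P N x))//.
    by apply: eq_bigr => N _; rewrite ipZl.
  by move=> N; exact: sqiZ.
have ipSS (c c' : nat -> R) : ipT (fun x => \sum_(N < M) c N * P N x) (fun x => \sum_(N < M) c' N * P N x)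
   = \sum_(N < M) c N * (c' N * s N).
  rewrite ipS//; apply: eq_bigr => N _; congr (_ * _).
  by rewrite ipC ip_sum_orth.
have A1 : ipT v v - \sum_(N < M) t N * b N < e / mu2.
  apply: le_lt_trans vp; rewrite ipBl ?ipBr//; last exact: sqiB.
  have -> : ipT p p = \sum_(N < M) s N.
    by rewrite pE (ipSS (fun=> 1) (fun=> 1)); apply: eq_bigr => N _; rewrite !mul1r.
  have E1 : ipT v p = \sum_(N < M) b N.
    rewrite pE ipC (ipS (fun=> 1))//; apply: eq_bigr => N _; rewrite mul1r; exact: ipC.
  rewrite (ipC leb2 T p v) E1.
  (* Each term equals [s N * (t N - 1)^2]: projection coefficients do at least as well as the
     coefficients 1 of [p]. *)
  suff : 0 <= \sum_(N < M) (t N * b N - 2 * b N + s N).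
    rewrite big_split sumrB /= -mulr_sumr; lra.
  apply: sumr_ge0 => N _.
  rewrite -(bs N); have -> : t N * (t N * s N) - 2 * (t N * s N) + s N = s N * (t N - 1) ^+ 2.
    by ring.
  by rewrite mulr_ge0 ?sqr_ge0.
(* Bessel's inequality for the energy: the gradient of the projection [q] has the same product with
   [h] as with itself ([d1], [d2]), and the energy of [h - grad q] is nonnegative. *)
have A2 : mu2 * (\sum_(N < M) t N * b N) <= dirT h h.
  have [tq sl hq] := weak_neumann_sum M t (fun N => weak_neumann_level0 (lP N)).
  set q := (fun x => \sum_(N < M) t N * P N x) in tq hq.
  have Hq := tame_H1 tq.
  have d1 : dirT (gradient q) h = \sum_(N < M) mu2 * N%:R * (t N * b N).
    rewrite (hq _ _ H).
    rewrite -(@eq_ip _ _ _ leb2 T (fun x => \sum_(N < M) (mu2 * N%:R * t N) * P N x) v)//.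
      rewrite (ipS (fun N => mu2 * N%:R * t N))//; apply: eq_bigr => N _; rewrite -mulrA.
      congr (_ * (_ * _)); exact: ipC.
    by move=> x _; apply: eq_bigr => N _; ring.
  have d2 : dirT (gradient q) (gradient q) = \sum_(N < M) mu2 * N%:R * (t N * b N).
    rewrite (hq _ _ Hq).
    rewrite -(@eq_ip _ _ _ leb2 T (fun x => \sum_(N < M) (mu2 * N%:R * t N) * P N x) q)//.
      by rewrite (ipSS (fun N => mu2 * N%:R * t N) t); apply: eq_bigr => N _; rewrite bs mulrA.
    by move=> x _; apply: eq_bigr => N _; ring.
  have Hhq := H1_lin a_gt0 V_equilateral (- 1) H Hq.
  have := dir_ge0 (fun x => h x + (- 1) *: gradient q x).
  have e1 := dir_linl (- 1) H Hq Hhq; have e2 := dir_linl (- 1) H Hq H.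
  have e3 := dir_linl (- 1) H Hq Hq; set hq' := (fun x => _) in e1 e2 e3 *.
  rewrite e1 (dirC V h hq') e2 (dirC V (gradient q) hq') e3 (dirC V h (gradient q)) d1 d2.
  move=> h0; have {}h0 : \sum_(N < M) mu2 * N%:R * (t N * b N) <= dirT h h by lra.
  apply: le_trans h0; rewrite mulr_sumr; apply: ler_sum => -[[|N] NM] _ /=.
    have [r rE] := level0_const (lP 0%N).
    suff -> : b 0%N = 0 by rewrite !mulr0.
    rewrite /b (@eq_ip _ _ _ leb2 T _ _ v (fun x => r * 1))//; last first.
      by move=> x _; rewrite rE mulr1.
    by rewrite ipZr ?v0 ?mulr0//; apply: tsqi; exact: tame_cst.
  have tb : 0 <= t N.+1 * b N.+1.
    by rewrite -(bs N.+1) mulrA mulr_ge0// -expr2 sqr_ge0.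
  by rewrite -mulrA ler_wpM2l ?(ltW mu0)// ler_peMl// ler1n.
have : mu2 * (ipT v v - \sum_(N < M) t N * b N) < e.
  by rewrite mulrC -ltr_pdivlMr.
rewrite mulrBr ltrBlDr => h1; apply: ltW; apply: (lt_le_trans h1).
by rewrite addrC lerD2r.
Qed.

(** Being orthogonal to an approximation [p], [u] satisfies [<u - p, u> = <u, u>], so Cauchy-Schwarz
    bounds its squared norm by that of [u - p]. *)
Lemma sqi_complete u : sqiT u ->
  (forall N p, level0 V N p -> ipT u p = 0) -> ipT u u = 0.
Proof.
move=> su uP; apply/eqP; rewrite eq_le ip_ge0 andbT; apply/ler_addgt0Pr => e e0.
rewrite add0r; have [p tp up] := trig_dense a_gt0 V_equilateral su e0.
have [M [P [lP [pP _]]]] := trig_decomp tp.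
have sP K : sqiT (P K) by apply: tsqi; exact: level0_tame (lP K).
have sp : sqiT p by apply: tsqi; exact: trig_tame tp.
have up0 : ipT p u = 0.
  rewrite (@eq_ip _ _ _ leb2 T p u (fun x => \sum_(N < M) P N x) u)//.
  rewrite (@ip_suml _ _ _ _ _ mT _ _ (fun (N : 'I_M) x => P N x))//.
  by rewrite big1// => N _; rewrite ipC (uP _ _ (lP N)).
have sup := sqiB mT su sp.
have E : ipT (fun x => u x - p x) u = ipT u u by rewrite ipBl// up0 subr0.
have := cauchy_schwarz mT sup su; rewrite E expr2 => cs.
case: (eqVneq (ipT u u) 0) => [->|u0]; first exact: ltW.
have up_ : 0 < ipT u u by rewrite lt_neqAle eq_sym u0 ip_ge0.
by rewrite ltW// (le_lt_trans _ up)// -(ler_pM2r up_).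
Qed.

Lemma neumann_test u (r : R) g N p : H1 T u g ->
  (forall v h, H1 T v h -> \int[leb2]_(x in T) dotp (g x) (h x) =
     r * \int[leb2]_(x in T) (u x * v x)) ->
  level0 V N p -> r != mu2 * N%:R -> ipT u p = 0.
Proof.
move=> Hu wu lp rN; have [tp _ hp] := weak_neumann_level0 lp.
have Hp := tame_H1 tp; have := wu _ _ Hp.
rewrite (dirE a_gt0 V_equilateral Hu Hp) dirC (hp _ _ Hu).
rewrite ipZl; [|exact: mT|exact: tsqi|exact: H1_sqi Hu].
rewrite (ipC leb2 T p u) => /eqP; rewrite -subr_eq0 -[\int[_]_(_ in _) _]/(ipT u p).
by rewrite -mulrBl mulf_eq0 subr_eq0 eq_sym (negbTE rN) => /eqP.
Qed.

(** All levels [N >= 1] have eigenvalue at least [mu2 > r], so [u] is orthogonal to them; once its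
    mean is removed, it is orthogonal to level 0 too. *)
Lemma neumann_low (r : R) u : r < mu2 -> neumann_eigenspace T r u ->
  exists c : R, ipT (fun x => u x - c) (fun x => u x - c) = 0.
Proof.
move=> rm [g [Hu wu]]; have su := H1_sqi Hu.
have s1 : sqiT (fun=> 1) by apply: tsqi; exact: tame_cst.
exists (ipT u (fun=> 1) / ipT (fun=> 1) (fun=> 1)); set c := _ / _.
have sc : sqiT (fun=> c) by apply: tsqi; exact: tame_cst.
apply: sqi_complete; first exact: sqiB.
move=> [|N] p lp; have sp : sqiT p by apply: tsqi; exact: level0_tame lp.
- have [k kE] := level0_const lp.
  rewrite (@eq_ip _ _ _ leb2 T _ p (fun x => u x - c * 1) (fun x => k * 1)); last 2 first.
  + by move=> x _; rewrite mulr1.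
  + by move=> x _; rewrite kE mulr1.
  have s1c := sqiZ mT c s1.
  rewrite ipZr//; last exact: sqiB.
  rewrite ipBl// ipZl// /c.
  have [i0|i0] := eqVneq (ipT (fun=> 1) (fun=> 1)) 0; last first.
    by rewrite divfK// subrr mulr0.
  have := cauchy_schwarz mT su s1; rewrite i0 !mulr0 => h.
  suff -> : ipT u (fun=> 1) = 0 by rewrite subr0 mulr0.
  by apply/eqP; rewrite -sqrf_eq0 eq_le h sqr_ge0.
- rewrite ipBl// (neumann_test Hu wu lp) ?sub0r; last first.
    rewrite lt_eqF// (lt_le_trans rm)// ler_peMr ?(ltW mu2_gt0)// ler1n //.
  rewrite (@eq_ip _ _ _ leb2 T _ p (fun x => c * 1) p)//; last by move=> x _; rewrite mulr1.
  rewrite ipZl// (_ : ipT (fun=> 1) p = 0) ?mulr0 ?oppr0//.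
  by apply: (level_orth _ lp (N := 0%N)) => //; right; exact: level_cst.
Qed.

Lemma neumann_mu2 u : neumann_eigenspace T mu2 u ->
  exists r t : R, let w x := u x - (r * eigX V x + t * eigY V x) in ipT w w = 0.
Proof.
move=> [g [Hu wu]]; have su := H1_sqi Hu.
have sX : sqiT (eigX V) by apply: tsqi; exact: orb_tame.
have sY : sqiT (eigY V) by apply: tsqi; exact: orb_tame.
have div0 f q : sqiT f -> sqiT q -> ipT f q / ipT q q * ipT q q = ipT f q.
  move=> sf sq; have [q0|q0] := eqVneq (ipT q q) 0; last by rewrite divfK.
  have := cauchy_schwarz mT sf sq; rewrite q0 !mulr0 => h.
  by apply/esym/eqP; rewrite -sqrf_eq0 eq_le h sqr_ge0.
(* Gram-Schmidt on [eigX] and [eigY]. By [div0] the projection formulas remain valid if a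
   denominator vanishes. *)
pose c := ipT (eigY V) (eigX V) / ipT (eigX V) (eigX V).
pose Y' x := eigY V x - c * eigX V x.
have sY' : sqiT Y' by apply: (sqiB mT sY); exact: sqiZ.
pose al := ipT u (eigX V) / ipT (eigX V) (eigX V); pose be := ipT u Y' / ipT Y' Y'.
have XY' : ipT Y' (eigX V) = 0.
  have scX := sqiZ mT c sX.
  by rewrite /Y' (ipBl mT sY scX sX) (ipZl mT c sX sX) /c div0// subrr.
exists (al - be * c), be => w.
have wE x : w x = u x - al * eigX V x - be * Y' x by rewrite /w /Y'; ring.
have saX := sqiZ mT al sX; have sbY := sqiZ mT be sY'.
have su1 := sqiB mT su saX; have su2 := sqiB mT su1 sbY.
have ipw q : sqiT q -> ipT w q = ipT u q - al * ipT (eigX V) q - be * ipT Y' q.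
  move=> sq; rewrite (@eq_ip _ _ _ leb2 T w q _ q (fun x _ => wE x))//.
  by rewrite ipBl// ipBl// ipZl// ipZl.
have sw : sqiT w by apply: (sqi_eq mT _ su2) => x _; rewrite wE.
have wX : ipT w (eigX V) = 0 by rewrite ipw// XY' mulr0 subr0 div0// subrr.
have wY' : ipT w Y' = 0.
  by rewrite ipw// (ipC leb2 T (eigX V) Y') XY' mulr0 subr0 div0// subrr.
have wY : ipT w (eigY V) = 0.
  rewrite (@eq_ip _ _ _ leb2 T w (eigY V) w (fun x => Y' x + c * eigX V x))//.
    by rewrite (ipDr mT sY' (sqiZ mT c sX) sw) (ipZr mT c sX sw) wX wY' mulr0 addr0.
  by move=> x _; rewrite /Y' subrK.
apply: sqi_complete => // N p lp; have sp : sqiT p by apply: tsqi; exact: level0_tame lp.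
have [N1|N1] := eqVneq N 1%N.
- subst N; have [r [t pE]] : exists r t : R, forall x, p x = r * eigX V x + t * eigY V x.
    case: lp => [->|lp1]; first by exists 0, 0 => x; rewrite !mul0r addr0.
    exact: level_one lp1.
  have srX := sqiZ mT r sX; have stY := sqiZ mT t sY.
  rewrite (@eq_ip _ _ _ leb2 T w p w _ (fun _ _ => erefl) (fun x _ => pE x)).
  by rewrite ipDr// ipZr// ipZr// wX wY !mulr0 addr0.
- have m1 : mu2 != mu2 * N%:R.
    rewrite -{1}[mu2]mulr1 (inj_eq (mulfI (negbT (gt_eqF mu2_gt0)))).
    by rewrite eq_sym pnatr_eq1.
  have oX : ipT (eigX V) p = 0.
    apply: (level_orth _ lp (N := 1%N)); last by rewrite eq_sym.
    by right; exact: eigX_level.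
  have oY : ipT (eigY V) p = 0.
    apply: (level_orth _ lp (N := 1%N)); last by rewrite eq_sym.
    by right; exact: eigY_level.
  rewrite ipw// (neumann_test Hu wu lp m1) oX mulr0 subr0 /Y'.
  by rewrite (ipBl mT sY (sqiZ mT c sX) sp) (ipZl mT c sX sp) oX oY !(mulr0, subr0).
Qed.

End Poincare.

(** * Affine change of variables in the plane *)

Section AffineChange.
Context {R : realType}.
Notation plane := (measurableTypeR R * measurableTypeR R)%type.
Notation leb := (@lebesgue_measure R).

Definition image_measure {d d'} {S : measurableType d} {S' : measurableType d'}
    (m : {measure set S -> \bar R}) (F : S -> S') (mF : measurable_fun setT F) :
    {measure set S' -> \bar R} :=
  measure_function_pushforward__canonical__measure_function_Measure m mF.

Lemma lebesgue_measure_affine (l n : R) (A : set (measurableTypeR R)) : l != 0 ->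
  measurable A -> leb ((fun y => l * y + n) @^-1` A) = (`|l|^-1%:E * leb A)%E.
Proof.
move=> l0 mA.
have mF : measurable_fun [set: measurableTypeR R]
    ((fun y => l * y + n) : measurableTypeR R -> measurableTypeR R).
  by apply: measurable_funD => //; exact: measurable_funM.
have k0 : 0 <= `|l| by [].
pose m' : {measure set (measurableTypeR R) -> \bar R} :=
  mscale (NngNum k0) (image_measure leb mF).
have H X : ocitv X -> leb X = m' X.
  move=> [[u v] _ <-]; rewrite lebesgue_measure_itv /=.
  have -> : m' `]u, v]%classic = (`|l|%:E * leb ((fun y => l * y + n)%R @^-1` `]u, v]%classic))%E by [].
  have [lp|ln] : 0 < l \/ l < 0 by case: (ltgtP l 0) l0 => //; [right|left].
  - rewrite (_ : _ @^-1` _ = `](u - n) / l, (v - n) / l]%classic); last first.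
      apply/seteqP; split => y /=; rewrite !in_itv /= ltr_pdivrMr// ler_pdivlMr// mulrC.
        by move=> /andP[h1 h2]; apply/andP; split; lra.
      by move=> /andP[h1 h2]; apply/andP; split; lra.
    rewrite lebesgue_measure_itv /= !lte_fin ltr_pM2r ?invr_gt0// ltrD2r gtr0_norm//.
    case: ifP => _; last by rewrite mule0.
    by rewrite -!EFinB -EFinM; congr (_%:E); field; rewrite gt_eqF.
  - rewrite (_ : _ @^-1` _ = `[(v - n) / l, (u - n) / l[%classic); last first.
      apply/seteqP; split => y /=; rewrite !in_itv /= ler_ndivrMr// ltr_ndivlMr// mulrC.
        by move=> /andP[h1 h2]; apply/andP; split; lra.
      by move=> /andP[h1 h2]; apply/andP; split; lra.
    rewrite lebesgue_measure_itv /= !lte_fin ltr_nM2r ?invr_lt0// ltrD2r ltr0_norm//.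
    case: ifP => _; last by rewrite mule0.
    by rewrite -!EFinB -EFinM; congr (_%:E); field; rewrite lt_eqF.
rewrite (lebesgue_measure_unique H mA).
have -> : m' A = (`|l|%:E * leb ((fun y => l * y + n)%R @^-1` A))%E by [].
rewrite muleA -EFinM.
by rewrite mulVf ?normr_eq0// mul1e.
Qed.

(** Stated on preimages, so [k] is the inverse of the Jacobian; in this form factors multiply under
    composition. *)
Definition scales (F : plane -> plane) (k : R) : Prop :=
  [/\ measurable_fun setT F, 0 < k &
      forall A, measurable A -> leb2 (F @^-1` A) = (k%:E * leb2 A)%E].

Lemma scales_comp F G k l : scales F k -> scales G l -> scales (F \o G) (k * l).
Proof.
move=> [mF k0 hF] [mG l0 hG]; split; [exact: measurableT_comp|exact: mulr_gt0|].
move=> A mA; rewrite comp_preimage hG ?hF ?muleA -?EFinM 1?mulrC//.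
by rewrite -[X in measurable X]setTI; exact: mF.
Qed.

Definition swap (x : plane) : plane := (x.2, x.1).

Lemma swap_scales : scales swap 1.
Proof.
have ms : measurable_fun setT swap.
  by apply: measurable_fun_pair; [exact: measurable_snd|exact: measurable_fst].
split=> // A mA; rewrite mul1e.
apply/esym; apply: (@product_measure_unique _ _ _ _ _ leb leb (image_measure (@leb2 R) ms)) => //.
move=> B C mB mC /=; rewrite /pushforward.
have -> : swap @^-1` (B `*` C) = C `*` B by apply/seteqP; split => x [].
by rewrite /leb2 /= product_measure1E// muleC.
Qed.

Lemma shear_scales (l m n : R) : l != 0 ->
  scales (fun x => (x.1, l * x.2 + m * x.1 + n)) `|l|^-1.
Proof.
move=> l0.
have mF : measurable_fun setT ((fun x => (x.1, l * x.2 + m * x.1 + n)) : plane -> plane).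
  apply: measurable_fun_pair; first exact: measurable_fst.
  apply: measurable_funD => //; apply: measurable_funD; apply: measurable_funM => //.
split=> //; first by rewrite invr_gt0 normr_gt0.
move=> A mA; rewrite /leb2 /= /product_measure1 -ge0_integralZl//=; last exact: measurable_fun_xsection.
apply: eq_integral => x _ /=.
rewrite -(lebesgue_measure_affine (m * x + n) l0); last exact: measurable_xsection.
by congr (leb _); apply/seteqP; split => y; rewrite /= !xsectionE /= addrA.
Qed.

(** Elimination with pivot [p]: a shear of the first coordinate, which is [shear_scales] conjugated
    by [swap], followed by a shear of the second. When [p = 0] the two variables are exchanged
    first. *)
Lemma affine_scales (p q r u c d : R) : p * u - q * r != 0 ->
  scales (fun x => (p * x.1 + q * x.2 + c, r * x.1 + u * x.2 + d)) `|p * u - q * r|^-1.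
Proof.
wlog p0 : p q r u / p != 0 => [H|] det0.
  have [p0|] := eqVneq p 0; last by move=> /H; exact.
  have q0 : q != 0 by apply: contra_neq det0 => ->; rewrite p0 !mul0r subrr.
  have det1 : q * r - p * u != 0 by rewrite -opprB oppr_eq0.
  have := scales_comp (H q p u r q0 det1) swap_scales.
  rewrite mulr1 distrC; congr (scales _ _).
  by apply/funext => x; rewrite /swap /=; congr (_, _); ring.
have l0 : (p * u - q * r) / p != 0 by rewrite mulf_neq0// invr_neq0.
have S1 := scales_comp swap_scales (scales_comp (shear_scales q c p0) swap_scales).
have := scales_comp (shear_scales (r / p) (d - r * c / p) l0) S1.
rewrite !mul1r !mulr1 -invfM -normrM divfK//; congr (scales _ _).
apply/funext => x; rewrite /swap /=; congr (_, _).
by field.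
Qed.

Lemma scales_integral (F : plane -> plane) k (D : set plane) (f : plane -> R) (M : R) :
  scales F k -> measurable D -> (leb2 D < +oo)%E -> measurable_fun D f ->
  (forall x, D x -> `|f x| <= M) ->
  \int[leb2]_(x in F @^-1` D) f (F x) = k * \int[leb2]_(x in D) f x.
Proof.
move=> [mF k0 hF] mD fD mf fM.
have mFD : measurable (F @^-1` D) by rewrite -[X in measurable X]setTI; exact: mF.
have fFD : (leb2 (F @^-1` D) < +oo)%E.
  by rewrite hF// lte_mul_pinfty// ?lee_fin ?ltW.
have pos (g : plane -> R) : measurable_fun D g -> (forall x, D x -> 0 <= g x) ->
    (\int[leb2]_(x in F @^-1` D) (g (F x))%:E = k%:E * \int[leb2]_(x in D) (g x)%:E)%E.
  move=> mg g0; have k1 := ltW k0.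
  rewrite -(@ge0_integral_mscale _ _ _ leb2 D mD (NngNum k1) (EFin \o g)); last 2 first.
  - exact/measurable_EFinP.
  - by move=> x Dx; rewrite lee_fin g0.
  rewrite -[LHS](@ge0_integral_pushforward _ _ _ _ _ F mF leb2 D (EFin \o g)) //; last 2 first.
  - exact/measurable_EFinP.
  - by move=> x /set_mem Dx; rewrite lee_fin g0.
  by apply: eq_measure_integral => A mA _; exact: (hF _ mA).
have bnd D' (g : plane -> R) (N : R) : measurable D' -> (leb2 D' < +oo)%E ->
    measurable_fun D' g -> (forall x, D' x -> `|g x| <= N) ->
    leb2.-integrable D' (EFin \o g).
  move=> mD' fD' mg gN; apply: (@le_integrable _ _ _ leb2 D' mD' _ (cst N%:E)).
  - exact/measurable_EFinP.
  - move=> x Dx /=; rewrite lee_fin (le_trans (gN x Dx))// ler_norm//.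
  - apply/integrableP; split; first exact: measurable_cst.
    by rewrite integral_cst//= lte_mul_pinfty// ?lee_fin.
(* Adding the bound [M] makes the integrand nonnegative; the added constants match because the
   preimage of [D] has [k] times the measure of [D]. *)
have mfM : measurable_fun D (fun x => f x + M) by exact: measurable_funD.
have f0 x : D x -> 0 <= f x + M.
  by move=> /fM; rewrite ler_norml => /andP[h _]; lra.
have P1 := pos _ mfM f0.
have mfF : measurable_fun (F @^-1` D) (fun x => f (F x)).
  apply: (measurable_comp mD _ mf); first by move=> _ [x Fx <-].
  exact: measurable_funS mF.
have if1 : leb2.-integrable D (EFin \o f) by apply: (bnd _ _ M).
have if2 : leb2.-integrable (F @^-1` D) (EFin \o (fun x => f (F x))).
  by apply: (bnd _ _ M) => // x Dx; exact: fM.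
have ic1 : leb2.-integrable D (EFin \o (fun=> M)).
  by apply: (bnd _ _ `|M|).
have ic2 : leb2.-integrable (F @^-1` D) (EFin \o (fun=> M)).
  by apply: (bnd _ _ `|M|).
have E : \int[leb2]_(x in F @^-1` D) (f (F x) + M) = k * \int[leb2]_(x in D) (f x + M).
  rewrite /Rintegral P1 fineM//.
  by apply: integrable_fin_num => //; apply: (bnd _ _ (`|M| + `|M|)) => // x Dx;
     rewrite (le_trans (ler_normD _ _))// lerD2r (le_trans (fM x Dx))// ler_norm.
move: E; rewrite RintegralD// RintegralD// !Rintegral_cst//.
have -> : fine (leb2 (F @^-1` D)) = k * fine (leb2 D).
  by rewrite hF// fineM// ge0_fin_numE.
lra.
Qed.

End AffineChange.

(** * Integrating a derivative along a side of the triangle *)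

Section Divergence.
Context {R : realType}.
Variables (a : R) (V : 'I_3 -> R * R).
Hypotheses (a_gt0 : 0 < a) (V_equilateral : equilateral V a).
Implicit Types (x y e P Q S : R * R) (f phi psi : R * R -> R) (i j k l : 'I_3).
Notation plane := (measurableTypeR R * measurableTypeR R)%type.
Notation leb := (@lebesgue_measure R).
Notation T := (open_triangle V).

Local Opaque derive.

Let mT := triangle_measurable a_gt0 V_equilateral.
Let fT := triangle_finite a_gt0 V_equilateral.

Definition segment P Q (t : R) : R * R := (1 - t) *: P + t *: Q.

Definition seg_int f P Q : R := \int[leb]_(t in `[0, 1]) f (segment P Q t).

Lemma segmentE P Q t : segment P Q t = P + t *: (Q - P).
Proof. by apply: injective_projections; rewrite /segment !coordE; ring. Qed.

Lemma segment_continuous P Q : continuous (segment P Q).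
Proof.
have -> : segment P Q = (fun t => P + t *: (Q - P)).
  by apply/funext => t; exact: segmentE.
exact: line_continuous.
Qed.

Lemma continuous_integrable01 (g : R -> R) : continuous g ->
  leb.-integrable `[0, 1] (EFin \o g).
Proof.
move=> cg; apply: continuous_compact_integrable; first exact: segment_compact.
exact: continuous_subspaceT.
Qed.

Lemma comp_segment_continuous f P Q : continuous f ->
  continuous (fun t => f (segment P Q t)).
Proof.
move=> cf t; apply: (@cvg_comp _ _ _ (segment P Q) f); first exact: segment_continuous.
exact: cf.
Qed.

Lemma seg_intC f P Q : continuous f -> seg_int f P Q = seg_int f Q P.
Proof.
move=> cf; rewrite /seg_int.
have r01 : 0 <= (1 : R) <= 1 by rewrite ler01 lexx.
have := @Rintegration_by_substitution_onem R (fun t => f (segment P Q t)) 1 r01.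
rewrite /unstable.onem subrr => ->.
  by apply: eq_Rintegral => t _; congr (f _); rewrite /segment addrC subKr.
exact/continuous_subspaceT/comp_segment_continuous.
Qed.

Let Jac : R := `|cross (V i0) (V i1) (V i2)|.

Lemma cross_any i j k : i != j -> j != k -> k != i ->
  `|cross (V i) (V j) (V k)| = Jac.
Proof.
have H (u v : R) : u = v \/ u = - v -> `|u| = `|v|.
  by case=> ->; rewrite ?normrN.
move: i j k; do 3 apply: I3P => //; move=> _ _ _; apply: H; rewrite /cross;
  ((left; ring) || (right; ring)).
Qed.

Lemma Jac_gt0 : 0 < Jac.
Proof. by rewrite normr_gt0; have := cross_V0 a_gt0 V_equilateral i0; rewrite !ordS012. Qed.

(** [F] maps [{0 < s < t < 1}] onto the triangle, with [s] running in the direction [e] of the side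
    [jk]. At fixed [t] the slice goes from the side [ik] ([s = 0]) to the side [ij] ([s = t]), so
    the inner integral is the difference of the end values, which [t] then integrates along both
    sides. *)
Lemma div_triangle f i j k : i != j -> j != k -> k != i ->
  (forall x, differentiable f x) -> continuous ('D_(V j - V k) f) ->
  \int[leb2]_(x in T) 'D_(V j - V k) f x =
    Jac * (seg_int f (V i) (V j) - seg_int f (V i) (V k)).
Proof.
move=> ij jk ki df cf; set e := V j - V k in cf *.
have cfc : continuous f by move=> x; exact: differentiable_continuous.
pose F (x : plane) : plane :=
  (e.1 * x.1 + (V k - V i).1 * x.2 + (V i).1, e.2 * x.1 + (V k - V i).2 * x.2 + (V i).2).
pose det := e.1 * (V k - V i).2 - (V k - V i).1 * e.2.
have detE : `|det| = Jac.
  rewrite -(cross_any ij jk ki); congr `|_|.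
  by rewrite /det /e /cross !coordE; ring.
have det0 : det != 0 by rewrite -normr_eq0 detE gt_eqF// Jac_gt0.
have sF : scales F `|det|^-1 by exact: affine_scales.
have FE x : F x = segment (V i) (V k) x.2 + x.1 *: e.
  by apply: injective_projections; rewrite /F /segment !coordE /= ?coordE; ring.
have TF x : T (F x) <-> 0 < x.1 /\ x.1 < x.2 /\ x.2 < 1.
  pose c l : R := if l == i then 1 - x.2 else if l == j then x.1 else x.2 - x.1.
  have cE : F x = \sum_(l < 3) c l *: V l.
    rewrite big_I3v /F /e /c; clear - ij jk ki; move: i j k ij jk ki.
    do 3 apply: I3P => //; move=> _ _ _; apply: injective_projections;
      rewrite !coordE /= ?coordE; ring.
  have c1 : \sum_(l < 3) c l = 1.
    rewrite big_I3 /c; clear - ij jk ki; move: i j k ij jk ki.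
    by do 3 apply: I3P => //; move=> _ _ _ /=; ring.
  rewrite cE (open_triangleE a_gt0 V_equilateral) /=; split=> [h|[h1 [h2 h3]] l].
    have := (h i, h j, h k); rewrite !(bary_of_comb a_gt0 V_equilateral)//.
    rewrite /c eqxx [j == i]eq_sym (negbTE ij) eqxx (negbTE ki) [k == j]eq_sym (negbTE jk).
    by case=> -[]; rewrite !subr_gt0.
  rewrite (bary_of_comb a_gt0 V_equilateral)// /c.
  by case: ifP => _; [|case: ifP => _ //]; rewrite subr_gt0.
have [B hB] := continuous_bounded_triangle a_gt0 V_equilateral cf.
have fB x : T x -> `|'D_e f x| <= B.
  by move=> /(sub_closed_triangle a_gt0 V_equilateral); exact: hB.
have mD : measurable_fun T ('D_e f : plane -> R).
  exact: measurable_funS (continuous_measurable2 cf).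
have E := scales_integral sF mT fT mD fB.
have J0 := Jac_gt0.
suff : \int[leb2]_(x in F @^-1` T) 'D_e f (F x) =
   seg_int f (V i) (V j) - seg_int f (V i) (V k).
  by rewrite E detE => <-; rewrite mulrA divff ?mul1r// gt_eqF.
have [mF _ hF] := sF.
have mFT : measurable (F @^-1` T) by rewrite -[X in measurable X]setTI; exact: mF.
have iFT : (@leb2 R).-integrable (F @^-1` T) (EFin \o (fun x => 'D_e f (F x))).
  have cDF : continuous (fun x : R * R => 'D_e f (F x)).
    have cF : continuous (fun x : R * R => segment (V i) (V k) x.2 + x.1 *: e).
      move=> x; apply: cvgD.
        apply: (@cvg_comp _ _ _ snd (segment (V i) (V k))); first exact: cvg_snd.
        exact: segment_continuous.
      apply: (@cvg_comp _ _ _ fst (fun s : R => s *: e)); first exact: cvg_fst.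
      exact: scalel_continuous.
    have -> : (fun x : R * R => 'D_e f (F x)) =
        (fun x => 'D_e f (segment (V i) (V k) x.2 + x.1 *: e)).
      by apply/funext => x; rewrite FE.
    by move=> x; apply: (@cvg_comp _ _ _ _ ('D_e f)); [exact: cF|exact: cf].
  apply: (@le_integrable _ _ _ leb2 _ mFT _ (cst B%:E)).
  - by apply/measurable_EFinP; exact: measurable_funS (continuous_measurable2 cDF).
  - by move=> x Fx /=; rewrite lee_fin (le_trans (fB _ Fx))// ler_norm.
  - apply/integrableP; split; first exact: measurable_cst.
    rewrite integral_cst//= hF// lte_mul_pinfty ?lee_fin// lte_mul_pinfty ?lee_fin//.
have {}iFT := (integrable_mkcond _ mFT).1 iFT.
rewrite /Rintegral integral_mkcond -integral21_prod_meas1//.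
pose G t := f (segment (V i) (V j) t) - f (segment (V i) (V k) t).
have inner t : fubini_G leb ((EFin \o (fun x => 'D_e f (F x))) \_ (F @^-1` T)) t =
   ((EFin \o G) \_ `]0, 1[) t.
  rewrite /fubini_G patchE; case: ifPn => [|/negP] t01; last first.
    rewrite (eq_integral (cst 0%E)) ?integral0// => s _; rewrite patchE ifF//.
    apply/negbTE/negP; rewrite inE => /(TF (s, t))[/= h1 [h2 h3]]; apply: t01.
    by rewrite inE /= in_itv /= h3 (lt_trans h1).
  move: t01; rewrite inE /= in_itv /= => /andP[t0 t1].
  have gE s : 'D_e f (F (s, t)) = 'D_e f (segment (V i) (V k) t + s *: e) by rewrite FE.
  pose g s := 'D_e f (segment (V i) (V k) t + s *: e).
  have cg : continuous g.
    move=> s; apply: (@cvg_comp _ _ _ (fun s : R => segment (V i) (V k) t + s *: e) ('D_e f)).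
      exact: line_continuous.
    exact: cf.
  have ig : leb.-integrable `[0, t] (EFin \o g).
    apply: continuous_compact_integrable; first exact: segment_compact.
    exact: continuous_subspaceT.
  transitivity (\int[leb]_s (((EFin \o g) \_ `]0%R, t[) s))%E.
    apply: eq_integral => s _; rewrite !patchE /= gE -/(g s); congr (if _ then _ else _).
    apply/idP/idP; rewrite !inE /= in_itv /=.
      by move=> /(TF (s, t))[/= -> [-> _]].
    by move=> /andP[h1 h2]; apply/(TF (s, t)); split.
  rewrite -integral_mkcond integral_itv_bndo_bndc; last first.
    by apply/measurable_EFinP; exact: measurable_funS (continuous_measurable_fun cg).
  rewrite integral_itv_obnd_cbnd; last first.
    by apply/measurable_EFinP; exact: measurable_funS (continuous_measurable_fun cg).
  have fin : (\int[leb]_(s in `[0%R, t]) (EFin \o g) s)%E \is a fin_num.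
    by apply: integrable_fin_num => //.
  rewrite -(fineK fin); congr (_%:E).
  have := FTC_line (segment (V i) (V k) t) t0 df cf; rewrite /Rintegral => ->.
  rewrite /G scale0r addr0; congr (f _ - _).
  by apply: injective_projections; rewrite /segment /e !coordE; ring.
rewrite (eq_integral _ _ (fun t _ => inner t)) -integral_mkcond.
have cG1 := @comp_segment_continuous _ (V i) (V j) cfc.
have cG2 := @comp_segment_continuous _ (V i) (V k) cfc.
have iG : leb.-integrable `[0, 1] (EFin \o G).
  by apply: continuous_integrable01 => t; apply: cvgB; [exact: cG1|exact: cG2].
have mG A : measurable A -> measurable_fun A (EFin \o G).
  move=> mA; apply/measurable_EFinP; apply: measurable_funB; apply: measurable_funS;
    by [exact: measurableT|exact: continuous_measurable_fun|].
rewrite integral_itv_bndo_bndc; last exact: mG.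
rewrite integral_itv_obnd_cbnd; last exact: mG.
rewrite -[LHS]/(\int[leb]_(t in `[0, 1]) G t) RintegralB//; exact: continuous_integrable01.
Qed.

End Divergence.

(** * The competitor and its Green formula *)

Section Competitor.
Context {R : realType}.
Variables (a : R) (V : 'I_3 -> R * R).
Hypotheses (a_gt0 : 0 < a) (V_equilateral : equilateral V a).
Implicit Types (x y e P Q S : R * R) (f phi psi : R * R -> R) (i j k l : 'I_3).
Notation T := (open_triangle V).
Notation ipT := (ip (@leb2 R) T).
Notation sqiT := (sqi (@leb2 R) T).
Notation dirT := (dir V).
Notation mu2 := (mu2 a).

Local Opaque derive.

Let mT := triangle_measurable a_gt0 V_equilateral.

Lemma seg_intD f g P Q : continuous f -> continuous g ->
  seg_int (fun x => f x + g x) P Q = seg_int f P Q + seg_int g P Q.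
Proof.
move=> cf cg; rewrite /seg_int -RintegralD//.
all: exact: (continuous_integrable01 (comp_segment_continuous _)).
Qed.

Lemma seg_intZ (k : R) f P Q : continuous f ->
  seg_int (fun x => k * f x) P Q = k * seg_int f P Q.
Proof.
move=> cf; rewrite /seg_int -RintegralZl//.
exact: (continuous_integrable01 (comp_segment_continuous _)).
Qed.

Lemma eq_seg_int f g P Q : (forall t, f (segment P Q t) = g (segment P Q t)) ->
  seg_int f P Q = seg_int g P Q.
Proof. by move=> fg; apply: eq_Rintegral => t _. Qed.

Lemma boundary_seg f : boundary_int V f = a * (seg_int f (V i0) (V i1) +
  seg_int f (V i1) (V i2) + seg_int f (V i2) (V i0)).
Proof.
rewrite /boundary_int (eq_bigr (fun i => a * seg_int f (V i) (V (ordS i)))).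
  by rewrite big_I3 !ordS012 -!mulrDr.
by move=> i _; rewrite /side_length V_equilateral//; move: i; apply: I3P; rewrite ordS012.
Qed.

(** The frequency at which a wave in one barycentric coordinate has eigenvalue [mu2], the gradient
    of that coordinate having squared length [4 / (3 a^2)]; see [z0_sqr]. *)
Definition z0 : R := pi / Num.sqrt 3.

Definition wfreq i : R * R := (2 * z0) *: normal V i.
Definition wphase i : R := 2 * z0 * (offset V i - 2^-1).
Definition comp i : R * R -> R := wave (wfreq i) (wphase i).
(** Derivative of [comp i] with respect to the coordinate [bary V i]: the gradient of [comp i] is
    [flux i] times [normal V i]. Writing it as a shifted wave keeps it [tame]. *)
Definition flux i x : R := 2 * z0 * wave (wfreq i) (wphase i + pi / 2) x.

(* In barycentric coordinates [c], [competitor] is the sum over [i] of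
   [cos (2 * z0 * (c i - 1/2))]: it solves [- Laplacian w = mu2 * w] and has a
   nonzero constant normal derivative. *)
Definition competitor x : R := \sum_(i < 3) comp i x.

Lemma warg i x : dotp (wfreq i) x + wphase i = 2 * z0 * (bary V i x - 2^-1).
Proof. by rewrite /wfreq /wphase /bary /dotp !coordE; ring. Qed.

Lemma compE i x : comp i x = cos (2 * z0 * (bary V i x - 2^-1)).
Proof. by rewrite /comp /wave warg. Qed.

Lemma fluxE i x : flux i x = - (2 * z0 * sin (2 * z0 * (bary V i x - 2^-1))).
Proof. by rewrite /flux /wave addrA warg cosDpihalf mulrN. Qed.

Lemma comp_tame i : tame (comp i). Proof. exact: tame_wave. Qed.
Lemma flux_tame i : tame (flux i). Proof. exact/tame_scale/tame_wave. Qed.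
Lemma competitor_tame : tame competitor.
Proof. by apply: tame_sum => i; exact: comp_tame. Qed.

Lemma comp_derive i e x : 'D_e (comp i) x = dotp (normal V i) e * flux i x.
Proof.
by rewrite /comp wave_derive warg fluxE /wfreq /dotp !coordE; ring.
Qed.

Lemma flux_derive i e x :
  'D_e (flux i) x = - (4 * z0 ^+ 2 * dotp (normal V i) e * comp i x).
Proof.
rewrite derive_scalefun; last exact: tame_wave.
rewrite wave_derive addrA warg sinDpihalf compE /wfreq /dotp !coordE; ring.
Qed.

Lemma z0_sqr : 4 * z0 ^+ 2 * (4 / (3 * a ^+ 2)) = mu2.
Proof.
have a0 : a != 0 by rewrite gt_eqF.
have s3 : Num.sqrt 3 ^+ 2 = 3 :> R by rewrite sqr_sqrtr.
by rewrite /z0 -[RHS]/(16 * pi ^+ 2 / (9 * a ^+ 2)) expr_div_n s3; field.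
Qed.

Lemma z0_gt0 : 0 < z0.
Proof. by rewrite divr_gt0 ?pi_gt0// sqrtr_gt0. Qed.

Lemma bary_segment i P Q t :
  bary V i (segment P Q t) = (1 - t) * bary V i P + t * bary V i Q.
Proof. by rewrite /bary /segment /dotp !coordE; ring. Qed.

Lemma bary_vertex i j : bary V i (V j) = if i == j then 1 else 0.
Proof.
have -> : V j = \sum_(k < 3) (if k == j then 1 else 0) *: V k.
  rewrite (bigD1 j)//= eqxx scale1r big1 ?addr0// => k /negbTE ->.
  by rewrite scale0r.
apply: (bary_of_comb a_gt0 V_equilateral (c := fun k => if k == j then 1 else 0) i).
by rewrite (bigD1 j)//= eqxx big1 ?addr0// => k /negbTE ->.
Qed.

Lemma flux_side i j k t : i != j -> i != k ->
  flux i (segment (V j) (V k) t) = 2 * z0 * sin z0.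
Proof.
move=> ij ik; rewrite fluxE bary_segment !bary_vertex (negbTE ij) (negbTE ik).
have -> : 2 * z0 * ((1 - t) * 0 + t * 0 - 2^-1) = - z0 by field.
by rewrite sinN mulrN opprK.
Qed.

Lemma flux_opp j k t : j != k ->
  flux j (segment (V j) (V k) t) + flux k (segment (V j) (V k) t) = 0.
Proof.
move=> jk; rewrite !fluxE !bary_segment !bary_vertex !eqxx (negbTE jk) [k == j]eq_sym (negbTE jk).
have -> : 2 * z0 * ((1 - t) * 1 + t * 0 - 2^-1) = - (2 * z0 * ((1 - t) * 0 + t * 1 - 2^-1)).
  by field.
by rewrite sinN mulrN opprK subrr.
Qed.

(** Minus the outer normal derivative of [competitor] on the sides, [4 z0 sin z0 / (sqrt 3 * a)],
    left in the form in which [div_triangle] delivers it. This is the constant [s] of the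
    overview. *)
Definition flux_const : R :=
  4 * (2 / (3 * a ^+ 2)) * `|cross (V i0) (V i1) (V i2)| * z0 * sin z0 / a.

(** The derivative of [flux i] along [normal V i] is [- mu2 * comp i], so the left-hand side is the
    integral of the sum of the derivatives of [flux i * phi] along [normal V i]. By [normalE] each
    of these is a sum of derivatives along two sides, which [div_triangle] turns into side
    integrals. *)
Lemma competitor_green phi : smooth phi ->
  dirT (gradient competitor) (gradient phi) - mu2 * ipT competitor phi =
  - flux_const * boundary_int V phi.
Proof.
move=> sp.
have dp := smooth_differentiable sp.
have cp := smooth_continuous sp.
have cDp e := smooth_continuous (smooth_derive e sp).
pose F i x := flux i x * phi x.
have dfl i := smooth_differentiable (tame_smooth (flux_tame i)).
have cfl i := tame_continuous (flux_tame i).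
have cDfl i e := tame_continuous (proj2 (tame_derive (flux_tame i)) e).
have dF i x : differentiable (F i) x by exact: differentiableM.
have DF i e x : 'D_e (F i) x = flux i x * 'D_e phi x + phi x * 'D_e (flux i) x.
  by rewrite /F deriveM//; exact: diff_derivable.
have cM f g : continuous f -> continuous g -> continuous (fun x => f x * g x).
  by move=> cf cg x; apply: continuousM; [exact: cf|exact: cg].
have cDF i e : continuous ('D_e (F i)).
  have -> : 'D_e (F i) = fun x => flux i x * 'D_e phi x + phi x * 'D_e (flux i) x.
    by apply/funext => x; exact: DF.
  move=> x; apply: cvgD; first exact: (cM _ _ (cfl i) (cDp e) x).
  exact: (cM _ _ cp (cDfl i e) x).
have csq f : continuous f -> sqiT f := @continuous_sqi _ _ _ a_gt0 V_equilateral f.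
have s1 : sqiT (fun=> 1) by apply: csq => x; exact: cst_continuous.
pose N f := ipT f (fun=> 1).
have NE f : N f = \int[leb2]_(x in T) f x.
  by apply: eq_Rintegral => x _; rewrite mulr1.
pose K : R := 2 / (3 * a ^+ 2); pose J := `|cross (V i0) (V i1) (V i2)|.
pose A : R := 2 * z0 * sin z0.
have N_normal i j k : i != j -> j != k -> k != i ->
    normal V i = K *: (2 *: V i - V j - V k) ->
    N ('D_(normal V i) (F i)) = K * J * (seg_int (F i) (V i) (V j) +
      seg_int (F i) (V i) (V k) - 2 * A * seg_int phi (V j) (V k)).
  move=> ij jk ki nE; have cF x : {for x, continuous (F i)} by exact: differentiable_continuous.
  have -> : N ('D_(normal V i) (F i)) =
     K * (N ('D_(V i - V j) (F i)) + N ('D_(V i - V k) (F i))).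
    rewrite /N -(ipDl mT); try by [exact: csq|].
    rewrite -(ipZl mT); [|apply: csq|exact: s1].
      apply: eq_ip => x _ //; rewrite nE !(derive_coord _ (dF i x)) !coordE.
      by move: (d1 (F i) x) (d2 (F i) x) => u v; ring.
    by move=> x; apply: cvgD; exact: cDF.
  have ji : j != i by rewrite eq_sym.
  have ik : i != k by rewrite eq_sym.
  have kj : k != j by rewrite eq_sym.
  rewrite !NE (div_triangle a_gt0 V_equilateral ki ij jk (dF i) (cDF i _)).
  rewrite (div_triangle a_gt0 V_equilateral ji ik kj (dF i) (cDF i _)).
  have cFi : continuous (F i) := cF.
  rewrite (seg_intC (V k) (V i) cFi) (seg_intC (V j) (V i) cFi) (seg_intC (V k) (V j) cFi).
  have -> : seg_int (F i) (V j) (V k) = A * seg_int phi (V j) (V k).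
    rewrite -seg_intZ//; apply: eq_seg_int => t.
    by rewrite /F flux_side.
  by rewrite -/J; ring.
have EQ : dirT (gradient competitor) (gradient phi) - mu2 * ipT competitor phi =
   \sum_(i < 3) N ('D_(normal V i) (F i)).
  rewrite /dir /N -(ip_suml mT) //; last by move=> i; exact: csq.
  have cw := tame_continuous competitor_tame.
  have cDw e := tame_continuous (proj2 (tame_derive competitor_tame) e).
  have ip1 f g : ipT f g = ipT (fun x => f x * g x) (fun=> 1).
    by apply: eq_Rintegral => x _; rewrite mulr1.
  have s12 := csq _ (cM _ _ (cDw (1, 0)) (cDp (1, 0))).
  have s34 := csq _ (cM _ _ (cDw (0, 1)) (cDp (0, 1))).
  have s56 := csq _ (cM _ _ cw cp).
  rewrite (ip1 competitor) (ip1 (fun x => (gradient competitor x).1)).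
  rewrite (ip1 (fun x => (gradient competitor x).2)) /=.
  rewrite -(ipDl mT s12 s34 s1) -(ipZl mT _ s56 s1).
  rewrite -(ipBl mT (sqiD mT s12 s34) (sqiZ mT _ s56) s1).
  apply: eq_ip => x _ //.
  have Dw e : 'D_e competitor x = \sum_(i < 3) dotp (normal V i) e * flux i x.
    rewrite derive_sumfun; last exact: comp_tame.
    by apply: eq_bigr => i _; exact: comp_derive.
  rewrite /d1 /d2 !Dw mulr_suml mulr_suml -big_split /= /competitor.
  rewrite mulr_suml mulr_sumr -sumrB; apply: eq_bigr => i _.
  rewrite DF flux_derive (derive_coord (normal V i) (dp x)) (normal_dot a_gt0 V_equilateral) eqxx -z0_sqr.
  rewrite /d1 /d2 /dotp /=.
  by move: ('D_(1, 0) phi x) ('D_(0, 1) phi x) (4 / _) => u v q; ring.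
rewrite EQ boundary_seg.
have nE := normalE a_gt0 V_equilateral.
have n0 := nE i0; have n1 := nE i1; have n2 := nE i2; rewrite !ordS012 in n0 n1 n2.
rewrite big_I3 (N_normal i0 i1 i2 isT isT isT n0) (N_normal i1 i2 i0 isT isT isT n1).
rewrite (N_normal i2 i0 i1 isT isT isT n2).
have cF i : continuous (F i) by move=> x; exact: differentiable_continuous.
rewrite (seg_intC (V i1) (V i0) (cF i1)) (seg_intC (V i2) (V i1) (cF i2)).
rewrite (seg_intC (V i0) (V i2) (cF i0)).
(* On the side [ij] the two coordinates sum to 1, and [comp] is even about 1/2, so its derivatives
   there are opposite. Only the constant flux of the third coordinate survives. *)
have opp i j : i != j -> seg_int (F i) (V i) (V j) = - seg_int (F j) (V i) (V j).
  move=> ij; apply/eqP; rewrite -addr_eq0 -seg_intD//; apply/eqP.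
  rewrite (@eq_seg_int _ (fun x => 0 * phi x)) ?seg_intZ ?mul0r// => t.
  by rewrite /F -mulrDl flux_opp.
rewrite (opp i0 i1)// (opp i1 i2)// (opp i2 i0)// /flux_const -/J -/K /A.
have a0 : a != 0 by rewrite gt_eqF.
by field.
Qed.

End Competitor.

(** * Signs of the constants attached to the competitor *)

Section CompetitorSign.
Context {R : realType}.
Variables (a : R) (V : 'I_3 -> R * R).
Hypotheses (a_gt0 : 0 < a) (V_equilateral : equilateral V a).
Implicit Types (x y e P Q S : R * R) (f phi psi : R * R -> R) (i j k l : 'I_3).
Notation leb := (@lebesgue_measure R).
Notation mu2 := (mu2 a).
Notation z0 := (@z0 R).

Local Opaque derive.

Lemma seg_int_cst (c : R) P Q : seg_int (fun=> c) P Q = c.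
Proof.
rewrite /seg_int /Rintegral integral_cst//= lebesgue_measure_itv /= lte_fin ltr01.
by rewrite oppr0 adde0 mule1.
Qed.

Lemma z0_bounds : [/\ pi / 2 < z0, z0 < pi & 2 * (pi - z0) > z0].
Proof.
have s0 : 0 < Num.sqrt 3 :> R by rewrite sqrtr_gt0.
have s3 : Num.sqrt 3 ^+ 2 = 3 :> R by rewrite sqr_sqrtr.
have p0 := pi_gt0 R; have zE : z0 * Num.sqrt 3 = pi.
  by rewrite /z0 divfK// gt_eqF.
have z0p := @z0_gt0 R.
have h1 : 1 < Num.sqrt 3 :> R by nra.
have h2 : Num.sqrt 3 < 2 :> R by nra.
have h3 : 3 / 2 < Num.sqrt 3 :> R by nra.
by split; nra.
Qed.

Lemma sin_z0_gt0 : 0 < sin z0.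
Proof. by have [_ h _] := z0_bounds; rewrite sin_gt0_pi// z0_gt0. Qed.

Lemma flux_const_gt0 : 0 < flux_const a V.
Proof.
have s := sin_z0_gt0; have z := @z0_gt0 R; have J := Jac_gt0 a_gt0 V_equilateral.
rewrite /flux_const; apply: divr_gt0 => //; do 4 apply: mulr_gt0 => //.
by rewrite divr_gt0// mulr_gt0// exprn_gt0.
Qed.

(** Here [cos z0 < 0]. With [y = pi - z0] in []0, pi/2[] the claim is [z0 * cos y < 2 * sin y]; the
    mean value theorem gives [sin y > y * cos y], and [2 y > z0] because [sqrt 3 > 3/2]. *)
Lemma z0_sign : 0 < cos z0 + 2 * (sin z0 / z0).
Proof.
have [h1 h2 h3] := z0_bounds; have z := @z0_gt0 R.
set y := pi - z0 in h3; have y0 : 0 < y by rewrite /y subr_gt0.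
have yE : z0 = pi - y by rewrite /y opprB addrC subrK.
have sE : sin z0 = sin y by rewrite yE sinB sinpi cospi; ring.
have cE : cos z0 = - cos y by rewrite yE cosB sinpi cospi; ring.
have ypi : y < pi / 2 by move: h1; rewrite yE; lra.
have cy : 0 < cos y by rewrite cos_gt0_pihalf// ypi andbT; lra.
have [c c01 ceq] : exists2 c, c \in `]0, y[ & sin y - sin 0 = cos c * (y - 0).
  apply: MVT => //; apply: continuous_subspaceT => t; exact: continuous_sin.
move: ceq c01; rewrite sin0 !subr0 in_itv /= => syE /andP[c0 cy'].
have : cos y < cos c by rewrite ltr_cos// in_itv /= ?andbT; apply/andP; split; lra.
rewrite sE cE syE => cc; rewrite mulrA addrC subr_gt0 ltr_pdivlMr//; nra.
Qed.

Lemma comp_side i j k : i != j -> i != k -> seg_int (comp V i) (V j) (V k) = cos z0.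
Proof.
move=> ij ik; rewrite (@eq_seg_int _ _ (fun=> cos z0)) ?seg_int_cst// => t.
rewrite compE bary_segment !(bary_vertex a_gt0 V_equilateral) (negbTE ij) (negbTE ik).
have -> : 2 * z0 * ((1 - t) * 0 + t * 0 - 2^-1) = - z0 by field.
by rewrite cosN.
Qed.

(** Along the side from [V j] the coordinate [bary V j] decreases at unit speed, so [flux V j] is a
    primitive of [4 z0^2 * comp V j]. *)
Lemma comp_vertex j k : j != k ->
  seg_int (comp V j) (V j) (V k) = sin z0 / z0.
Proof.
move=> jk; have z := @z0_gt0 R; have zn : z0 != 0 by rewrite gt_eqF.
have tf := flux_tame V j; set e := V k - V j.
have de : dotp (normal V j) e = - 1.
  have -> : dotp (normal V j) e = bary V j (V k) - bary V j (V j).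
    by rewrite /bary /e /dotp !coordE; ring.
  by rewrite !(bary_vertex a_gt0 V_equilateral) eqxx (negbTE jk) sub0r.
have := FTC_line (V j) (ltr01 : (0 : R) < 1)
  (smooth_differentiable (tame_smooth tf)) (tame_continuous (proj2 (tame_derive tf) e)).
have -> : V j + (1 : R) *: e = segment (V j) (V k) 1 by rewrite segmentE.
have -> : V j + (0 : R) *: e = segment (V j) (V k) 0 by rewrite segmentE.
rewrite !fluxE !bary_segment !(bary_vertex a_gt0 V_equilateral) eqxx (negbTE jk).
have -> : 2 * z0 * ((1 - 1) * 1 + 1 * 0 - 2^-1) = - z0 by field.
have -> : 2 * z0 * ((1 - 0) * 1 + 0 * 0 - 2^-1) = z0 by field.
have -> : \int[leb]_(t in `[0, 1]) 'D_e (flux V j) (V j + t *: e) =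
    seg_int (fun x => 4 * z0 ^+ 2 * comp V j x) (V j) (V k).
  by apply: eq_Rintegral => t _; rewrite segmentE -/e flux_derive de; ring.
rewrite seg_intZ; last exact: (tame_continuous (comp_tame V j)).
rewrite sinN => h; apply: (mulfI (_ : 4 * z0 ^+ 2 != 0)).
  by rewrite mulf_neq0// expf_neq0.
by rewrite h; field.
Qed.

Lemma boundary_competitor_gt0 : 0 < boundary_int V (competitor V).
Proof.
have cc i : continuous (comp V i) by exact: (tame_continuous (comp_tame V i)).
have side i j k : i != j -> j != k -> k != i ->
    seg_int (competitor V) (V j) (V k) = cos z0 + 2 * (sin z0 / z0).
  move=> ij jk ki.
  rewrite (@eq_seg_int _ _ (fun x => comp V i x + (comp V j x + comp V k x))); last first.
    move=> t; rewrite /competitor big_I3; move: (segment _ _ _) => x {t}.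
    move: i j k ij jk ki; do 3 apply: I3P => //; move=> _ _ _; ring.
  rewrite !seg_intD//; last by move=> x; apply: cvgD; exact: cc.
  rewrite comp_side//; last by rewrite eq_sym.
  rewrite comp_vertex// (seg_intC (V j) (V k) (cc k)) comp_vertex; last by rewrite eq_sym.
  by ring.
rewrite (boundary_seg V_equilateral).
rewrite (side i2 i0 i1)// (side i0 i1 i2)// (side i1 i2 i0)//.
by have h := z0_sign; rewrite mulr_gt0// addr_gt0// addr_gt0.
Qed.

Lemma boundary_cst (c : R) : boundary_int V (fun=> c) = 3 * a * c.
Proof. by rewrite (boundary_seg V_equilateral) !seg_int_cst; ring. Qed.

End CompetitorSign.

(** * Extension of the Green formula to traces *)

Section TraceGreen.
Context {R : realType}.
Variables (a : R) (V : 'I_3 -> R * R).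
Hypotheses (a_gt0 : 0 < a) (V_equilateral : equilateral V a).
Implicit Types (x y e P Q S : R * R) (f phi psi : R * R -> R) (i j k l : 'I_3).
Notation leb := (@lebesgue_measure R).
Notation T := (open_triangle V).
Notation ipT := (ip (@leb2 R) T).
Notation sqiT := (sqi (@leb2 R) T).
Notation dirT := (dir V).
Notation mu2 := (mu2 a).

Local Opaque derive.

Let mT := triangle_measurable a_gt0 V_equilateral.

Lemma squeeze0 (f h : nat -> R) : (forall n, 0 <= f n <= h n) ->
  h @ \oo --> (0 : R) -> f @ \oo --> (0 : R).
Proof.
move=> fh h0; apply: (@squeeze_cvgr _ _ _ R (fun=> 0) h) => //; last exact: cvg_cst.
exact: nearW.
Qed.

Lemma cvg_ipT (F : nat -> R * R -> R) u q (e : nat -> R) :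
  (forall n, sqiT (F n)) -> sqiT u -> sqiT q ->
  (forall n, ipT (fun x => F n x - u x) (fun x => F n x - u x) <= e n) ->
  e @ \oo --> (0 : R) ->
  (fun n => ipT q (F n) - ipT q u) @ \oo --> (0 : R).
Proof.
move=> sF su sq le_e e0.
have -> : (fun n => ipT q (F n) - ipT q u) = (fun n => ipT (fun x => F n x - u x) q).
  by apply/funext => n; rewrite (ipBl mT)// !(ipC leb2 T q).
apply: (cvg_ip0 mT) => // [n|]; first exact: (sqiB mT).
by apply: squeeze0 e0 => n; rewrite ip_ge0 le_e.
Qed.

Lemma boundary_cvg (F : nat -> R * R -> R) (tau : R * R -> R) :
  (forall n, continuous (F n)) -> boundary_L2 V tau ->
  (fun n => boundary_int V (fun x => (F n x - tau x) ^+ 2)) @ \oo --> (0 : R) ->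
  (fun n => boundary_int V (F n) - boundary_int V tau) @ \oo --> (0 : R).
Proof.
move=> cF tau2 h0.
have mI : measurable (`[0, 1] : set (measurableTypeR R)) by exact: measurable_itv.
have cS n i : continuous (fun t => F n (side V i t)).
  exact: (comp_segment_continuous _).
have sF n i : sqi leb `[0, 1] (fun t => F n (side V i t)).
  split; first exact: measurable_funS (continuous_measurable_fun (cS n i)).
  apply: continuous_integrable01 => t; apply: cvgM; exact: cS.
have st i : sqi leb `[0, 1] (fun t => tau (side V i t)) by exact: tau2.
have s1 : sqi leb `[0, 1] (fun=> 1 : R).
  split; first exact: measurable_cst.
  by apply: continuous_integrable01 => t; exact: cst_continuous.
pose D n i t := F n (side V i t) - tau (side V i t).
have sD n i : sqi leb `[0, 1] (D n i) := sqiB mI (sF n i) (st i).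
have lenE i : side_length V i = a.
  by rewrite /side_length V_equilateral//; move: i; apply: I3P; rewrite ordS012.
have D0 i : (fun n => ip leb `[0, 1] (D n i) (D n i)) @ \oo --> (0 : R).
  apply: (squeeze0 _ (h := fun n => a^-1 * boundary_int V (fun x => (F n x - tau x) ^+ 2))).
    move=> n; rewrite ip_ge0 /= /boundary_int mulr_sumr.
    rewrite (eq_bigr (fun i => ip leb `[0, 1] (D n i) (D n i))).
      by rewrite (bigD1 i)//= lerDl sumr_ge0// => j _; rewrite ip_ge0.
    by move=> j _; rewrite lenE mulKf ?gt_eqF// ip_sqr.
  by rewrite -(mulr0 a^-1); apply: cvgM => //; exact: cvg_cst.
have -> : (fun n => boundary_int V (F n) - boundary_int V tau) =
    (fun n => \sum_(i < 3) a * ip leb `[0, 1] (D n i) (fun=> 1)).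
  apply/funext => n; rewrite /boundary_int -sumrB; apply: eq_bigr => i _.
  rewrite lenE -mulrBr; congr (a * _); rewrite (ipBl mI)//.
  by congr (_ - _); apply: eq_Rintegral => t _; rewrite mulr1.
rewrite -[X in _ --> X](_ : \sum_(i < 3) a * (0 : R) = 0); last first.
  by rewrite big1// => i _; rewrite mulr0.
rewrite big_I3; under eq_fun do rewrite big_I3.
by apply: cvgD; first apply: cvgD; apply: cvgM; try exact: cvg_cst; exact: (cvg_ip0 mI).
Qed.

(** [competitor_green] holds for the smooth functions that define the trace. Each of its terms pairs
    them, or their gradients, with a fixed square integrable function, hence passes to the limit. *)
Lemma trace_green u g tau : H1t V u g tau ->
  dirT (gradient (competitor V)) g - mu2 * ipT (competitor V) u =
  - flux_const a V * boundary_int V tau.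
Proof.
move=> [[su sg1 sg2 _] [tau2 [phi [sphi cu cg ctau]]]].
have tw := competitor_tame V; have [sw sw1 sw2 _] := tame_H1 a_gt0 V_equilateral tw.
have sm n := smooth_sqi a_gt0 V_equilateral (sphi n).
have sm1 n := smooth_sqi a_gt0 V_equilateral (smooth_derive (1, 0) (sphi n)).
have sm2 n := smooth_sqi a_gt0 V_equilateral (smooth_derive (0, 1) (sphi n)).
set w := competitor V in tw sw sw1 sw2 *.
have gE n : \int[leb2]_(x in T) dotp (gradient (phi n) x - g x) (gradient (phi n) x - g x) =
    ipT (fun x => d1 (phi n) x - (g x).1) (fun x => d1 (phi n) x - (g x).1) +
    ipT (fun x => d2 (phi n) x - (g x).2) (fun x => d2 (phi n) x - (g x).2).
  rewrite /ip -RintegralD//; first exact: (sqi_mul mT (sqiB mT (sm1 n) sg1) (sqiB mT (sm1 n) sg1)).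
  exact: (sqi_mul mT (sqiB mT (sm2 n) sg2) (sqiB mT (sm2 n) sg2)).
have c1 : (fun n => ipT (fun x => (gradient w x).1) (d1 (phi n)) -
     ipT (fun x => (gradient w x).1) (fun x => (g x).1)) @ \oo --> (0 : R).
  by apply: (cvg_ipT sm1 sg1 sw1 _ cg) => n; rewrite gE lerDl ip_ge0.
have c2 : (fun n => ipT (fun x => (gradient w x).2) (d2 (phi n)) -
     ipT (fun x => (gradient w x).2) (fun x => (g x).2)) @ \oo --> (0 : R).
  by apply: (cvg_ipT sm2 sg2 sw2 _ cg) => n; rewrite gE lerDr ip_ge0.
have c0 : (fun n => ipT w (phi n) - ipT w u) @ \oo --> (0 : R).
  by apply: (cvg_ipT sm su sw _ cu) => n; rewrite ip_sqr.
have cb := boundary_cvg (fun n => smooth_continuous (sphi n)) tau2 ctau.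
set L := (RHS); apply/eqP; rewrite -subr_eq0; apply/eqP.
(* By [competitor_green] this sequence is constant, equal to minus the expression to be shown zero,
   so its limit decides the claim. *)
have C : (fun n => (ipT (fun x => (gradient w x).1) (d1 (phi n)) -
     ipT (fun x => (gradient w x).1) (fun x => (g x).1)) +
   (ipT (fun x => (gradient w x).2) (d2 (phi n)) -
     ipT (fun x => (gradient w x).2) (fun x => (g x).2)) -
   mu2 * (ipT w (phi n) - ipT w u) +
   flux_const a V * (boundary_int V (phi n) - boundary_int V tau)) @ \oo --> 
   (0 + 0 - mu2 * 0 + flux_const a V * 0 : R).
  apply: cvgD; last by apply: cvgM => //; exact: cvg_cst.
  apply: cvgB; last by apply: cvgM => //; exact: cvg_cst.
  exact: cvgD.
rewrite !mulr0 subr0 !addr0 in C.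
apply: oppr_inj; rewrite oppr0; apply: (@cvg_unique _ (@Rhausdorff R) _ _ _ _ _ C).
rewrite (_ : (fun n => _) = fun=> - (dirT (gradient w) g - mu2 * ipT w u - L)).
  exact: cvg_cst.
apply/funext => n; have := competitor_green a_gt0 V_equilateral (sphi n).
rewrite -/w /L /dir /=.
by move=> /(canRL (subrK _)) /(canRL (addrK _)) ->; ring.
Qed.

End TraceGreen.

Lemma ae_imply2 d (S : measurableType d) (R : realType)
    (m : {measure set S -> \bar R}) (P Q Z : S -> Prop) :
  (forall x, P x -> Q x -> Z x) -> {ae m, forall x, P x} -> {ae m, forall x, Q x} ->
  {ae m, forall x, Z x}.
Proof. by move=> PQZ hP hQ; apply: filterS2 hP hQ. Qed.

(** * The deficit inequality and the second Neumann eigenvalue *)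

Section Spectrum.
Context {R : realType}.
Variables (a : R) (V : 'I_3 -> R * R).
Hypotheses (a_gt0 : 0 < a) (V_equilateral : equilateral V a).
Implicit Types (x y : R * R) (f p q u v l tau : R * R -> R) (g h : R * R -> R * R) (i j : 'I_3).
Notation plane := (measurableTypeR R * measurableTypeR R)%type.
Notation leb := (@lebesgue_measure R).
Notation T := (open_triangle V).
Notation ipT := (ip (@leb2 R) T).
Notation sqiT := (sqi (@leb2 R) T).
Notation dirT := (dir V).
Notation mu2 := (mu2 a).

Local Opaque derive.

Let mT := triangle_measurable a_gt0 V_equilateral.
Let tsqi := tame_sqi a_gt0 V_equilateral.

Lemma triangle_nbhs x : T x -> \forall y \near x, T y.
Proof.
rewrite (open_triangleE a_gt0 V_equilateral) => Tx.
have pos i : \forall y \near x, 0 < bary V i y.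
  exact: (cvgr_gt (bary V i x) (@bary_continuous _ V i x) 0 (Tx i)).
near=> y; move=> i; move: i; apply: I3P; near: y; exact: pos.
Unshelve. all: by end_near.
Qed.

(** With zero norm [p] would vanish off a null set, yet by continuity it is nonzero on a whole
    square around [x]. *)
Lemma continuous_ip_gt0 p x : continuous p -> T x -> p x != 0 -> 0 < ipT p p.
Proof.
move=> cp Tx px; rewrite lt_def ip_ge0 andbT; apply/eqP => p0.
have sp := continuous_sqi a_gt0 V_equilateral cp.
have [A [mA A0 sA]] := ip_eq0_ae mT sp p0.
have : \forall y \near x, T y /\ p y != 0.
  near=> y; split; near: y; first exact: triangle_nbhs.
  exact: (cvgr_neq0 (p x) (cp x) px).
move=> /nbhs_ballP[e /= e0 he].
pose I (r : R) : set (measurableTypeR R) := [set` `]r - e, r + e[].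
have mI r : measurable (I r) by exact: measurable_itv.
have mB : measurable (I x.1 `*` I x.2 : set plane) by exact: measurableX.
have BA : I x.1 `*` I x.2 `<=` A.
  move=> y [/= y1 y2]; apply: sA => /= h.
  have [Ty /eqP] : T y /\ p y != 0; last by apply; exact: h.
  apply: he; split; rewrite /ball /= ltr_distlC;
    by [move: y1; rewrite /I /= in_itv|move: y2; rewrite /I /= in_itv].
have IE r : leb (I r) = (2 * e)%:E.
  rewrite /I lebesgue_measure_itv /= lte_fin ifT; last by lra.
  by rewrite -EFinD; congr EFin; ring.
have : (@leb2 R (I x.1 `*` I x.2) <= leb2 A)%E.
  by apply: le_measure => //; rewrite inE.
have -> : leb2 (I x.1 `*` I x.2) = (leb (I x.1) * leb (I x.2))%E.
  exact: product_measure1E.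
rewrite A0 !IE -EFinM lee_fin leNgt; move/negP; apply.
by rewrite mulr_gt0// mulr_gt0.
Unshelve. all: by end_near.
Qed.

Lemma eigX_gt0 : 0 < ipT (eigX V) (eigX V).
Proof.
(* At the point with coordinates [1/2, 1/4, 1/4] the angles are [pi/6], [2 pi/3] and [- 5 pi/6]: the
   first and third cosines cancel and [cos (2 pi/3)] remains. *)
pose c i : R := if i == i0 then 2^-1 else 4^-1.
have c1 : \sum_(i < 3) c i = 1 by rewrite big_I3 /c /=; field.
pose x := \sum_(i < 3) c i *: V i.
have bE i : bary V i x = c i by exact: (bary_of_comb a_gt0 V_equilateral).
apply: (@continuous_ip_gt0 _ x).
- exact: (tame_continuous (orb_tame V _ _)).
- rewrite (open_triangleE a_gt0 V_equilateral) => i /=.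
  by rewrite bE /c; case: ifP => _; rewrite invr_gt0.
- rewrite /eigX orb_unitE big_I3 !addr0 /ang !ordS012 !bE /ang_shift /c /=.
  set y := 2 * pi / 3 * (2^-1 - 4^-1 + _).
  have -> : 2 * pi / 3 * (4^-1 - 2^-1 + - 1) = y - pi by rewrite /y; field.
  have -> : 2 * pi / 3 * (4^-1 - 4^-1 + 1) = pi / 6 + pi / 2 :> R by field.
  rewrite cosB cospi sinpi mulr0 addr0 mulrN1 addrAC subrr add0r.
  rewrite cosDpihalf mulf_neq0// oppr_eq0 gt_eqF// sin_gt0_pi//.
  by have := pi_gt0 R; lra.
Qed.

Lemma gradient_cst (c : R) x : gradient (fun=> c) x = 0.
Proof. by rewrite /gradient /d1 /d2 !derive_cst. Qed.

Let s1 : sqiT (fun=> 1) := tsqi (tame_cst 1).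

Lemma dir_cst u g (c : R) : H1 T u g -> dirT g (gradient (fun=> c)) = 0.
Proof.
move=> _; rewrite dirC /dir.
by rewrite !(@eq_ip _ _ _ leb2 T _ _ (fun=> 0) _ _ (fun _ _ => erefl)) ?ip0l ?addr0//
  => x _; rewrite gradient_cst.
Qed.

Lemma ip1E u : ipT u (fun=> 1) = \int[leb2]_(x in T) u x.
Proof. by apply: eq_Rintegral => x _; rewrite mulr1. Qed.

(** The constant sequence [p] realizes the trace. Letting [u] agree with [p] only up to zero norm
    covers Neumann eigenfunctions, which are known only almost everywhere. *)
Lemma tame_trace u p : tame p -> ipT (fun x => p x - u x) (fun x => p x - u x) = 0 ->
  trace_of V u (gradient p) p.
Proof.
move=> tp pu; have cp := tame_continuous tp; split=> [i|].
  have cs : continuous (fun t => p (side V i t)) by exact: (comp_segment_continuous _).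
  split; first exact: measurable_funS (continuous_measurable_fun cs).
  by apply: continuous_integrable01 => t; apply: cvgM; exact: cs.
have cst0 (k : R) : k = 0 -> (fun=> k) @ \oo --> (0 : R) by move=> ->; exact: cvg_cst.
exists (fun=> p); split; first by move=> _; exact: tame_smooth.
- by apply: cst0; rewrite -ip_sqr.
- apply: cst0; rewrite -(ip0l (@leb2 R) mT (fun=> 0)); apply: eq_Rintegral => x _.
  by rewrite subrr /dotp !mulr0 addr0.
- apply: cst0; rewrite -[RHS](mulr0 (3 * a)) -(boundary_cst V_equilateral).
  by congr boundary_int; apply/funext => x; rewrite subrr expr0n.
Qed.

Lemma tame_H1t p : tame p -> H1t V p (gradient p) p.
Proof.
move=> tp; split; first exact: (tame_H1 a_gt0 V_equilateral).
apply: tame_trace => //; rewrite -(ip0l (@leb2 R) mT (fun=> 0)).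
by apply: eq_Rintegral => x _; rewrite subrr.
Qed.

Notation w := (competitor V).
Let tw := competitor_tame V.
Let H1w := tame_H1 a_gt0 V_equilateral tw.

(** Green's formula against the constant 1 reads [mu2 * \int w = flux_const * 3 a]. *)
Lemma competitor_mean_gt0 : 0 < ipT w (fun=> 1).
Proof.
have := trace_green a_gt0 V_equilateral (tame_H1t (tame_cst 1)).
rewrite (dir_cst _ H1w) sub0r (boundary_cst V_equilateral) mulr1 mulNr => /oppr_inj h.
have m := mu2_gt0 a_gt0; have f := flux_const_gt0 a_gt0 V_equilateral.
by rewrite -(pmulr_rgt0 _ m) h mulr_gt0// mulr_gt0.
Qed.

(** A triangle of zero area would force the mean of the competitor to vanish, by Cauchy-Schwarz. *)
Lemma one_gt0 : 0 < ipT (fun=> 1) (fun=> 1).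
Proof.
have sw := H1_sqi H1w; have := cauchy_schwarz mT sw s1.
rewrite lt_def ip_ge0 andbT => h; apply/eqP => h0; move: h; rewrite h0 mulr0.
by apply/negP; rewrite -ltNge exprn_gt0// competitor_mean_gt0.
Qed.

(** The left-hand side is kept, rather than only its sign: it is what makes the mean of [u] vanish
    in the case of equality. *)
Lemma H1t_deficit u g tau : H1t V u g tau -> boundary_int V tau = 0 ->
  (ipT u (fun=> 1) / ipT w (fun=> 1)) ^+ 2 * (flux_const a V * boundary_int V w) <=
  dirT g g - mu2 * ipT u u.
Proof.
move=> Hu tau0; set t := _ / _; have HuH := proj1 Hu.
have := trace_green a_gt0 V_equilateral Hu; rewrite tau0 mulr0 => Qu.
have Qw := trace_green a_gt0 V_equilateral (tame_H1t tw).
have su := H1_sqi HuH; have sw := H1_sqi H1w.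
have Hv := H1_lin a_gt0 V_equilateral (- t) HuH H1w.
have sv := H1_sqi Hv.
have := poincare a_gt0 V_equilateral Hv.
have wm := competitor_mean_gt0.
rewrite (ip_linl a_gt0 V_equilateral)// mulNr /t divfK ?gt_eqF// subrr => /(_ erefl).
rewrite -/t (ip_linl a_gt0 V_equilateral)// (dir_linl a_gt0 V_equilateral _ HuH H1w Hv).
rewrite !(dirC _ _ (fun x => g x + _)) !(ipC leb2 T _ (fun x => u x + _)).
rewrite !(ip_linl a_gt0 V_equilateral)// (dir_linl a_gt0 V_equilateral _ HuH H1w HuH).
rewrite (dir_linl a_gt0 V_equilateral _ HuH H1w H1w).
rewrite (dirC _ g) (ipC leb2 T u w).
move: Qu Qw; set A := dirT _ _; set B := ipT w u; set C := dirT _ _; set D := ipT w w.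
set E := boundary_int V w; set F := flux_const a V.
set G := dirT g g; set H := ipT u u => Qu Qw h.
have -> : F * E = - (C - mu2 * D) by rewrite Qw; ring.
rewrite -subr_ge0 in h; rewrite -subr_ge0.
suff : (G - mu2 * H - t ^+ 2 * - (C - mu2 * D)) =
  G + - t * A + - t * (A + - t * C) - mu2 * (H + - t * B + - t * (B + - t * D)) +
  2 * t * (A - mu2 * B) by rewrite Qu mulr0 addr0 => ->.
by ring.
Qed.

Lemma level0_eigen N p : level0 V N p -> forall v h, H1 T v h ->
  dirT (gradient p) h = mu2 * N%:R * ipT p v.
Proof.
move=> lp v h Hv; have [tp _ hp] := weak_neumann_level0 a_gt0 V_equilateral lp.
by rewrite (hp _ _ Hv) (ipZl mT)//; [exact: tsqi|exact: H1_sqi Hv].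
Qed.

Lemma level0_eigenspace N p : level0 V N p -> neumann_eigenspace T (mu2 * N%:R) p.
Proof.
move=> lp; have Hp := tame_H1 a_gt0 V_equilateral (level0_tame lp).
exists (gradient p); split=> // v h Hv.
by rewrite (dirE a_gt0 V_equilateral Hp Hv) (level0_eigen lp Hv).
Qed.

(** Testing the Neumann equation of [p] with the competitor gives [Q(w, p) = 0], while [trace_green]
    evaluates the same quantity as a nonzero multiple of the boundary integral. *)
Lemma level1_boundary p : level0 V 1 p -> boundary_int V p = 0.
Proof.
move=> lp; have tp := level0_tame lp.
have := trace_green a_gt0 V_equilateral (tame_H1t tp).
rewrite dirC (level0_eigen lp H1w) mulr1 (ipC leb2 T p w) subrr => /esym/eqP.
have f := flux_const_gt0 a_gt0 V_equilateral.
by rewrite mulf_eq0 oppr_eq0 (gt_eqF f) /= => /eqP.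
Qed.

Lemma inf_min (E : set R) (m : R) : E m -> lbound E m -> inf E = m.
Proof.
move=> Em lbm; apply/eqP; rewrite eq_le; apply/andP; split.
  by apply: ge_inf => //; exists m.
by apply: lb_le_inf => //; exists m.
Qed.

Lemma level1_mean p : level0 V 1 p -> ipT p (fun=> 1) = 0.
Proof.
move=> lp; apply: (level_orth a_gt0 V_equilateral lp (N' := 0%N)) => //.
by right; exact: level_cst.
Qed.

Let lX : level0 V 1 (eigX V) := or_intror (eigX_level V).

Lemma not_ae_zero_gt0 u : sqiT u -> ~ ae_zero T u -> 0 < ipT u u.
Proof.
move=> su nz; rewrite lt_def ip_ge0 andbT; apply/eqP => u0; apply: nz.
exact: ip_eq0_ae u0.
Qed.

(** The constant 1 and [eigX] are two independent eigenfunctions up to [mu2]. Below [mu2],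
    [neumann_low] makes every eigenfunction constant almost everywhere, and two constants are
    dependent. *)
Lemma neumann_muE : neumann_mu T 2 = mu2.
Proof.
apply: inf_min => [|r [u [ind eig]]].
- have sX := tsqi (level0_tame lX).
  exists (fun i : 'I_2 => if i == ord0 then fun=> 1 else eigX V); split.
    move=> c; rewrite /ae_zero => c0.
    pose q x : R := c ord0 * 1 + c ord_max * eigX V x.
    have q0 : {ae leb2, forall x, T x -> q x = 0}.
      by apply: (ae_imply2 _ c0 c0) => x h _ Tx; rewrite -h// !big_ord_recl big_ord0 addr0 /q;
        congr (_ + c _ * _); exact/val_inj.
    have sq : sqiT q by apply: (sqiD mT); exact: (sqiZ mT).
    have ipq f : sqiT f -> c ord0 * ipT (fun=> 1) f + c ord_max * ipT (eigX V) f = 0.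
      move=> sf; rewrite -(ae_eq0_ip mT sq sf q0) /q (ipDl mT)//; try exact: (sqiZ mT).
      by rewrite !(ipZl mT).
    have := ipq _ s1; rewrite (level1_mean lX) mulr0 addr0 => /eqP.
    rewrite mulf_eq0 (gt_eqF one_gt0) orbF => /eqP c00.
    have := ipq _ sX; rewrite c00 mul0r add0r => /eqP.
    rewrite mulf_eq0 (gt_eqF eigX_gt0) orbF => /eqP c10 i.
    have [->//|i0] := eqVneq i ord0; rewrite -c10; congr c; apply/val_inj.
    by case: i i0 => -[|[|]].
  move=> i; case: ifP => _.
    exists (mu2 * 0%:R); first by rewrite mulr0 ltW// mu2_gt0.
    by apply: level0_eigenspace; right; exact: level_cst.
  exists (mu2 * 1%:R); last exact: (level0_eigenspace lX).
  by rewrite mulr1.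
- rewrite leNgt; apply/negP => rm.
  have cst (i : 'I_2) : exists c : R, {ae leb2, forall x, T x -> u i x - c = 0}.
    have [l lr [g [Hu wu]]] := eig i.
    have [|c hc] := @neumann_low _ _ _ a_gt0 V_equilateral l (u i) _ (ex_intro _ g (conj Hu wu)).
      exact: le_lt_trans rm.
    exists c; apply: (ip_eq0_ae mT _ hc); apply: (sqiB mT (H1_sqi Hu)).
    exact/tsqi/tame_cst.
  have [c0 h0] := cst ord0; have [c1 h1] := cst ord_max.
  have dep (x0 x1 : R) : x0 * c0 + x1 * c1 = 0 -> x0 = 0 /\ x1 = 0.
    move=> xc; have := ind (fun i : 'I_2 => if i == ord0 then x0 else x1).
    have z : ae_zero T (fun x => \sum_(i < 2) (if i == ord0 then x0 else x1) * u i x).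
      apply: (ae_imply2 _ h0 h1) => x /[swap] + /[swap] Tx => /(_ Tx)/eqP.
      rewrite subr_eq0 => /eqP e1 /(_ Tx)/eqP; rewrite subr_eq0 => /eqP e0.
      rewrite !big_ord_recl big_ord0 addr0 /=.
      have -> : lift ord0 ord0 = ord_max :> 'I_2 by exact/val_inj.
      by rewrite e0 e1.
    by move=> /(_ z) H; split; [exact: (H ord0)|exact: (H ord_max)].
  (* The relation [c1 * u_0 - c0 * u_1 = 0] forces both constants to be 0; then [u_0] itself
     vanishes, and the coefficients [1, 0] give the contradiction. *)
  have [|c10 c00] := dep c1 (- c0); first by ring.
  have [|/eqP] := dep 1 0; last by rewrite oner_eq0.
  by rewrite mul0r addr0 mul1r -[LHS]opprK c00 oppr0.
Qed.

End Spectrum.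

(** * The value of kappa1 and equality of the eigenspaces *)

Section Equality.
Context {R : realType}.
Variables (a : R) (V : 'I_3 -> R * R).
Hypotheses (a_gt0 : 0 < a) (V_equilateral : equilateral V a).
Implicit Types (x y : R * R) (f p q u v l tau : R * R -> R) (g h : R * R -> R * R) (i j : 'I_3).
Notation T := (open_triangle V).
Notation ipT := (ip (@leb2 R) T).
Notation sqiT := (sqi (@leb2 R) T).
Notation dirT := (dir V).
Notation mu2 := (mu2 a).

Local Opaque derive.

Let mT := triangle_measurable a_gt0 V_equilateral.
Let tsqi := tame_sqi a_gt0 V_equilateral.

Let s1 : sqiT (fun=> 1) := tsqi (tame_cst 1).
Let lX : level0 V 1 (eigX V) := or_intror (eigX_level V).
Let lY : level0 V 1 (eigY V) := or_intror (eigY_level V).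
Notation w := (competitor V).

Let boundary_gain : 0 < flux_const a V * boundary_int V w.
Proof.
by rewrite mulr_gt0//; [exact: flux_const_gt0|exact: (boundary_competitor_gt0 a_gt0)].
Qed.

(** The infimum is attained at [eigX], which is its own trace and has zero boundary mean; the lower
    bound is [H1t_deficit]. *)
Lemma kappa1E : kappa1 V = mu2.
Proof.
have tX := level0_tame lX; have HX := tame_H1t a_gt0 V_equilateral tX.
have X0 := eigX_gt0 a_gt0 V_equilateral.
apply: inf_min => [|q [u [g [tau [Hu nz tau0 ->]]]]].
- exists (eigX V), (gradient (eigX V)), (eigX V); split=> //.
  + move=> /(ae_eq0_ip mT (tsqi tX) (tsqi tX)) h.
    by move: X0; rewrite h ltxx.
  + exact: (level1_boundary a_gt0 V_equilateral lX).
  + rewrite (dirE a_gt0 V_equilateral (proj1 HX) (proj1 HX)).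
    rewrite (level0_eigen a_gt0 V_equilateral lX (proj1 HX)) mulr1 -ip_sqr mulfK//.
    by rewrite gt_eqF.
- have su := H1_sqi (proj1 Hu); have u0 := not_ae_zero_gt0 a_gt0 V_equilateral su nz.
  rewrite -ip_sqr (dirE a_gt0 V_equilateral (proj1 Hu) (proj1 Hu)) ler_pdivlMr//.
  rewrite -subr_ge0; apply: le_trans (H1t_deficit a_gt0 V_equilateral Hu tau0).
  by rewrite mulr_ge0 ?sqr_ge0// ltW.
Qed.

(** The given equation tests only functions with a trace, the wanted one all of H^1. Tested with [u]
    itself it gives [Q(u, u) = 0], so the deficit forces [u] to have mean zero. On mean zero
    functions Q is semidefinite by [poincare], and Cauchy-Schwarz for Q yields [Q(u, v) = 0] for all
    of them. *)
Lemma bmz_neumann u : bmz_eigenspace V mu2 u -> neumann_eigenspace T mu2 u.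
Proof.
move=> [g [tau [Hu tau0 wu]]]; have HuH := proj1 Hu; have su := H1_sqi HuH.
exists g; split=> //.
have Qu : dirT g g - mu2 * ipT u u = 0.
  have := wu _ _ _ Hu; rewrite tau0 mulr0 subr0 (dirE a_gt0 V_equilateral HuH HuH) => ->.
  by rewrite subrr.
have um : ipT u (fun=> 1) = 0.
  have := H1t_deficit a_gt0 V_equilateral Hu tau0; rewrite Qu pmulr_lle0//.
  rewrite le_eqVlt ltNge sqr_ge0 orbF sqrf_eq0 mulf_eq0 invr_eq0.
  by rewrite (gt_eqF (competitor_mean_gt0 a_gt0 V_equilateral)) orbF => /eqP.
have Qpos p (q : R * R -> R * R) : H1 T p q -> ipT p (fun=> 1) = 0 -> 0 <= dirT q q - mu2 * ipT p p.
  by move=> Hp pm; rewrite subr_ge0 (poincare a_gt0 V_equilateral Hp).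
have Qmean v' (h' : R * R -> R * R) : H1 T v' h' -> ipT v' (fun=> 1) = 0 ->
    dirT g h' - mu2 * ipT u v' = 0.
  move=> Hv' vm; have sv' := H1_sqi Hv'.
  apply/eqP; rewrite -sqrf_eq0 eq_le sqr_ge0 andbT.
  rewrite -(mul0r (dirT h' h' - mu2 * ipT v' v')).
  apply: quadratic_ge0_discr; last exact: Qpos.
  move=> t; have Ht := H1_lin a_gt0 V_equilateral t HuH Hv'.
  have := Qpos _ _ Ht; rewrite (ip_linl a_gt0 V_equilateral)// um vm mulr0 addr0.
  move=> /(_ erefl); have st := H1_sqi Ht.
  rewrite (ip_linl a_gt0 V_equilateral)// (dir_linl a_gt0 V_equilateral _ HuH Hv' Ht).
  rewrite !(dirC _ _ (fun x => g x + _)) !(ipC leb2 T _ (fun x => u x + _)).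
  rewrite !(ip_linl a_gt0 V_equilateral)// (dir_linl a_gt0 V_equilateral _ HuH Hv' HuH).
  rewrite (dir_linl a_gt0 V_equilateral _ HuH Hv' Hv').
  rewrite (dirC _ h' g) (ipC leb2 T v' u) => H0.
  apply: le_trans H0 _; rewrite le_eqVlt; apply/orP; left; apply/eqP.
  move: Qu; set A := dirT g g; set B := ipT u u; set C := dirT g h'; set D := ipT u v'.
  move=> /(canRL (subrK _)) ->; ring.
move=> v h Hv; have sv := H1_sqi Hv.
(* Subtracting its mean from [v] changes neither side: constants have zero gradient and [u] has mean
   zero. *)
pose c : R := ipT v (fun=> 1) / ipT (fun=> 1) (fun=> 1).
have Hc := tame_H1 a_gt0 V_equilateral (tame_cst (1 : R)).
have Hv' := H1_lin a_gt0 V_equilateral (- c) Hv Hc.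
set v' := (fun x => v x + _) in Hv'; set h' := (fun x => h x + _) in Hv'.
have sv' := H1_sqi Hv'.
have vm : ipT v' (fun=> 1) = 0.
  rewrite /v' (ip_linl a_gt0 V_equilateral)// mulNr /c divfK ?subrr//.
  by rewrite gt_eqF// (one_gt0 a_gt0 V_equilateral).
have Quv := Qmean _ _ Hv' vm.
rewrite (dirE a_gt0 V_equilateral HuH Hv).
have -> : dirT g h = dirT g h'.
  rewrite (dirC _ g h') (dir_linl a_gt0 V_equilateral _ Hv Hc HuH) (dirC _ _ g).
  by rewrite (dirC _ (gradient _)) (dir_cst a_gt0 V_equilateral _ HuH) mulr0 addr0.
move: Quv => /(canRL (subrK _)); rewrite add0r => ->; congr (_ * _).
rewrite (ipC leb2 T u v') (ip_linl a_gt0 V_equilateral)// (ipC leb2 T (fun=> 1) u).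
by rewrite um mulr0 addr0 ipC.
Qed.

(** Almost everywhere [u] is a combination [p] of [eigX] and [eigY], which supplies a weak gradient
    and a trace. The boundary integral of [p] is 0, and so is its mean, which removes the extra term
    of the equation. *)
Lemma neumann_bmz u : neumann_eigenspace T mu2 u -> bmz_eigenspace V mu2 u.
Proof.
move=> eu; have [g [Hu _]] := eu; have su := H1_sqi Hu.
have [r [t]] := neumann_mu2 a_gt0 V_equilateral eu.
pose p x := r * eigX V x + t * eigY V x.
have lp : level0 V 1 p by apply: level0_add; apply: level0_scale.
have tp := level0_tame lp; have sp := tsqi tp.
rewrite -/(p _) => /= up.
have upf f : sqiT f -> ipT p f = ipT u f.
  move=> sf; apply/esym/eqP; rewrite -subr_eq0 -(ipBl mT)//; apply/eqP.
  apply: (ae_eq0_ip mT _ sf (ip_eq0_ae mT _ up)); exact: (sqiB mT).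
have HpH := tame_H1 a_gt0 V_equilateral tp.
have Hup : H1 T u (gradient p) := H1_ae_eq a_gt0 V_equilateral su upf HpH.
exists (gradient p), p; split.
- split=> //; apply: (tame_trace a_gt0 V_equilateral tp); rewrite -[RHS]up.
  by apply: eq_Rintegral => x _; rewrite -mulrNN !opprB.
- exact: (level1_boundary a_gt0 V_equilateral lp).
- move=> v h s [Hv _]; rewrite (dirE a_gt0 V_equilateral HpH Hv).
  rewrite (level0_eigen a_gt0 V_equilateral lp Hv) mulr1 upf; last exact: H1_sqi Hv.
  by rewrite -(ip1E V u) -(upf _ s1) (level1_mean a_gt0 V_equilateral lp) mulr0 mul0r subr0.
Qed.

End Equality.

Theorem theorem6p2 (R : realType) (a : R) (V : 'I_3 -> R * R)
    (a_gt0 : 0 < a) (V_equilateral : equilateral V a) :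
  [/\ kappa1 V = neumann_mu (open_triangle V) 2,
      neumann_mu (open_triangle V) 2 = 16 * pi ^+ 2 / (9 * a ^+ 2) &
      bmz_eigenspace V (kappa1 V)
        = neumann_eigenspace (open_triangle V)
            (neumann_mu (open_triangle V) 2)].
Proof.
rewrite (kappa1E a_gt0 V_equilateral) (neumann_muE a_gt0 V_equilateral); split=> //.
apply/seteqP; split=> u; first exact: bmz_neumann.
exact: neumann_bmz.
Qed.
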